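(* Let $\Omega\subset\mathbb{R}^2$ be open and bounded with $\partial\Omega\in C^{0,1}$, let $0<\gamma<\infty$, and let $\rho$ be as described in the context. Let $u\in\mathcal{A}_{u_0}$ satisfy $$\int_\Omega\big(\nabla u+\rho'(\det\nabla u)\,\mathrm{cof}\,\nabla u\big)\cdot\nabla\varphi\,dx=0\qquad\text{for all }\varphi\in C_c^\infty(\Omega,\mathbb{R}^2).$$ Then $u$ is locally Hölder continuous, i.e. there exists $\alpha\in(0,1)$ such that $u\in C^{0,\alpha}_{loc}(\Omega,\mathbb{R}^2)$.
   Context: The function $\rho\in C^\infty(\mathbb{R})$ is given by $\rho(s)=0$ for $s\le 0$, $\rho(s)=\rho_1(s)$ for $0\le s\le s_0$, and $\rho(s)=\gamma s+\kappa$ for $s\ge s_0$, where $\gamma>0$, $s_0\ge0$, $\kappa\ge-\gamma s_0$ are constants and $\rho_1:[0,s_0]\to\mathbb{R}$ is smooth and convex with $\rho_1(0)=0$, $\rho_1(s_0)=\gamma s_0+\kappa$, the pieces being connected so that $\rho$ is smooth on $\mathbb{R}$; $\rho$ is convex on $\mathbb{R}$. $\mathcal{A}_{u_0}=\{u\in W^{1,2}(\Omega,\mathbb{R}^2): u=u_0\text{ on }\partial\Omega\text{ in the trace sense}\}$ for a given boundary datum $u_0$. For $A\in\mathbb{R}^{2\times2}$, $\mathrm{cof}\,A=\begin{pmatrix}a_{22}&-a_{21}\\-a_{12}&a_{11}\end{pmatrix}$, and $\cdot$ is the Frobenius inner product. The displayed equation is the weak Euler–Lagrange equation of $I(u)=\int_\Omega\frac12|\nabla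 u|^2+\rho(\det\nabla u)\,dx$. *)

(* Defs.v *)
From HB Require Import structures.
From mathcomp Require Import all_boot all_order all_algebra.
From mathcomp Require Import all_classical all_reals all_analysis.

Set Implicit Arguments.
Unset Strict Implicit.
Unset Printing Implicit Defensive.

Import Order.TTheory GRing.Theory Num.Theory.
Import numFieldNormedType.Exports.

Local Open Scope classical_set_scope.
Local Open Scope ring_scope.

Notation plane R := (R * R)%type (only parsing).

Notation leb2 R := ((@lebesgue_measure R) \x (@lebesgue_measure R))%E.

Section Algebra.
Variable R : realType.

(* The norm that the library puts on R * R and on matrices is the maximum norm. *)
Definition enorm (x : plane R) : R := Num.sqrt (x.1 ^+ 2 + x.2 ^+ 2).

Definition frobenius m n (A B : 'M[R]_(m, n)) : R :=
  \sum_i \sum_j A i j * B i j.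

Definition frobenius_norm m n (A : 'M[R]_(m, n)) : R :=
  Num.sqrt (frobenius A A).

Definition cof (A : 'M[R]_2) : 'M[R]_2 := \matrix_(i, j) cofactor A i j.

(* Entries are numbered from 0. *)
Lemma cofE (A : 'M[R]_2) :
  [/\ cof A 0 0 = A 1 1, cof A 0 1 = - A 1 0,
      cof A 1 0 = - A 0 1 & cof A 1 1 = A 0 0].
Proof.
have e (i j : 'I_2) : cof A i j = (-1) ^+ (i + j) * A (lift i 0) (lift j 0).
  by rewrite mxE /cofactor det_mx11 !mxE.
have l0 : lift (0 : 'I_2) (0 : 'I_1) = 1 by apply: val_inj.
have l1 : lift (1 : 'I_2) (0 : 'I_1) = 0 by apply: val_inj.
by split; rewrite e ?l0 ?l1 /= ?expr0 ?expr1 ?mul1r ?mulN1r // expr2 mulrNN !mul1r.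
Qed.

End Algebra.

Section Smoothness.
Variable R : realType.

Definition basis_vector (j : 'I_2) : plane R := if j == 0 then (1, 0) else (0, 1).

Definition partial (j : 'I_2) (f : plane R -> R) : plane R -> R :=
  fun x => 'D_(basis_vector j) f x.

Fixpoint is_Ck (k : nat) (f : plane R -> R) : Prop :=
  continuous f /\
  if k is k'.+1 then
    forall j, (forall x, derivable f x (basis_vector j)) /\ is_Ck k' (partial j f)
  else True.

Definition smooth2 (f : plane R -> R) : Prop := forall k, is_Ck k f.

Definition smooth1 (f : R -> R) : Prop :=
  forall (k : nat) (x : R), derivable (derive1n k f) x 1.

Definition component (u : plane R -> 'cV[R]_2) (i : 'I_2) : plane R -> R :=
  fun x => u x i 0.

Definition entry (F : plane R -> 'M[R]_2) (i j : 'I_2) : plane R -> R :=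
  fun x => F x i j.

Definition gradient (u : plane R -> 'cV[R]_2) (x : plane R) : 'M[R]_2 :=
  \matrix_(i, j) partial j (component u i) x.

Definition test_function (Omega : set (plane R)) (psi : plane R -> R) : Prop :=
  let supp := closure [set x | psi x != 0] in
  [/\ smooth2 psi, compact supp & supp `<=` Omega].

End Smoothness.

Section Sobolev.
Variable R : realType.
Implicit Types (Omega : set (plane R)) (u : plane R -> 'cV[R]_2).

Definition square_integrable Omega (f : plane R -> R) : Prop :=
  f \_ Omega \in Lfun (leb2 R) 2%:E.

(* u is in W^{1,2}(Omega, R^2) and Du, with Du i j = d_j u_i, represents its
   weak gradient, which is determined only up to a null set. *)
Definition W12_with_gradient Omega u (Du : plane R -> 'M[R]_2) : Prop :=
  [/\ forall i, square_integrable Omega (component u i),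
      forall i j, square_integrable Omega (entry Du i j) &
      forall (psi : plane R -> R) (i j : 'I_2), test_function Omega psi ->
        \int[leb2 R]_(x in Omega) (u x i 0 * partial j psi x) =
        - \int[leb2 R]_(x in Omega) (Du x i j * psi x)].

Definition W12 Omega u : Prop := exists Du, W12_with_gradient Omega u Du.

End Sobolev.

(* The boundary measure for traces: the one-dimensional Hausdorff measure of
   the Euclidean plane, restricted to its Caratheodory sigma-algebra. *)
Section Hausdorff.
Variable R : realType.
Local Open Scope ereal_scope.

(* 0 is added so that the empty set has diameter 0 rather than -oo. *)
Definition diameter (A : set (plane R)) : \bar R :=
  ereal_sup (0 |` [set (enorm (xy.1 - xy.2)%R)%:E | xy in A `*` A]).

Definition small_diameter (delta : R) (A : set (plane R)) : \bar R :=
  if diameter A <= delta%:E then diameter A else +oo.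

(* In g_sigma_algebraType setT every set is measurable, so mu_ext ranges over
   all countable covers; the penalty +oo discards those that use a set of
   diameter greater than delta. *)
Definition hausdorff_content (delta : R) (A : set (plane R)) : \bar R :=
  mu_ext (T := g_sigma_algebraType [set: set (plane R)])
    (small_diameter delta) A.

Definition hausdorff1 (A : set (plane R)) : \bar R :=
  ereal_sup [set hausdorff_content delta A | delta in [set d : R | (0 < d)%R]].

Let diameter_ge0 A : 0 <= diameter A.
Proof. by apply: ereal_sup_ubound; left. Qed.

Let diameter0 : diameter set0 = 0.
Proof.
rewrite /diameter set0X image_set0 setU0; exact: ereal_sup1.
Qed.

Let small_diameter_ge0 delta A : 0 <= small_diameter delta A.
Proof. by rewrite /small_diameter; case: ifP => // _; exact: leey. Qed.

Let small_diameter0 delta : (0 < delta)%R -> small_diameter delta set0 = 0.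
Proof. by move=> d0; rewrite /small_diameter diameter0 lee_fin ltW. Qed.

Let hausdorff10 : hausdorff1 set0 = 0.
Proof.
rewrite /hausdorff1; apply/eqP; rewrite eq_le; apply/andP; split.
  apply: ge_ereal_sup => _ [delta /= d0 <-].
  rewrite /hausdorff_content mu_ext0//; first exact: small_diameter0.
apply: ereal_sup_ubound; exists 1%R => //=.
by rewrite /hausdorff_content mu_ext0//; exact: small_diameter0.
Qed.

Let hausdorff1_ge0 A : 0 <= hausdorff1 A.
Proof.
apply: (@le_trans _ _ (hausdorff_content 1 A)); first exact: mu_ext_ge0.
by apply: ereal_sup_ubound; exists 1%R => //=.
Qed.

Let le_hausdorff1 : {homo hausdorff1 : A B / A `<=` B >-> A <= B}.
Proof.
move=> A B AB; apply: ge_ereal_sup => _ [delta /= d0 <-].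
apply: (@le_trans _ _ (hausdorff_content delta B)); first exact: le_mu_ext.
by apply: ereal_sup_ubound; exists delta.
Qed.

Let hausdorff1_sigma_subadditive : sigma_subadditive hausdorff1.
Proof.
move=> F; apply: ge_ereal_sup => _ [delta /= d0 <-].
apply: le_trans.
  apply: (@mu_ext_sigma_subadditive _
    (g_sigma_algebraType [set: set (plane R)])) => //; exact: small_diameter0.
apply: lee_nneseries => [i _ _|i _]; first exact: mu_ext_ge0.
by apply: ereal_sup_ubound; exists delta.
Qed.

HB.instance Definition _ := isOuterMeasure.Build R (plane R) hausdorff1
  hausdorff10 hausdorff1_ge0 le_hausdorff1 hausdorff1_sigma_subadditive.

Let hausdorff_outer : {outer_measure set (plane R) -> \bar R} := @hausdorff1.

Definition hausdorff_measure :
    {measure set (caratheodory_type hausdorff1) -> \bar R} :=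
  hausdorff_outer.

End Hausdorff.

Section BoundaryValues.
Variable R : realType.
Implicit Types (Omega : set (plane R)) (u : plane R -> 'cV[R]_2).

Definition boundary Omega : set (plane R) := closure Omega `\` interior Omega.

(* Near each boundary point, in suitable orthonormal coordinates
   (c y1 + s y2, - s y1 + c y2), Omega is the strict epigraph of a Lipschitz
   function. *)
Definition lipschitz_domain Omega : Prop :=
  forall x, boundary Omega x ->
  exists (r c s : R) (g : R -> R),
    [/\ 0 < r, c ^+ 2 + s ^+ 2 = 1, lipschitz g &
        forall y, enorm (y - x) < r ->
          (Omega y <-> g (c * y.1 + s * y.2) < - s * y.1 + c * y.2)].

(* Only the values of g on the boundary of Omega matter. The trace operator is
   the continuous extension to W^{1,2}(Omega) of the restriction to the
   boundary of functions that are smooth up to the boundary; has_trace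
   describes its graph as the closure of the graph of this restriction. *)
Definition has_trace Omega u (g : plane R -> 'cV[R]_2) : Prop :=
  (forall i, component g i \_ (boundary Omega) \in Lfun (hausdorff_measure R) 2%:E) /\
  exists (Du : plane R -> 'M[R]_2) (v : nat -> plane R -> 'cV[R]_2),
    [/\ W12_with_gradient Omega u Du,
        forall n i, smooth2 (component (v n) i),
        forall i, Lnorm (leb2 R) 2%:E (EFin \o
          ((component (v n) i \- component u i) \_ Omega)) @[n --> \oo] --> 0%E,
        forall i j, Lnorm (leb2 R) 2%:E (EFin \o
          ((entry (gradient (v n)) i j \- entry Du i j) \_ Omega))
          @[n --> \oo] --> 0%E &
        forall i, Lnorm (hausdorff_measure R) 2%:E (EFin \o
          ((component (v n) i \- component g i) \_ (boundary Omega)))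
          @[n --> \oo] --> 0%E].

Definition admissible Omega (u0 : plane R -> 'cV[R]_2) u : Prop :=
  W12 Omega u /\ has_trace Omega u u0.

End BoundaryValues.

Section Problem.
Variable R : realType.

Record energy_density (gamma s0 kappa : R) (rho1 rho : R -> R) : Prop := {
  gamma_gt0 : 0 < gamma;
  s0_ge0 : 0 <= s0;
  kappa_ge : - (gamma * s0) <= kappa;
  rho1_smooth : exists2 f, smooth1 f & forall s, 0 <= s <= s0 -> rho1 s = f s;
  rho1_convex : convex_function `[0, s0]%classic rho1;
  rho1_left : rho1 0 = 0;
  rho1_right : rho1 s0 = gamma * s0 + kappa;
  rho_nonpos : forall s, s <= 0 -> rho s = 0;
  rho_middle : forall s, 0 <= s <= s0 -> rho s = rho1 s;
  rho_affine : forall s, s0 <= s -> rho s = gamma * s + kappa;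
  rho_smooth : smooth1 rho;
  rho_convex : convex_function [set: R] rho
}.

Definition weak_euler_lagrange (Omega : set (plane R)) (rho : R -> R)
    (Du : plane R -> 'M[R]_2) : Prop :=
  forall phi : plane R -> 'cV[R]_2,
    (forall i, test_function Omega (component phi i)) ->
    \int[leb2 R]_(x in Omega)
      frobenius (Du x + derive1 rho (\det (Du x)) *: cof (Du x))
                (gradient phi x) = 0.

(* u coincides almost everywhere with a function that is alpha-Hoelder
   continuous on each compact subset of Omega. *)
Definition locally_hoelder (Omega : set (plane R)) (alpha : R)
    (u : plane R -> 'cV[R]_2) : Prop :=
  exists v : plane R -> 'cV[R]_2,
    {ae leb2 R, forall x, Omega x -> v x = u x} /\
    forall K, compact K -> K `<=` Omega ->
      exists C : R, forall x y, K x -> K y ->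
        frobenius_norm (v x - v y) <= C * enorm (x - y) `^ alpha.

End Problem.

(* Main.v *)
Require Import Defs.
From mathcomp Require Import all_boot all_order all_algebra.
From mathcomp Require Import all_classical all_reals all_analysis.
From mathcomp Require Import measurable_realfun ring lra.
Set Implicit Arguments.
Unset Strict Implicit.
Unset Printing Implicit Defensive.
Import Order.TTheory GRing.Theory Num.Theory.
Import numFieldNormedType.Exports.
Local Open Scope classical_set_scope.
Local Open Scope ring_scope.

(** Write S = Du + rho'(det Du) cof Du for the stress.  Convexity and the two
    affine ends of rho give 0 <= rho' <= gamma, with rho' = 0 on the negative
    half line.  Since cof A . A = 2 det A, the nonlinear term contributes
    2 rho'(det Du) det Du >= 0 to S . Du, so that the equation behaves like a
    linear elliptic system: S . Du >= |Du|^2 ([stress_coercive]) while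
    |S| <= C |Du| ([stress_bounded]).  The stress need not be monotone
    when gamma > 1, but coercivity and growth suffice for the following hole
    filling argument of Widman.

    Test the equation with eta (u - c), where eta is a cutoff equal to 1 on the
    square of half side r about z and to 0 off the square of half side 2r.  The
    gradient of eta lives on the square annulus between them and is at most
    2M/r, so Young's inequality bounds the energy of the inner square by the
    energy of the annulus plus r^-2 times the integral of |u - c|^2 over the
    annulus.  With a good constant c, the Poincare inequality on the annulus
    turns the last term into energy of the annulus as well ([hole_filling]).
    Adding a multiple of the energy of the inner square to both sides, the
    energy shrinks by a fixed factor theta < 1 whenever r is halved
    ([energy_decay]).

    The function u itself is not an admissible factor of a test function, since
    it is not smooth.  It is replaced by the smooth functions that approximate
    it in W^{1,2} according to the definition of the trace.  Their gradients
    converge to some weak gradient of u, which agrees almost everywhere with Du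
    by the fundamental lemma of the calculus of variations
    ([weak_gradient_unique]).

    The Poincare inequality on squares then bounds the mean square oscillation
    of u on a square of half side 2^-(k+l) by a multiple of theta^l
    ([campanato_bound]), and Campanato's theorem ([campanato_hoelder]) yields a
    Hoelder continuous representative.  Its value at x is the limit of the
    constants that approximate u on the squares about x, and its exponent is
    alpha = log_2 (theta^(-1/2)), which lies in (0, 1) because
    1/4 < theta < 1.

    The norm on the plane is the maximum norm, hence its balls are squares and
    all integral inequalities reduce to integrals along horizontal and vertical
    lines. *)

(** * Open sets, small squares and almost everywhere statements *)

Section Borel.
Variable R : realType.

Lemma ball_planeE (z : plane R) r : ball z r = ball z.1 r `*` ball z.2 r.
Proof. by []. Qed.

Lemma measurable_ball_plane (z : plane R) r :
  measurable (ball z r : set (plane R)).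
Proof. by rewrite ball_planeE; apply: measurableX; exact: measurable_ball. Qed.

Lemma rat_near (x e : R) : 0 < e -> exists q : rat, ball (ratr q : R) e x.
Proof.
move=> e0; have : x - e < x + e by lra.
move=> /rat_in_itvoo[q]; rewrite in_itv/= => /andP[q1 q2]; exists q.
by rewrite /ball/= ltr_distlC; apply/andP; split; lra.
Qed.

Definition dyadic k : R := 2^-1 ^+ k.

Lemma dyadic_gt0 k : 0 < dyadic k.
Proof. by rewrite exprn_gt0// invr_gt0. Qed.

Lemma dyadicS k : dyadic k = 2 * dyadic k.+1.
Proof. by rewrite /dyadic exprS mulrA divff ?mul1r. Qed.

Lemma dyadic_le k l : (k <= l)%N -> dyadic l <= dyadic k.
Proof.
by move=> kl; rewrite /dyadic ler_wiXn2l// ?invr_ge0// invf_le1// ler1n.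
Qed.

Lemma dyadic_small (e : R) : 0 < e -> exists k, dyadic k < e.
Proof.
move=> e0; have h1 : `|2^-1 : R| < 1 by rewrite ger0_norm ?invr_ge0// invf_lt1// ltr1n.
have /cvgr0_norm_lt /(_ e e0)[k _ hk] := cvg_expr h1.
exists k; have := hk k (leqnn _).
by rewrite ger0_norm// ltW// dyadic_gt0.
Qed.

Definition rat_center (i : rat * rat * nat) : plane R :=
  (ratr i.1.1, ratr i.1.2).

(** The rational square around x may be enlarged by the factor 2^s m without
    leaving A; local estimates on small squares need such room. *)
Lemma rational_ball (s : nat) (A : set (plane R)) (m : R) (x : plane R) :
  open A -> 0 < m -> A x -> exists i,
    ball (rat_center i) (dyadic (i.2 + s)) x /\
    ball (rat_center i) (m * dyadic i.2) `<=` A.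
Proof.
move=> oA m0 Ax.
have /nbhs_ballP[e /= e0 eA] := open_nbhs_nbhs (conj oA Ax).
have m1 : 0 < m + 1 by lra.
have [k ke] := dyadic_small (divr_gt0 e0 m1).
have k0 := dyadic_gt0 (k + s).
have [q1 q1x] := rat_near x.1 k0; have [q2 q2x] := rat_near x.2 k0.
exists (q1, q2, k); split; first by split.
have {}ke : m * dyadic k + dyadic (k + s) < e.
  apply: (@le_lt_trans _ _ ((m + 1) * dyadic k)); last by rewrite mulrC -ltr_pdivlMr.
  by rewrite mulrDl mul1r lerD2l dyadic_le// leq_addr.
move=> y [/= y1 y2]; apply: eA.
move: (m * dyadic k) (dyadic (k + s)) ke q1x q2x y1 y2 => t d td.
rewrite /ball/= !ltr_distlC.
move=> /andP[? ?] /andP[? ?] /andP[? ?] /andP[? ?].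
by split; rewrite /ball/= ltr_distlC; apply/andP; split; lra.
Qed.

Lemma open_measurable_plane (A : set (plane R)) : open A -> measurable A.
Proof.
move=> oA; have -> : A = \bigcup_i
    (if `[< ball (rat_center i) (dyadic i.2) `<=` A >]
     then ball (rat_center i) (dyadic i.2) else set0).
  apply/seteqP; split => [x Ax|x [i _]]; last by case: ifPn => // /asboolP; apply.
  have [i []] := rational_ball 0 oA ltr01 Ax; rewrite mul1r addn0 => ix iA.
  by exists i => //; rewrite ifT//; exact/asboolP.
apply: countable_bigcupT_measurable => // i.
by case: ifP => // _; exact: measurable_ball_plane.
Qed.

(** Countably many small squares exhaust an open set, and countable unions of
    null sets are null. *)
Lemma ae_open (s : nat) (A : set (plane R)) (m : R) (P : plane R -> Prop) :
  open A -> 0 < m ->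
  (forall z k, ball z (m * dyadic k) `<=` A ->
    {ae leb2 R, forall x, ball z (dyadic (k + s)) x -> P x}) ->
  {ae leb2 R, forall x, A x -> P x}.
Proof.
move=> oA m0 H.
pose F (i : rat * rat * nat) : set (plane R) :=
  if `[< ball (rat_center i) (m * dyadic i.2) `<=` A >]
  then ~` [set x | ball (rat_center i) (dyadic (i.2 + s)) x -> P x] else set0.
have nF i : (leb2 R).-negligible (F i).
  rewrite /F; case: ifPn => [/asboolP|_]; last exact: negligible_set0.
  exact: H.
pose G n := if unpickle n is Some i then F i else set0.
have nG : (leb2 R).-negligible (\bigcup_n G n).
  apply: negligible_bigcup => n; rewrite /G.
  by case: unpickle => [i|]; [exact: nF|exact: negligible_set0].
apply: (negligibleS _ nG) => x /= /not_implyP[Ax nP].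
have [i [ix iA]] := rational_ball s oA m0 Ax.
have Gi : G (pickle i) = F i by rewrite /G pickleK.
exists (pickle i); [exact: I|rewrite Gi].
rewrite /F ifT; last by apply/asboolP; exact: iA.
by move=> /(_ ix).
Qed.

Lemma open_continuous_measurable_plane (D : set (plane R)) (f : plane R -> R) :
  open D -> {in D, continuous f} -> measurable_fun D f.
Proof.
move=> oD cf mD; apply: (measurability _ (RGenOpens.measurableE R)) => //.
move=> _ [_ [a [b ->]] <-]; apply: open_measurable_plane.
rewrite openE => x [Dx fx]; apply: filterI; first exact: open_nbhs_nbhs.
apply: cf; first by rewrite inE.
by apply: open_nbhs_nbhs; split => //; exact: interval_open.
Qed.

Lemma continuous_measurable_plane (f : plane R -> R) :
  continuous f -> measurable_fun setT f.
Proof.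
by move=> cf; apply: open_continuous_measurable_plane; [exact: openT|].
Qed.

End Borel.

(** * Smooth functions of two variables *)

Section Smooth.
Variable R : realType.

(** Reduces derivatives along a line in the plane to the calculus of one
    variable. *)
Lemma is_derive_slice (f : plane R -> R) (x v : plane R) (s d : R) :
  is_derive s 1 (fun t : R => f (t *: v + x)) d <->
  is_derive (s *: v + x) v f d.
Proof.
set F := fun t : R => f (t *: v + x).
have e (h : R) : F (h *: (1 : R) + s) = f (h *: v + (s *: v + x)).
  by rewrite /F scalerDl [h *: 1]mulr1 addrA.
pose G1 (h : R) := h^-1 *: ((F \o shift s) (h *: 1) - F s).
pose G2 (h : R) := h^-1 *: ((f \o shift (s *: v + x)) (h *: v) - f (s *: v + x)).
have G12 : G1 = G2 by apply/funext => h; rewrite /G1 /G2 /= e.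
have e1 : derivable F s 1 = derivable f (s *: v + x) v.
  by change (cvg (G1 @ 0^') = cvg (G2 @ 0^')); rewrite G12.
have e2 : 'D_1 F s = 'D_v f (s *: v + x).
  by change (lim (G1 @ 0^') = lim (G2 @ 0^')); rewrite G12.
by split => -[d1 d2]; split; rewrite -?d2; [rewrite -e1|rewrite e2|rewrite e1|rewrite -e2].
Qed.

Definition coord (j : 'I_2) (x : plane R) : R := if j == 0 then x.1 else x.2.

Lemma coord_continuous j : continuous (coord j).
Proof.
rewrite /coord; case: (j == 0) => x; [exact: cvg_fst|exact: cvg_snd].
Qed.

Lemma coordD j (t : R) i (x : plane R) :
  coord j (t *: basis_vector R i + x) = t * (i == j)%:R + coord j x.
Proof.
rewrite /coord /basis_vector.
by case: j => [[|[|//]] ?]; case: i => [[|[|//]] ?] //=;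
  rewrite /GRing.scale /= ?mulr1 ?mulr0.
Qed.

Lemma is_CkS k (f : plane R -> R) : is_Ck k.+1 f -> is_Ck k f.
Proof.
elim: k f => [|k IH] f [cf df]; first by split.
by split => // j; have [dfj /IH] := df j.
Qed.

Lemma is_Ck_cst k (c : R) : is_Ck k (cst c : plane R -> R).
Proof.
elim: k c => [|k IH] c; split => //; try exact: cst_continuous.
move=> j; split => [x|]; first exact: derivable_cst.
by have -> : partial j (cst c) = cst 0 by apply/funext => x; rewrite /partial derive_cst.
Qed.

Lemma is_CkD k (f g : plane R -> R) :
  is_Ck k f -> is_Ck k g -> is_Ck k (fun x => f x + g x).
Proof.
elim: k f g => [|k IH] f g [cf df] [cg dg];
  (split; first by move=> x; apply: cvgD; [exact: cf|exact: cg]) => // j.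
have [df1 df2] := df j; have [dg1 dg2] := dg j; split => [x|].
  exact: derivableD.
have -> : partial j (fun x => f x + g x) = fun x => partial j f x + partial j g x.
  by apply/funext => x; rewrite /partial deriveD.
exact: IH.
Qed.

Lemma partialM (f g : plane R -> R) j :
  (forall x, derivable f x (basis_vector R j)) ->
  (forall x, derivable g x (basis_vector R j)) ->
  partial j (fun x => f x * g x) =
    fun x => f x * partial j g x + g x * partial j f x.
Proof. by move=> df dg; apply/funext => x; rewrite /partial deriveM. Qed.

Lemma is_CkM k (f g : plane R -> R) :
  is_Ck k f -> is_Ck k g -> is_Ck k (fun x => f x * g x).
Proof.
elim: k f g => [|k IH] f g hf hg; have [cf df] := hf; have [cg dg] := hg;
  (split; first by move=> x; apply: cvgM; [exact: cf|exact: cg]) => // j.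
have [df1 df2] := df j; have [dg1 dg2] := dg j; split => [x|].
  exact: derivableM.
by rewrite partialM//; apply: is_CkD; apply: IH => //; exact: is_CkS.
Qed.

Lemma smooth2_derivable (f : plane R -> R) j x :
  smooth2 f -> derivable f x (basis_vector R j).
Proof. by move=> /(_ 1)[_ /(_ j)[]]. Qed.

Lemma smooth2_continuous (f : plane R -> R) : smooth2 f -> continuous f.
Proof. by move=> /(_ 0)[]. Qed.

Lemma smooth2_partial (f : plane R -> R) j : smooth2 f -> smooth2 (partial j f).
Proof. by move=> sf k; have [_ /(_ j)[]] := sf k.+1. Qed.

Lemma smooth2_cst (c : R) : smooth2 (cst c : plane R -> R).
Proof. by move=> k; exact: is_Ck_cst. Qed.

Lemma smooth2D (f g : plane R -> R) :
  smooth2 f -> smooth2 g -> smooth2 (fun x => f x + g x).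
Proof. by move=> sf sg k; exact: is_CkD. Qed.

Lemma smooth2M (f g : plane R -> R) :
  smooth2 f -> smooth2 g -> smooth2 (fun x => f x * g x).
Proof. by move=> sf sg k; exact: is_CkM. Qed.

Lemma smooth1_derivable (h : R -> R) x : smooth1 h -> derivable h x 1.
Proof. by move=> /(_ 0 x). Qed.

Lemma smooth1_derive (h : R -> R) : smooth1 h -> smooth1 (derive1 h).
Proof. by move=> sh k x; have := sh k.+1 x; rewrite derive1Sn. Qed.

Lemma smooth1_continuous (h : R -> R) : smooth1 h -> continuous h.
Proof.
by move=> sh x; apply/differentiable_continuous/derivable1_diffP; exact: smooth1_derivable.
Qed.

Lemma is_derive_coord (h : R -> R) (a b : R) i j x : smooth1 h ->
  is_derive x (basis_vector R j) (fun x => h (a * coord i x + b))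
    ((j == i)%:R * a * (derive1 h) (a * coord i x + b)).
Proof.
move=> sh; rewrite -[x]add0r -[in X in X + x](scale0r (basis_vector R j)).
apply/is_derive_slice; rewrite scale0r add0r.
have -> : (fun t : R => h (a * coord i (t *: basis_vector R j + x) + b)) =
   h \o (fun t : R => (j == i)%:R * a * t + (a * coord i x + b)).
  by apply/funext => t /=; rewrite coordD; congr h; ring.
have dl : is_derive (0 : R) 1 (fun t : R => (j == i)%:R * a * t + (a * coord i x + b))
   ((j == i)%:R * a).
  apply: is_derive_eq; rewrite /GRing.scale /=; ring.
have dh : is_derive ((j == i)%:R * a * 0 + (a * coord i x + b)) 1 h
    ((derive1 h) (a * coord i x + b)).
  rewrite mulr0 add0r derive1E; apply: DeriveDef => //; exact: smooth1_derivable.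
apply: (is_derive_eq (@is_derive1_comp _ h (fun t : R => (j == i)%:R * a * t +
  (a * coord i x + b)) _ _ _ dh dl)).
by rewrite mulrC.
Qed.

Lemma partial_coord (h : R -> R) (a b : R) i j : smooth1 h ->
  partial j (fun x => h (a * coord i x + b)) =
  fun x => (j == i)%:R * a * (derive1 h) (a * coord i x + b).
Proof.
by move=> sh; apply/funext => x; apply: derive_val; exact: is_derive_coord.
Qed.

Lemma smooth2_coord (h : R -> R) (a b : R) i : smooth1 h ->
  smooth2 (fun x : plane R => h (a * coord i x + b)).
Proof.
move=> sh k; elim: k h sh => [|k IH] h sh; split => //.
1,2: move=> x; apply: continuous_comp; last exact: smooth1_continuous.
1,2: by apply: cvgD; [apply: cvgM; [exact: cvg_cst|exact: coord_continuous]|exact: cvg_cst].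
move=> j; split => [x|].
  by apply: ex_derive; exact: is_derive_coord.
rewrite partial_coord//.
by apply: is_CkM; [exact: is_Ck_cst|exact/IH/smooth1_derive].
Qed.

End Smooth.

(** * The energy density and a smooth step *)

Section Step.
Variable R : realType.
Implicit Types f h : R -> R.

Lemma homo_derive1_ge0 f (x : R) : {homo f : a b / a <= b} ->
  derivable f x 1 -> 0 <= derive1 f x.
Proof.
move=> fi df; rewrite derive1E; apply: limr_ge; first exact: df.
near=> t; have t0 : t != 0 by near: t; exact: nbhs_dnbhs_neq.
rewrite /GRing.scale /= mulr1; case: (ltgtP t 0) t0 => // t0 _.
  by rewrite nmulr_rge0 ?invr_lt0// subr_le0 fi// gerDr ltW.
by rewrite pmulr_rge0 ?invr_gt0// subr_ge0 fi// lerDr ltW.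
Unshelve. all: by end_near. Qed.

Lemma continuous_eq_closure (f : R -> R) (A : set R) (a c : R) :
  continuous f -> (forall x, A x -> f x = c) -> closure A a -> f a = c.
Proof.
move=> cf fA; have cl : closed [set x | f x = c].
  by apply: (@closed_comp _ _ f [set c]) => //; exact: accessible_closed_set1.
by move=> /closure_subset => /(_ [set x | f x = c] fA); rewrite -(closure_id _).1.
Qed.

Lemma near_derive1_cst f (a c : R) :
  (\forall x \near a, f x = c) -> derive1 f a = 0.
Proof.
move=> fc; rewrite derive1E; have -> : 'D_1 f a = 'D_1 (cst c) a.
  by apply: near_eq_derive.
by rewrite derive_cst.
Qed.

Lemma derive1_cst_lt f (a c : R) : (forall x, x <= a -> f x = c) ->
  forall x, x < a -> derive1 f x = 0.
Proof.
move=> fc x xa; apply: (@near_derive1_cst _ _ c).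
by near=> y; apply: fc; apply/ltW; near: y; exact: lt_nbhsl.
Unshelve. all: by end_near. Qed.

Lemma derive1_cst_gt f (a c : R) : (forall x, a <= x -> f x = c) ->
  forall x, a < x -> derive1 f x = 0.
Proof.
move=> fc x xa; apply: (@near_derive1_cst _ _ c).
by near=> y; apply: fc; apply/ltW; near: y; exact: lt_nbhsr.
Unshelve. all: by end_near. Qed.

(** The derivative is continuous, hence its vanishing extends from the open half
    line to the end point. *)
Lemma derive1_cst_le f (a c : R) : smooth1 f -> (forall x, x <= a -> f x = c) ->
  forall x, x <= a -> derive1 f x = 0.
Proof.
move=> sf fc x; rewrite le_eqVlt => /predU1P[->|]; last exact: derive1_cst_lt fc _.
apply: (@continuous_eq_closure _ [set y | y < a]).
- exact/smooth1_continuous/smooth1_derive.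
- by move=> y; exact: derive1_cst_lt fc _.
- by rewrite closure_lt /=.
Qed.

Lemma derive1_cst_ge f (a c : R) : smooth1 f -> (forall x, a <= x -> f x = c) ->
  forall x, a <= x -> derive1 f x = 0.
Proof.
move=> sf fc x; rewrite le_eqVlt => /predU1P[<-|]; last exact: derive1_cst_gt fc _.
apply: (@continuous_eq_closure _ [set y | a < y]).
- exact/smooth1_continuous/smooth1_derive.
- by move=> y; exact: derive1_cst_gt fc _.
- by rewrite closure_gt /=.
Qed.

Lemma smooth1_affine h (c a b : R) : smooth1 h ->
  smooth1 (fun t => c * h (a * t + b)).
Proof.
move=> sh.
have H g c' (x : R) : smooth1 g ->
    is_derive x 1 (fun t => c' * g (a * t + b)) (c' * (derive1 g (a * x + b) * a)).
  move=> sg.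
  have dl : is_derive x 1 (fun t : R => a * t + b) a.
    by apply: is_derive_eq; rewrite /GRing.scale /=; ring.
  have dg : is_derive (a * x + b) 1 g (derive1 g (a * x + b)).
    by rewrite derive1E; apply: DeriveDef => //; exact: smooth1_derivable.
  exact: (@is_deriveZ _ _ _ _ c' _ _ _ (@is_derive1_comp _ g (fun t => a * t + b) _ _ _ dg dl)).
have sk k : smooth1 (derive1n k h).
  by elim: k => [//|k IHk]; rewrite derive1nS; exact: smooth1_derive.
have H1 k : exists c', derive1n k (fun t => c * h (a * t + b)) =
    fun t => c' * (derive1n k h) (a * t + b).
  elim: k => [|k [c' IH]]; first by exists c.
  exists (c' * a); rewrite derive1nS IH; apply/funext => x.
  by rewrite derive1E derive1nS (@derive_val _ _ _ _ _ _ _ (H _ c' x (sk k))); ring.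
by move=> k x; have [c' ->] := H1 k; have [] := H _ c' x (sk k).
Qed.

Record smooth_step (sigma : R -> R) : Prop := {
  step_smooth : smooth1 sigma;
  step_le0 : forall t, t <= 0 -> sigma t = 0;
  step_ge1 : forall t, 1 <= t -> sigma t = 1;
  step_itv : forall t, 0 <= sigma t <= 1 }.

Lemma step_derive0 sigma : smooth_step sigma ->
  forall t, (t <= 0) || (1 <= t) -> derive1 sigma t = 0.
Proof.
move=> [ss s0 s1 _] t /orP[]; first exact: derive1_cst_le s0 _.
exact: derive1_cst_ge s1 _.
Qed.

Lemma step_derive_bounded sigma : smooth_step sigma ->
  exists M, forall t, `|derive1 sigma t| <= M.
Proof.
move=> ss.
have cs : {within `[0, 1], continuous (fun t => `|derive1 sigma t|)}.
  apply: continuous_subspaceT => t; apply: continuous_comp; last exact: norm_continuous.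
  exact/smooth1_continuous/smooth1_derive/step_smooth.
have [c _ hc] := EVT_max ler01 cs.
exists `|derive1 sigma c| => t.
have [t01|] := boolP (t \in `[0, 1]); first exact: hc.
rewrite in_itv/= negb_and -!ltNge => t01.
by rewrite (step_derive0 ss) ?normr0//; case/orP: t01 => /ltW ->; rewrite ?orbT.
Qed.

(** The chord from a zero c of f to y lies above f at x, which gives
    f x <= (1 - t) * f y with 0 <= t < 1.  Applied with x = 0 this shows that
    f is nonnegative, and then that f x <= f y. *)
Lemma convex_homo f : convex_function [set: R] f -> (forall s, s <= 0 -> f s = 0) ->
  {homo f : a b / a <= b}.
Proof.
move=> cf f0.
have cvx a b t : 0 <= t <= 1 -> f (t * a + (1 - t) * b) <= t * f a + (1 - t) * f b.
  by move=> /andP[t0 t1]; exact: (cf (Itv01 t0 t1) a b (in_setT _) (in_setT _)).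
have slope c x y : c < x -> x <= y -> c <= 0 -> exists2 t, 0 <= t < 1 & f x <= (1 - t) * f y.
  move=> cx xy c0; have yc : 0 < y - c by lra.
  exists ((y - x) / (y - c)).
    by apply/andP; split; [apply: divr_ge0; lra|rewrite ltr_pdivrMr// mul1r; lra].
  have := cvx c y ((y - x) / (y - c)).
  rewrite (f0 c)// mulr0 add0r (_ : _ * c + _ * y = x); last by field; lra.
  by apply; apply/andP; split; [apply: divr_ge0; lra|rewrite ler_pdivrMr// mul1r; lra].
have fge0 x : 0 <= f x.
  have [/f0->//|x0] := leP x 0.
  have [t /andP[_ t1]] := @slope (- 1) 0 x (ltrN10 _) (ltW x0) (lerN10 _).
  by rewrite f0// pmulr_rge0// subr_gt0.
move=> x y xy; pose c := Num.min x 0 - 1.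
have cx : c < x by rewrite /c ltrBlDr gt_min ltrDl ltr01.
have c0 : c <= 0 by rewrite /c lerBlDr ge_min add0r ler01 orbT.
have [t /andP[t0 t1] /le_trans] := slope c x y cx xy c0; apply.
by rewrite ler_piMl// ?fge0// gerBl.
Qed.

Section EnergyDensity.
Variables (gamma s0 kappa : R) (rho1 rho : R -> R).
Hypothesis spec : energy_density gamma s0 kappa rho1 rho.

Let srho : smooth1 rho := rho_smooth spec.

Lemma rho'_ge0 s : 0 <= derive1 rho s.
Proof.
apply: homo_derive1_ge0; last exact: smooth1_derivable.
exact: convex_homo (rho_convex spec) (rho_nonpos spec).
Qed.

Lemma rho'_le0 s : s <= 0 -> derive1 rho s = 0.
Proof. exact: derive1_cst_le srho (rho_nonpos spec) s. Qed.

(** Reflecting the graph of rho and subtracting the affine part gives another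
    convex function that vanishes on a half line. *)
Lemma rho'_le s : derive1 rho s <= gamma.
Proof.
pose g t := rho (s0 - t) - (gamma * (s0 - t) + kappa).
have cg : convex_function [set: R] g.
  move=> t x y _ _; have := rho_convex spec t (in_setT (s0 - x)) (in_setT (s0 - y)).
  set p := t%:num; rewrite /g.
  change (rho (p * (s0 - x) + (1 - p) * (s0 - y))
      <= p * rho (s0 - x) + (1 - p) * rho (s0 - y) ->
    rho (s0 - (p * x + (1 - p) * y)) - (gamma * (s0 - (p * x + (1 - p) * y)) + kappa)
      <= p * (rho (s0 - x) - (gamma * (s0 - x) + kappa))
       + (1 - p) * (rho (s0 - y) - (gamma * (s0 - y) + kappa))).
  rewrite (_ : p * (s0 - x) + _ = s0 - (p * x + (1 - p) * y)); last by ring.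
  lra.
have g0 t : t <= 0 -> g t = 0.
  by move=> t0; rewrite /g (rho_affine spec) ?subrr//; lra.
have hg := convex_homo cg g0.
have ha : {homo (fun t => gamma * t - rho t) : a b / a <= b}.
  move=> a b ab; have := hg (s0 - b) (s0 - a); rewrite /g !subKr.
  have -> : s0 - b <= s0 - a by lra.
  by move=> /(_ isT); lra.
have dl : is_derive s 1 (fun t : R => gamma * t) gamma.
  by apply: is_derive_eq; rewrite /GRing.scale /=; ring.
have da : is_derive s 1 rho (derive1 rho s).
  by rewrite derive1E; apply: DeriveDef => //; exact: smooth1_derivable.
have dd := is_deriveB dl da.
have := homo_derive1_ge0 ha (@ex_derive _ _ _ _ _ _ _ dd).
by rewrite derive1E (@derive_val _ _ _ _ _ _ _ dd) subr_ge0.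
Qed.

Lemma rho'_affine s : s0 <= s -> derive1 rho s = gamma.
Proof.
pose g t := rho t - (gamma * t).
have dg (t : R) : is_derive t 1 g (derive1 rho t - gamma).
  have dl : is_derive t 1 (fun t : R => gamma * t) gamma.
    by apply: is_derive_eq; rewrite /GRing.scale /=; ring.
  have da : is_derive t 1 rho (derive1 rho t).
    by rewrite derive1E; apply: DeriveDef => //; exact: smooth1_derivable.
  exact: is_deriveB.
have gk x : s0 <= x -> g x = kappa.
  by move=> sx; rewrite /g (rho_affine spec)//; ring.
have H t : s0 < t -> derive1 rho t = gamma.
  move=> /(derive1_cst_gt gk); rewrite derive1E (@derive_val _ _ _ _ _ _ _ (dg t)).
  by move=> /eqP; rewrite subr_eq0 => /eqP.
rewrite le_eqVlt => /predU1P[<-|]; last exact: H.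
apply: (@continuous_eq_closure _ [set y | s0 < y]).
- exact/smooth1_continuous/smooth1_derive.
- exact: H.
- by rewrite closure_gt /=.
Qed.

(** If s0 were 0, rho would have a kink there, against smoothness: rho' would
    be both 0 and gamma there. *)
Lemma s0_gt0 : 0 < s0.
Proof.
rewrite lt_neqAle (s0_ge0 spec) andbT; apply/eqP => s00.
have := @rho'_affine 0; rewrite -s00 lexx rho'_le0// => /(_ isT) g0.
by have := gamma_gt0 spec; rewrite -g0 ltxx.
Qed.

(** The derivative of rho rises smoothly from 0 to gamma, so that rescaling it
    yields a cutoff profile. *)
Lemma exists_smooth_step : exists sigma : R -> R, smooth_step sigma.
Proof.
have g0 := gamma_gt0 spec; have s00 := s0_gt0.
exists (fun t => gamma^-1 * derive1 rho (s0 * t + 0)); split.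
- exact/smooth1_affine/smooth1_derive.
- by move=> t t0; rewrite rho'_le0 ?mulr0// addr0 pmulr_rle0.
- by move=> t t1; rewrite rho'_affine ?mulVf ?gt_eqF// addr0 ler_peMr// ltW.
- move=> t; apply/andP; split; first by apply: mulr_ge0; rewrite ?rho'_ge0// invr_ge0 ltW.
  by rewrite -(mulVf (lt0r_neq0 g0)) ler_pM2l ?invr_gt0// rho'_le.
Qed.

End EnergyDensity.

End Step.

(** * Cutoff functions for rectangles *)

Section Bump.
Variable R : realType.
Variable sigma : R -> R.
Hypothesis step : smooth_step sigma.

Definition profile (d : R) (a b : plane R) (i : 'I_2) (x : plane R) : R :=
  sigma (d^-1 * coord i x + - (d^-1 * coord i a)) *
  sigma (- d^-1 * coord i x + d^-1 * coord i b).

(** The parameter d is the width of the transition layer inside the boundary of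
    the rectangle with corners a and b. *)
Definition bump (d : R) (a b x : plane R) : R :=
  profile d a b 0 x * profile d a b 1 x.

Lemma smooth2_profile d a b i : smooth2 (profile d a b i).
Proof. by apply: smooth2M; apply: smooth2_coord; exact: step_smooth. Qed.

Lemma smooth2_bump d a b : smooth2 (bump d a b).
Proof. by apply: smooth2M; exact: smooth2_profile. Qed.

Lemma profile_itv d a b i x : 0 <= profile d a b i x <= 1.
Proof.
have /andP[p0 p1] := step_itv step (d^-1 * coord i x + - (d^-1 * coord i a)).
have /andP[q0 q1] := step_itv step (- d^-1 * coord i x + d^-1 * coord i b).
by rewrite mulr_ge0//= mulr_ile1.
Qed.

Lemma bump_itv d a b x : 0 <= bump d a b x <= 1.
Proof.
have /andP[p0 p1] := profile_itv d a b 0 x.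
have /andP[q0 q1] := profile_itv d a b 1 x.
by rewrite mulr_ge0//= mulr_ile1.
Qed.

Definition rect (a b : plane R) : set (plane R) :=
  [set x | forall i, coord i a < coord i x < coord i b].

Lemma rectE a b : rect a b = `]a.1, b.1[ `*` `]a.2, b.2[.
Proof.
apply/seteqP; split => x /=.
  by move=> h; split; rewrite /= in_itv /=; [exact: (h 0)|exact: (h 1)].
rewrite !in_itv/= => -[h0 h1] i; rewrite /coord; case: ifP => //.
Qed.

Lemma profile_eq0 d a b i x : 0 < d ->
  ~~ (coord i a < coord i x < coord i b) -> profile d a b i x = 0.
Proof.
move=> d0; rewrite negb_and -!leNgt /profile => /orP[h|h].
  rewrite (step_le0 step) ?mul0r//.
  by rewrite -mulrN -mulrDr pmulr_rle0 ?invr_gt0// subr_le0.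
rewrite [X in _ * X](step_le0 step) ?mulr0//.
by rewrite mulNr -mulrN -mulrDr pmulr_rle0 ?invr_gt0// addrC subr_le0.
Qed.

Lemma bump_eq0 d a b x : 0 < d -> ~ rect a b x -> bump d a b x = 0.
Proof.
move=> d0 /existsNP[i /negP h]; rewrite /bump.
suff : profile d a b i x = 0.
  case: i {h} => [[|[|//]] i] h.
    by rewrite (_ : 0 = Ordinal i) ?h ?mul0r//; exact: val_inj.
  by rewrite (_ : 1 = Ordinal i) ?h ?mulr0//; exact: val_inj.
exact: profile_eq0.
Qed.

Lemma profile_eq1 d a b i x : 0 < d ->
  coord i a + d <= coord i x <= coord i b - d -> profile d a b i x = 1.
Proof.
move=> d0 /andP[h1 h2]; rewrite /profile !(step_ge1 step) ?mul1r//.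
  by rewrite mulNr -mulrN -mulrDr -ler_pdivrMl ?invr_gt0// invrK mulr1; lra.
by rewrite -mulrN -mulrDr -ler_pdivrMl ?invr_gt0// invrK mulr1; lra.
Qed.

Lemma bump_eq1 d a b x : 0 < d ->
  (forall i, coord i a + d <= coord i x <= coord i b - d) -> bump d a b x = 1.
Proof. by move=> d0 h; rewrite /bump !profile_eq1// mul1r. Qed.

Lemma partial_profile d a b i j x : partial j (profile d a b i) x =
  (j == i)%:R * d^-1 *
   (derive1 sigma (d^-1 * coord i x + - (d^-1 * coord i a)) *
      sigma (- d^-1 * coord i x + d^-1 * coord i b) -
    sigma (d^-1 * coord i x + - (d^-1 * coord i a)) *
      derive1 sigma (- d^-1 * coord i x + d^-1 * coord i b)).
Proof.
have ss := step_smooth step.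
rewrite /profile partialM ?partial_coord//; first by ring.
  by move=> y; apply: smooth2_derivable; exact: smooth2_coord.
by move=> y; apply: smooth2_derivable; exact: smooth2_coord.
Qed.

Lemma partial_profile_le M d a b i j x : 0 < d ->
  (forall t, `|derive1 sigma t| <= M) ->
  `|partial j (profile d a b i) x| <= (j == i)%:R * (2 * M / d).
Proof.
move=> d0 hM; rewrite partial_profile normrM normrM normr_nat -mulrA.
apply: ler_wpM2l => //; rewrite gtr0_norm ?invr_gt0// mulrC.
apply: ler_wpM2r; first by rewrite invr_ge0 ltW.
apply: (le_trans (ler_normB _ _)); rewrite !normrM mulrDl mul1r.
have h t : `|sigma t| <= 1.
  by have /andP[h1 h2] := step_itv step t; rewrite ger0_norm.
apply: lerD; [rewrite -[leRHS]mulr1|rewrite -[leRHS]mul1r];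
  exact: ler_pM.
Qed.

Lemma partial_profile_eq0 d a b i j x : 0 < d ->
  (coord i a + d <= coord i x <= coord i b - d) || ~~ (coord i a < coord i x < coord i b) ->
  partial j (profile d a b i) x = 0.
Proof.
move=> d0 h; rewrite partial_profile.
have d0' : 0 < d^-1 by rewrite invr_gt0.
have e1 : - d^-1 * coord i x + d^-1 * coord i b = d^-1 * (coord i b - coord i x) by ring.
have e2 : d^-1 * coord i x + - (d^-1 * coord i a) = d^-1 * (coord i x - coord i a) by ring.
rewrite e1 e2.
have big t : d <= t -> 1 <= d^-1 * t.
  by move=> dt; rewrite -(mulVf (lt0r_neq0 d0)) ler_pM2l.
have neg t : t <= 0 -> d^-1 * t <= 0 by move=> t0; rewrite pmulr_rle0.
case/orP: h => [/andP[h1 h2]|].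
  have k1 : 1 <= d^-1 * (coord i x - coord i a) by apply: big; lra.
  have k2 : 1 <= d^-1 * (coord i b - coord i x) by apply: big; lra.
  by rewrite !(step_derive0 step) ?k1 ?k2 ?orbT// mul0r mulr0 subrr mulr0.
rewrite negb_and -!leNgt => /orP[h|h].
  have k : d^-1 * (coord i x - coord i a) <= 0 by apply: neg; lra.
  by rewrite (step_derive0 step) ?k// (step_le0 step k) !mul0r subrr mulr0.
have k : d^-1 * (coord i b - coord i x) <= 0 by apply: neg; lra.
by rewrite (step_derive0 step (t := d^-1 * (coord i b - _))) ?k// (step_le0 step k) !mulr0 subrr mulr0.
Qed.

Lemma partial_bump d a b j x : partial j (bump d a b) x =
  profile d a b 0 x * partial j (profile d a b 1) x +
  profile d a b 1 x * partial j (profile d a b 0) x.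
Proof.
by rewrite /bump partialM// => y; exact/smooth2_derivable/smooth2_profile.
Qed.

Lemma partial_bump_le M d a b j x : 0 < d ->
  (forall t, `|derive1 sigma t| <= M) -> `|partial j (bump d a b) x| <= 2 * M / d.
Proof.
move=> d0 hM; rewrite partial_bump.
have M0 : 0 <= 2 * M / d.
  rewrite divr_ge0 ?mulr_ge0//; last exact: ltW.
  exact: le_trans (hM 0).
have h i : `|profile d a b i x| <= 1.
  by have /andP[h1 h2] := profile_itv d a b i x; rewrite ger0_norm.
have hp i := @partial_profile_le M d a b i j x d0 hM.
apply: (le_trans (ler_normD _ _)).
apply: (@le_trans _ _ ((j == 1)%:R * (2 * M / d) + (j == 0)%:R * (2 * M / d))).
  by apply: lerD; rewrite -[leRHS]mul1r normrM; apply: ler_pM.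
by case: j {hp} => [[|[|//]] ?] /=; rewrite ?mul0r ?mul1r ?addr0 ?add0r.
Qed.

Lemma partial_bump_plateau d a b j x : 0 < d ->
  (forall i, coord i a + d <= coord i x <= coord i b - d) ->
  partial j (bump d a b) x = 0.
Proof.
move=> d0 h; rewrite partial_bump !partial_profile_eq0 ?mulr0 ?addr0//; by rewrite h.
Qed.

Lemma partial_bump_out d a b j x : 0 < d -> ~ rect a b x ->
  partial j (bump d a b) x = 0.
Proof.
move=> d0 /existsNP[i /negP h]; rewrite partial_bump.
have h1 := profile_eq0 d0 h.
have h2 : partial j (profile d a b i) x = 0.
  by apply: partial_profile_eq0 => //; rewrite h orbT.
case: i {h} h1 h2 => [[|[|//]] i] h1 h2.
  by rewrite (_ : 0 = Ordinal i) ?h1 ?h2 ?mul0r ?mulr0 ?addr0//; exact: val_inj.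
by rewrite (_ : 1 = Ordinal i) ?h1 ?h2 ?mul0r ?mulr0 ?addr0//; exact: val_inj.
Qed.

Definition crect (a b : plane R) : set (plane R) := `[a.1, b.1] `*` `[a.2, b.2].

Lemma compact_crect a b : compact (crect a b).
Proof. by apply: compact_setX; exact: segment_compact. Qed.

Lemma closed_crect a b : closed (crect a b).
Proof.
apply: compact_closed; last exact: compact_crect.
exact: norm_hausdorff.
Qed.

Lemma rect_crect a b : rect a b `<=` crect a b.
Proof. by rewrite rectE => x [/= h1 h2]; split; exact: subset_itv_oo_cc. Qed.

Lemma test_function_bumpM Omega d a b g : 0 < d -> smooth2 g ->
  crect a b `<=` Omega -> test_function Omega (fun x => bump d a b x * g x).
Proof.
move=> d0 sg abO.
have cl : closure [set x | bump d a b x * g x != 0] `<=` crect a b.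
  rewrite [X in _ `<=` X](closure_id _).1; last exact: closed_crect.
  apply: closure_subset => x /= x0; apply: rect_crect.
  by apply: contrapT => /bump_eq0 b0; move: x0; rewrite b0// mul0r eqxx.
split.
- by apply: smooth2M => //; exact: smooth2_bump.
- apply: (subclosed_compact _ (@compact_crect a b)) => //; exact: closed_closure.
- exact: subset_trans cl abO.
Qed.

Lemma test_function_bump Omega d a b : 0 < d ->
  crect a b `<=` Omega -> test_function Omega (bump d a b).
Proof.
move=> d0 abO; rewrite (_ : bump d a b = fun x => bump d a b x * cst 1 x).
  by apply: test_function_bumpM => //; exact: smooth2_cst.
by apply/funext => x; rewrite mulr1.
Qed.

End Bump.

(** * The fundamental lemma of the calculus of variations *)

Section Fundamental.
Variable R : realType.
Implicit Types Omega : set (plane R).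
Local Notation mu := (leb2 R).

Lemma measurable_rect (a b : plane R) : measurable (rect a b).
Proof. by rewrite rectE; apply: measurableX; exact: measurable_itv. Qed.

(** As the transition layer gets thinner, the bumps fill the open rectangle. *)
Lemma bump_cvg (sigma : R -> R) (a b x : plane R) : smooth_step sigma ->
  bump sigma (dyadic R n) a b x @[n --> \oo] --> (\1_(rect a b) x : R).
Proof.
move=> ss; rewrite indicE; have [|nx] := boolP (x \in rect a b); last first.
  have -> : (fun n => bump sigma (dyadic R n) a b x) = cst 0.
    apply/funext => n; apply: bump_eq0 => //; first exact: dyadic_gt0.
    by move=> h; rewrite (mem_set h) in nx.
  exact: cvg_cst.
rewrite inE => hx; have /andP[a1 b1] := hx 0; have /andP[a2 b2] := hx 1.
have e0 : 0 < Num.min (Num.min (coord 0 x - coord 0 a) (coord 0 b - coord 0 x))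
   (Num.min (coord 1 x - coord 1 a) (coord 1 b - coord 1 x)).
  by rewrite !lt_min !subr_gt0 a1 b1 a2 b2.
have [N] := dyadic_small e0.
rewrite !lt_min => /andP[/andP[h1 h2] /andP[h3 h4]].
apply: cvg_near_cst; exists N => // n /= Nn.
have nN := dyadic_le R Nn.
apply: bump_eq1 => //; first exact: dyadic_gt0.
by case=> [[|[|//]] i]; [rewrite (_ : Ordinal i = 0)|rewrite (_ : Ordinal i = 1)];
  (try exact: val_inj); apply/andP; split; lra.
Qed.

Lemma integral_rect_eq0 Omega (f : plane R -> R) (sigma : R -> R) (a b : plane R) :
  measurable Omega -> smooth_step sigma ->
  mu.-integrable Omega (EFin \o f) ->
  (forall psi, test_function Omega psi ->
    \int[mu]_(x in Omega) (f x * psi x) = 0) ->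
  crect a b `<=` Omega ->
  (\int[mu]_(x in rect a b) (f x)%:E = 0)%E.
Proof.
move=> mO ss fi f0 abO.
pose fn n x := (f x * bump sigma (dyadic R n) a b x)%:E.
have mf : measurable_fun Omega f by apply/measurable_EFinP; case/integrableP: fi.
have mb n : measurable_fun Omega (bump sigma (dyadic R n) a b).
  apply: measurable_funTS; apply: continuous_measurable_plane.
  exact/smooth2_continuous/smooth2_bump.
have mfn n : measurable_fun Omega (fn n).
  by apply/measurable_EFinP; apply: measurable_funM.
have fnf n x : (`|fn n x| <= `|(f x)%:E|)%E.
  rewrite /fn /= lee_fin normrM ler_piMr//.
  by have /andP[h1 h2] := bump_itv ss (dyadic R n) a b x; rewrite ger0_norm.
have mlim : measurable_fun Omega (fun x => (f x * \1_(rect a b) x)%:E).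
  apply/measurable_EFinP; apply: measurable_funM => //.
  by apply: measurable_funTS; apply: measurable_indic; exact: measurable_rect.
have [] := @dominated_convergence _ _ R mu Omega mO fn _ (abse \o (EFin \o f)) mfn mlim.
- apply: aeW => x _; apply: cvg_EFin; first exact: nearW.
  by apply: cvgM; [exact: cvg_cst|exact: bump_cvg].
- exact: integrable_abse.
- by apply: aeW => x n _; exact: fnf.
move=> ilim _.
have -> : (fun n => (\int[mu]_(x in Omega) fn n x)%E) = cst 0%E.
  apply/funext => n.
  have fin : mu.-integrable Omega (fn n).
    apply: (@le_integrable _ _ _ mu Omega mO (fn n) (EFin \o f)).
    - exact: mfn.
    - by move=> x _; exact: fnf.
    - exact: fi.
  have := f0 _ (test_function_bump ss (dyadic_gt0 R n) abO).
  rewrite /Rintegral => h; rewrite -[LHS]fineK ?h//.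
  exact: integrable_fin_num.
move=> /cvg_lim; rewrite lim_cst// => /(_ (@ereal_hausdorff R)) h.
rewrite (_ : rect a b = Omega `&` rect a b); last first.
  by rewrite setIidr//; apply: subset_trans abO; exact: rect_crect.
rewrite integral_mkcondr h; apply: eq_integral => x _.
by rewrite patchE indicE; case: (x \in rect a b); rewrite ?mulr1 ?mulr0.
Qed.

Definition rects : set (set (plane R)) :=
  [set A | exists a b : plane R, A = rect a b].

Lemma rectI (a b c d : plane R) : rect a b `&` rect c d =
  rect (Num.max a.1 c.1, Num.max a.2 c.2) (Num.min b.1 d.1, Num.min b.2 d.2).
Proof.
have e (p q x y z : R) : (Num.max p q < x < Num.min y z) =
    (p < x < y) && (q < x < z).
  by rewrite gt_max lt_min; case: (p < x); case: (q < x); case: (x < y).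
apply/seteqP; split => x.
  move=> [h1 h2] i; have := h1 i; have := h2 i; rewrite /coord.
  by case: ifP => _ /= u v; rewrite e v u.
move=> h; split => i; have := h i; rewrite /coord;
  by case: ifP => _ /=; rewrite e => /andP[].
Qed.

(** The Borel sets of the plane are generated by the coordinate strips, and an
    open strip is a countable union of rectangles.  Rectangles are stable under
    intersection, so this sets the stage for an induction over a Dynkin
    system. *)
Lemma measurable_planeE : @measurable _ (plane R) = <<s rects >>.
Proof.
apply/seteqP; split; last first.
  apply: smallest_sub; first exact: sigma_algebra_measurable.
  by move=> _ [a [b ->]]; exact: measurable_rect.
pose T := g_sigma_algebraType rects.
have strip (i : 'I_2) : measurable_fun [set: T] (coord i : T -> R).
  apply: (measurability _ (RGenOpens.measurableE R)) => _ [_ [a [b ->]] <-].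
  pose c (n : nat) (s : R) : plane R := if i == 0 then (s, - n%:R) else (- n%:R, s).
  pose d (n : nat) (s : R) : plane R := if i == 0 then (s, n%:R) else (n%:R, s).
  rewrite setTI (_ : _ @^-1` _ = \bigcup_n rect (c n a) (d n b)); last first.
    apply/seteqP; split => [x|x [n _ /(_ i)]]; last first.
      by rewrite /= in_itv /= /c /d /coord; case: (i == 0).
    rewrite /= in_itv /= => h.
    pose N := Num.bound (Num.max `|x.1| `|x.2|).
    have : Num.max `|x.1| `|x.2| < N%:R.
      by apply: archi_boundP; rewrite le_max normr_ge0.
    rewrite gt_max !ltr_norml => /andP[N1 N2].
    exists N => // j; move: h; rewrite /c /d /coord.
    by case: i {c d} => [[|[|//]] ?]; case: j => [[|[|//]] ?].
  by apply: bigcupT_measurable => n; apply: sub_sigma_algebra; do 2 eexists.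
have mid : measurable_fun [set: T] (fun x : T => (coord 0 x, coord 1 x)).
  exact: measurable_fun_pair (strip 0) (strip 1).
move=> A mA; have := mid measurableT A mA; rewrite setTI.
by rewrite (_ : _ @^-1` A = A)//; apply/seteqP; split => -[x y].
Qed.

Lemma ball_rect (z : plane R) r :
  ball z r = rect (z.1 - r, z.2 - r) (z.1 + r, z.2 + r).
Proof.
by rewrite rectE /= ball_planeE !ball_itv.
Qed.

(** Smooth bumps converge to indicators of rectangles, so f has zero integral
    over every rectangle inside Omega, hence over every measurable subset of a
    small square. *)
Lemma fundamental_lemma Omega (f : plane R -> R) (sigma : R -> R) :
  open Omega -> smooth_step sigma ->
  mu.-integrable Omega (EFin \o f) ->
  (forall psi, test_function Omega psi ->
    \int[mu]_(x in Omega) (f x * psi x) = 0) ->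
  {ae mu, forall x, Omega x -> f x = 0}.
Proof.
move=> oO ss fi f0; have mO := open_measurable_plane oO.
apply: (ae_open (s := 0) oO (ltr0Sn R 1)) => z k zO; rewrite addn0.
set B := ball z (dyadic R k).
have d0 := dyadic_gt0 R k.
pose a : plane R := (z.1 - dyadic R k, z.2 - dyadic R k).
pose b : plane R := (z.1 + dyadic R k, z.2 + dyadic R k).
have BE : B = rect a b by exact: ball_rect.
have abO : crect a b `<=` Omega.
  move=> x; rewrite /crect /= !in_itv/= => -[/andP[h1 h2] /andP[h3 h4]].
  apply: zO; split; rewrite /ball/= ltr_distlC; apply/andP; split; lra.
have BO : B `<=` Omega.
  by rewrite BE; apply: subset_trans abO; exact: rect_crect.
have mB : measurable B by exact: measurable_ball_plane.
have fB : mu.-integrable B (EFin \o f) by exact: integrableS fi.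
(* The sets S for which P holds form a Dynkin system containing the rectangles. *)
pose P S := (\int[mu]_(x in B `&` S) (f x)%:E = 0)%E.
have PT : P setT.
  by rewrite /P setIT BE; exact: (integral_rect_eq0 mO ss fi f0 abO).
have PS : forall S, <<s rects >> S -> P S.
  apply: (dynkin_induction measurable_planeE) => //.
  - by move=> _ _ [a1 [b1 ->]] [a2 [b2 ->]]; rewrite rectI; do 2 eexists.
  - move=> _ [c [d ->]]; rewrite /P BE rectI.
    apply: (integral_rect_eq0 mO ss fi f0) => x.
    move=> [/=]; rewrite !in_itv /= => /andP[h1 h2] /andP[h3 h4].
    move: h1 h2 h3 h4; rewrite !ge_max !le_min.
    move=> /andP[h1 _] /andP[h2 _] /andP[h3 _] /andP[h4 _].
    by apply: abO; split; rewrite /= in_itv; apply/andP.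
  - move=> S mS PS; rewrite /P -setDE.
    have := PT; rewrite /P setIT -[X in integral _ X _](setDUK (@subIsetl _ B S)).
    rewrite integral_setU//=; last 4 first.
      exact: measurableI.
      by apply: measurableD => //; exact: measurableI.
      by rewrite setDUK; [case/integrableP: fB|exact: subIsetl].
      by apply/disj_set2P/seteqP; split => // x [? []].
    by rewrite PS add0e setDIr setDv set0U.
  - move=> F mF tF PF; rewrite /P setI_bigcupr integral_bigcup//.
    + by apply: eseries0 => i _ _; exact: PF.
    + by apply: trivIset_setIl.
    + by move=> n; apply: measurableI => //; exact: mF.
    + rewrite -setI_bigcupr; apply: (@integrableS _ _ _ mu B); [exact: mB| |exact: subIsetl|exact: fB].
      by apply: measurableI => //; apply: bigcup_measurable => n _; exact: mF.
have : ae_eq mu B (EFin \o f) (cst 0%E).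
  (* Zero integral over every measurable subset of B forces f = 0 there. *)
apply: integral_ae_eq => // E EB mE.
  rewrite integral0; have := PS E; rewrite /P setIidr//; apply.
  by rewrite -measurable_planeE.
by apply: filterS => x h Bx; have [] := h Bx.
Qed.

End Fundamental.

(** * Line integrals and the Poincare inequality on strips *)

Section Poincare.
Variable R : realType.
Local Notation mu := (leb2 R).
Local Notation leb := (@lebesgue_measure R).

(** Cauchy-Schwarz, without integrals of products: with m the mean slope of g on
    [x, y], integrate 2 m g' - m^2 <= g'^2. *)
Lemma sqr_increment_le_lt (g g' : R -> R) (x y : R) :
  (forall t : R, is_derive t 1 g (g' t)) -> continuous g' -> x < y ->
  (((g y - g x) ^+ 2)%:E <=
    (y - x)%:E * \int[leb]_(t in `[x, y]) (g' t ^+ 2)%:E)%E.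
Proof.
move=> dg cg xy; have L0 : 0 < y - x by rewrite subr_gt0.
pose m := (g y - g x) / (y - x).
pose G t := 2 * m * g t - m ^+ 2 * t.
pose h t := 2 * m * g' t - m ^+ 2.
have dG (t : R) : is_derive t 1 G (h t).
  have := dg t => dgt.
  by apply: is_derive_eq; rewrite /h /GRing.scale /=; ring.
have ch : continuous h.
  by move=> t; apply: cvgB; [apply: cvgM; [exact: cvg_cst|exact: cg]|exact: cvg_cst].
have cG : continuous G.
  by move=> t; apply/differentiable_continuous/derivable1_diffP/ex_derive.
have FTC : (\int[leb]_(t in `[x, y]) (h t)%:E = (G y)%:E - (G x)%:E)%E.
  apply: continuous_FTC2 => //.
  - exact: continuous_subspaceT.
  - split; first by move=> t _; exact: ex_derive.
      by apply: cvg_at_right_filter; exact: cG.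
    by apply: cvg_at_left_filter; exact: cG.
  - by move=> t _; rewrite derive1E (@derive_val _ _ _ _ _ _ _ (dG t)).
have -> : ((g y - g x) ^+ 2)%:E = ((y - x)%:E * \int[leb]_(t in `[x, y]) (h t)%:E)%E.
  rewrite FTC -EFinB -EFinM /G /m; congr EFin; field.
  by rewrite gt_eqF.
apply: lee_wpmul2l; first by rewrite lee_fin ltW.
have i1 : leb.-integrable `[x, y] (EFin \o h).
  apply: continuous_compact_integrable; first exact: segment_compact.
  exact: continuous_subspaceT.
have i2 : leb.-integrable `[x, y] (EFin \o (fun t => g' t ^+ 2)).
  apply: continuous_compact_integrable; first exact: segment_compact.
  apply: continuous_subspaceT => t; rewrite [X in continuous_at _ X](_ : _ = fun t => g' t * g' t)//.
  by apply: cvgM; exact: cg.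
apply: le_integral => // t _; rewrite lee_fin /h -subr_ge0.
by rewrite (_ : _ - _ = (g' t - m) ^+ 2) ?sqr_ge0//; ring.
Qed.

(** The right hand side no longer depends on x and y, which may come in either
    order; this is what averaging over lines requires. *)
Lemma sqr_increment_le (g g' : R -> R) (a b x y : R) :
  (forall t : R, is_derive t 1 g (g' t)) -> continuous g' ->
  a < x < b -> a < y < b ->
  (((g y - g x) ^+ 2)%:E <=
    (b - a)%:E * \int[leb]_(t in `]a, b[) (g' t ^+ 2)%:E)%E.
Proof.
move=> dg cg.
have mg (A : set R) : measurable_fun A (fun t => (g' t ^+ 2)%:E).
  apply/measurable_EFinP; apply: measurable_funX.
  by apply: measurable_funTS; exact: continuous_measurable_fun.
have H (p q : R) : a < p -> p < q -> q < b -> (((g q - g p) ^+ 2)%:E <=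
    (b - a)%:E * \int[leb]_(t in `]a, b[) (g' t ^+ 2)%:E)%E.
  move=> ap pq qb; apply: (le_trans (sqr_increment_le_lt dg cg pq)).
  apply: lee_pmul; [by rewrite lee_fin; lra| | |].
  - by apply: integral_ge0 => t _; rewrite lee_fin sqr_ge0.
  - by rewrite lee_fin; lra.
  apply: ge0_subset_integral => //.
  - exact: mg.
  - by move=> t _; rewrite lee_fin sqr_ge0.
  - by move=> t /=; rewrite !in_itv/= => /andP[h1 h2]; apply/andP; split; lra.
move=> /andP[ax xb] /andP[ay yb]; have [xy|yx|->] := ltgtP x y.
- exact: H.
- by rewrite -sqrrN opprB; exact: H.
- rewrite subrr expr0n/= mule_ge0 ?lee_fin//; first lra.
  by apply: integral_ge0 => t _; rewrite lee_fin sqr_ge0.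
Qed.

(** Functions of two variables with continuous partial derivatives; unlike
    smoothness this is visibly symmetric in the two variables. *)
Record C1_plane (w w1 w2 : plane R -> R) : Prop := {
  C1_c1 : continuous w1;
  C1_c2 : continuous w2;
  C1_c : continuous w;
  C1_d1 : forall x y : R, is_derive x 1 (fun s => w (s, y)) (w1 (x, y));
  C1_d2 : forall x y : R, is_derive y 1 (fun s => w (x, s)) (w2 (x, y)) }.

Definition swapp (x : plane R) : plane R := (x.2, x.1).

Lemma swapp_continuous : continuous swapp.
Proof. exact: swap_continuous. Qed.

Lemma C1_swap w w1 w2 : C1_plane w w1 w2 ->
  C1_plane (w \o swapp) (w2 \o swapp) (w1 \o swapp).
Proof.
move=> [c1 c2 c d1 d2]; split.
- by move=> x; apply: continuous_comp; [exact: swapp_continuous|exact: c2].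
- by move=> x; apply: continuous_comp; [exact: swapp_continuous|exact: c1].
- by move=> x; apply: continuous_comp; [exact: swapp_continuous|exact: c].
- by move=> x y; exact: d2.
- by move=> x y; exact: d1.
Qed.

Lemma smooth2_C1 w : smooth2 w -> C1_plane w (partial 0 w) (partial 1 w).
Proof.
move=> sw; split; try exact/smooth2_continuous/smooth2_partial.
- exact: smooth2_continuous.
- move=> x y; have e (s : R) : s *: basis_vector R 0 + (0, y) = (s, y) :> plane R.
    rewrite [LHS]surjective_pairing; congr pair.
      by apply: etrans (coordD 0 s 0 (0, y)) _; rewrite /coord /= ?mulr1 ?mulr0 ?addr0 ?add0r.
    by apply: etrans (coordD 1 s 0 (0, y)) _; rewrite /coord /= ?mulr1 ?mulr0 ?addr0 ?add0r.
  have -> : (fun s => w (s, y)) = fun s => w (s *: basis_vector R 0 + (0, y)).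
    by apply/funext => s; rewrite e.
  apply/is_derive_slice; rewrite e.
  by apply: DeriveDef => //; exact: smooth2_derivable.
- move=> x y; have e (s : R) : s *: basis_vector R 1 + (x, 0) = (x, s) :> plane R.
    rewrite [LHS]surjective_pairing; congr pair.
      by apply: etrans (coordD 0 s 1 (x, 0)) _; rewrite /coord /= ?mulr1 ?mulr0 ?addr0 ?add0r.
    by apply: etrans (coordD 1 s 1 (x, 0)) _; rewrite /coord /= ?mulr1 ?mulr0 ?addr0 ?add0r.
  have -> : (fun s => w (x, s)) = fun s => w (s *: basis_vector R 1 + (x, 0)).
    by apply/funext => s; rewrite e.
  apply/is_derive_slice; rewrite e.
  by apply: DeriveDef => //; exact: smooth2_derivable.
Qed.

Implicit Types f g w : plane R -> R.

Definition sqint (A : set (plane R)) (f : plane R -> R) : \bar R :=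
  (\int[mu]_(x in A) (f x ^+ 2)%:E)%E.

Lemma sqint_ge0 A f : (0 <= sqint A f)%E.
Proof. by apply: integral_ge0 => x _; rewrite lee_fin sqr_ge0. Qed.

Lemma measurable_sqr (A : set (plane R)) f :
  measurable_fun A f -> measurable_fun A (fun x => (f x ^+ 2)%:E).
Proof. by move=> mf; apply/measurable_EFinP; exact: measurable_funX. Qed.

Lemma subset_sqint A B f : measurable A -> measurable B -> measurable_fun B f ->
  A `<=` B -> (sqint A f <= sqint B f)%E.
Proof.
move=> mA mB mf AB; apply: ge0_subset_integral => //.
  exact: measurable_sqr.
by move=> x _; rewrite lee_fin sqr_ge0.
Qed.

Lemma sqintU A B f : measurable A -> measurable B -> measurable_fun (A `|` B) f ->
  [disjoint A & B] -> sqint (A `|` B) f = (sqint A f + sqint B f)%E.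
Proof.
move=> mA mB mf AB; apply: ge0_integral_setU => //.
  exact: measurable_sqr.
by move=> x _; rewrite lee_fin sqr_ge0.
Qed.

Lemma sqintU_le A B f : measurable A -> measurable B -> measurable_fun (A `|` B) f ->
  (sqint (A `|` B) f <= sqint A f + sqint B f)%E.
Proof.
move=> mA mB mf.
have mD : measurable (B `\` A) by exact: measurableD.
have e : A `|` B = A `|` (B `\` A).
  apply/seteqP; split => x; last by case=> [|[]]; [left|right].
  by move=> ABx; have [Ax|nAx] := pselect (A x); [left|right; case: ABx].
have mf' : measurable_fun (A `|` (B `\` A)) f by rewrite -e.
rewrite {1}e (sqintU mA mD mf'); last by apply/disj_set2P/seteqP; split => // x [? []].
apply: leeD2l; apply: subset_sqint => //.
apply: (@measurable_funS _ _ _ _ (A `|` B)) => //.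
by exact: measurableU.
Qed.

Lemma tonelli_rect (A B : set R) (F : plane R -> \bar R) :
  measurable A -> measurable B -> measurable_fun setT F -> (forall x, 0 <= F x)%E ->
  (\int[mu]_(x in A `*` B) F x = \int[leb]_(y in B) \int[leb]_(x in A) F (x, y))%E.
Proof.
move=> mA mB mF F0; have mAB : measurable (A `*` B) by exact: measurableX.
rewrite integral_mkcond fubini_tonelli2//.
- rewrite [RHS]integral_mkcond; apply: eq_integral => y _.
  rewrite /fubini_G patchE; case: ifPn => [yB|yB].
    rewrite [RHS]integral_mkcond; apply: eq_integral => x _.
    by rewrite !patchE in_setX yB andbT.
  by apply: integral0_eq => x _; rewrite patchE in_setX (negbTE yB) andbF.
- by apply: (measurable_restrictT F mAB).1; exact: measurable_funTS.
- by move=> x; rewrite patchE; case: ifP.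
Qed.

Lemma tonelli_rect2 (A B : set R) (F : plane R -> \bar R) :
  measurable A -> measurable B -> measurable_fun setT F -> (forall x, 0 <= F x)%E ->
  (\int[mu]_(x in A `*` B) F x = \int[leb]_(x in A) \int[leb]_(y in B) F (x, y))%E.
Proof.
move=> mA mB mF F0; have mAB : measurable (A `*` B) by exact: measurableX.
rewrite integral_mkcond fubini_tonelli1//.
- rewrite [RHS]integral_mkcond; apply: eq_integral => x _.
  rewrite /fubini_F patchE; case: ifPn => [yB|yB].
    rewrite [RHS]integral_mkcond; apply: eq_integral => y _.
    by rewrite !patchE in_setX yB.
  by apply: integral0_eq => y _; rewrite patchE in_setX (negbTE yB).
- by apply: (measurable_restrictT F mAB).1; exact: measurable_funTS.
- by move=> x; rewrite patchE; case: ifP.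
Qed.

(** Lets statements about columns be read as statements about rows. *)
Lemma sqint_swap (A B : set R) (f : plane R -> R) :
  measurable A -> measurable B -> measurable_fun setT f ->
  sqint (A `*` B) (f \o swapp) = sqint (B `*` A) f.
Proof.
move=> mA mB mf; rewrite /sqint tonelli_rect//.
- by rewrite tonelli_rect2//; [exact: measurable_sqr|move=> x; rewrite lee_fin sqr_ge0].
- apply: measurable_sqr; apply: measurableT_comp => //.
  by apply: measurable_fun_pair; [exact: measurable_snd|exact: measurable_fst].
- by move=> x; rewrite lee_fin sqr_ge0.
Qed.

Lemma measurable_col_energy (B : set R) f : measurable B -> measurable_fun setT f ->
  measurable_fun setT (fun x => \int[leb]_(y in B) (f (x, y) ^+ 2)%:E)%E.
Proof.
move=> mB mf.
have mTB : measurable (setT `*` B : set (plane R)) by exact: measurableX.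
have /(measurable_fun_fubini_tonelli_F (m2 := leb)) : measurable_fun setT
   ((fun x : plane R => (f x ^+ 2)%:E) \_ (setT `*` B)).
  by apply: (measurable_restrictT _ mTB).1; apply: measurable_sqr; exact: measurable_funTS.
have h0 x : (0 <= ((fun x : plane R => (f x ^+ 2)%:E) \_ (setT `*` B)) x)%E.
  by rewrite patchE; case: ifP => // _; rewrite lee_fin sqr_ge0.
move=> /(_ h0); congr measurable_fun; apply/funext => x; rewrite /fubini_F.
rewrite [RHS]integral_mkcond; apply: eq_integral => y _.
by rewrite !patchE in_setX in_setT.
Qed.

Lemma measurable_row_energy (A : set R) f : measurable A -> measurable_fun setT f ->
  measurable_fun setT (fun y => \int[leb]_(x in A) (f (x, y) ^+ 2)%:E)%E.
Proof.
move=> mA mf; apply: (@measurable_col_energy A (f \o swapp)) => //.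
apply: measurableT_comp => //.
by apply: measurable_fun_pair; [exact: measurable_snd|exact: measurable_fst].
Qed.

(** If every column over A carried more than the average, so would the whole
    rectangle.  The margin eps makes the comparison strict. *)
Lemma exists_good_line (A B : set R) (f : plane R -> R) (m p eps : R) :
  measurable A -> measurable B -> measurable_fun setT f ->
  leb A = m%:E -> 0 < m -> 0 < eps -> (sqint (A `*` B) f <= p%:E)%E ->
  exists2 x, A x & (\int[leb]_(y in B) (f (x, y) ^+ 2)%:E <= ((p + eps) / m)%:E)%E.
Proof.
move=> mA mB mf Am m0 e0 fp; apply: contrapT => noline.
have lb x : A x -> (((p + eps) / m)%:E <= \int[leb]_(y in B) (f (x, y) ^+ 2)%:E)%E.
  move=> Ax; have [h|/ltW//] := leP (\int[leb]_(y in B) (f (x, y) ^+ 2)%:E)%E ((p + eps) / m)%:E.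
  by exfalso; apply: noline; exists x.
have mff : measurable_fun setT (fun x : plane R => (f x ^+ 2)%:E) by exact: measurable_sqr.
have := fp; rewrite /sqint tonelli_rect2//; last by move=> x; rewrite lee_fin sqr_ge0.
apply/negP; rewrite -ltNge.
apply: (@lt_le_trans _ _ (\int[leb]_(x in A) (cst ((p + eps) / m)%:E) x)%E).
  have -> : (\int[leb]_(x in A) (cst ((p + eps) / m)%:E) x)%E = (((p + eps) / m)%:E * m%:E)%E.
    by rewrite -Am; exact: integral_cst.
  by rewrite -EFinM lte_fin divfK ?gt_eqF// ltrDl.
have p0 : 0 <= p by rewrite -lee_fin; apply: le_trans fp; exact: sqint_ge0.
have mF : measurable_fun A (fun x => \int[leb]_(y in B) (f (x, y) ^+ 2)%:E)%E.
  by apply: measurable_funTS; exact: measurable_col_energy.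
apply: ge0_le_integral => //.
- by move=> x _; rewrite /cst lee_fin divr_ge0//; lra.
Qed.

(** Going from (x, y) to (x0, y0) first horizontally and then along the fixed
    column x0 costs the energy on the row of y and the energy q on that column. *)
Lemma strip_poincare w w1 w2 (a b c d x0 y0 m p q : R) (B : set R) :
  C1_plane w w1 w2 -> measurable B -> B `<=` `]c, d[ -> leb B = m%:E ->
  a < x0 < b -> c < y0 < d ->
  (sqint (`]a, b[ `*` B) w1 <= p%:E)%E ->
  (\int[leb]_(y in `]c, d[) (w2 (x0, y) ^+ 2)%:E <= q%:E)%E ->
  (sqint (`]a, b[ `*` B) (fun x => w x - w (x0, y0))%R <=
    (2 * (b - a) ^+ 2 * p + 2 * (b - a) * (d - c) * m * q)%:E)%E.
Proof.
move=> [c1 c2 cw d1 d2] mB Bcd Bm ax0 cy0 hp hq.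
have ab : 0 < b - a by move: ax0; lra.
have cd : 0 < d - c by move: cy0; lra.
have m0 : 0 <= m by rewrite -lee_fin -Bm.
have q0 : 0 <= q.
  by rewrite -lee_fin; apply: le_trans hq; apply: integral_ge0 => y _; rewrite lee_fin sqr_ge0.
have cont1 (f : plane R -> R) y : continuous f -> continuous (fun s : R => f (s, y)).
  move=> cf s; apply: (@continuous_comp _ _ _ (fun s : R => (s, y)) f); last exact: cf.
  by apply: (@cvg_pair _ _ _ _ (nbhs s) (nbhs y)); [exact: cvg_id|exact: cvg_cst].
have cont2 (f : plane R -> R) x : continuous f -> continuous (fun s : R => f (x, s)).
  move=> cf s; apply: (@continuous_comp _ _ _ (fun s : R => (x, s)) f); last exact: cf.
  by apply: (@cvg_pair _ _ _ _ (nbhs x) (nbhs s)); [exact: cvg_cst|exact: cvg_id].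
pose F (y : R) := (\int[leb]_(t in `]a, b[) (w1 (t, y) ^+ 2)%:E)%E.
have F0 y : (0 <= F y)%E by apply: integral_ge0 => t _; rewrite lee_fin sqr_ge0.
have mab : measurable (`]a, b[ : set R) by exact: measurable_itv.
have pt x y : `]a, b[%classic x -> B y -> (((w (x, y) - w (x0, y0)) ^+ 2)%:E <=
    (2 * (b - a))%:E * F y + (2 * (d - c) * q)%:E)%E.
  rewrite /= in_itv /= => axb /Bcd; rewrite /= in_itv /= => cyd.
  have h1 := sqr_increment_le (fun t => d1 t y) (cont1 _ y c1) ax0 axb.
  have h2 := sqr_increment_le (fun t => d2 x0 t) (cont2 _ x0 c2) cy0 cyd.
  apply: (@le_trans _ _ (2%:E * ((w (x, y) - w (x0, y)) ^+ 2)%:E +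
                         2%:E * ((w (x0, y) - w (x0, y0)) ^+ 2)%:E)%E).
    rewrite -!EFinM -EFinD lee_fin -subr_ge0.
    rewrite (_ : _ - _ = (w (x, y) - w (x0, y) - (w (x0, y) - w (x0, y0))) ^+ 2) ?sqr_ge0//.
    by ring.
  apply: leeD.
    by rewrite [(2 * (b - a))%:E]EFinM -muleA; apply: lee_wpmul2l => //; rewrite lee_fin.
  rewrite -mulrA [(2 * _)%:E]EFinM; apply: lee_wpmul2l; first by rewrite lee_fin.
  apply: (le_trans h2); rewrite EFinM; apply: lee_wpmul2l => //.
  by rewrite lee_fin ltW.
have mF : measurable_fun setT F.
  by apply: measurable_row_energy => //; exact: continuous_measurable_plane.
have mG : measurable_fun B (fun y => (2 * (b - a))%:E * F y + (2 * (d - c) * q)%:E)%E.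
  apply: emeasurable_funD => //; apply: measurable_funeM.
  exact: measurable_funTS.
have G0 y : (0 <= (2 * (b - a))%:E * F y + (2 * (d - c) * q)%:E)%E.
  apply: adde_ge0; first by apply: mule_ge0 => //; rewrite lee_fin; lra.
  by rewrite lee_fin !mulr_ge0// ltW.
have lab : leb `]a, b[ = (b - a)%:E.
  by rewrite lebesgue_measure_itv /= lte_fin -subr_gt0 ab -EFinD.
have mw1 : measurable_fun setT (fun x : plane R => (w1 x ^+ 2)%:E).
  by apply: measurable_sqr; exact: continuous_measurable_plane.
have mww : measurable_fun setT (fun x : plane R => ((w x - w (x0, y0)) ^+ 2)%:E).
  apply: measurable_sqr; apply: continuous_measurable_plane => x.
  by apply: cvgB; [exact: cw|exact: cvg_cst].
rewrite /sqint tonelli_rect//; last by move=> x; rewrite lee_fin sqr_ge0.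
apply: (@le_trans _ _ (\int[leb]_(y in B)
    ((b - a)%:E * ((2 * (b - a))%:E * F y + (2 * (d - c) * q)%:E)))%E).
  apply: ge0_le_integral => //.
  - by move=> y _; apply: integral_ge0 => x _; rewrite lee_fin sqr_ge0.
  - apply: measurable_funTS.
    apply: (@measurable_row_energy _ (fun x => w x - w (x0, y0))%R) => //.
    apply: continuous_measurable_plane => x.
    by apply: cvgB; [exact: cw|exact: cvg_cst].
  - exact: measurable_funeM.
  - move=> y By; rewrite muleC -lab.
    rewrite -[X in (_ <= X)%E](integral_cst leb mab).
    apply: ge0_le_integral => //.
    + by move=> x _; rewrite lee_fin sqr_ge0.
    + apply/measurable_EFinP; apply: measurable_funX; apply: measurable_funTS.
      apply: continuous_measurable_fun; apply: (cont1 (fun x => w x - w (x0, y0))%R) => x.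
      by apply: cvgB; [exact: cw|exact: cvg_cst].
    + by move=> x abx; exact: pt.
rewrite ge0_integralZl//; last by rewrite lee_fin ltW.
rewrite ge0_integralD//; last 3 first.
- by move=> y _; apply: mule_ge0 => //; rewrite lee_fin; lra.
- by apply: measurable_funeM; exact: measurable_funTS.
- by move=> y _; rewrite lee_fin !mulr_ge0// ltW.
rewrite ge0_integralZl//; last 2 first.
- exact: measurable_funTS.
- by rewrite lee_fin; lra.
have -> : (\int[leb]_(y in B) (2 * (d - c) * q)%:E)%E = ((2 * (d - c) * q)%:E * m%:E)%E.
  by rewrite -Bm; exact: integral_cst.
have -> : (\int[leb]_(y in B) F y)%E = sqint (`]a, b[ `*` B) w1.
  by rewrite /sqint tonelli_rect// => x; rewrite lee_fin sqr_ge0.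
apply: (@le_trans _ _ ((b - a)%:E * ((2 * (b - a))%:E * p%:E + (2 * (d - c) * q)%:E * m%:E))%E).
  apply: lee_wpmul2l; first by rewrite lee_fin ltW.
  by apply: leeD2r; apply: lee_wpmul2l => //; rewrite lee_fin; lra.
rewrite -!EFinM lee_fin le_eqVlt; apply/orP; left; apply/eqP; ring.
Qed.

End Poincare.

(** * The Poincare inequality on squares and square annuli *)

Section PoincareSquares.
Variable R : realType.
Local Notation mu := (leb2 R).
Local Notation leb := (@lebesgue_measure R).
Implicit Types f g w : plane R -> R.

Lemma measure_ball (x r : R) : 0 < r -> leb (ball x r) = (2 * r)%:E.
Proof.
move=> r0; rewrite ball_itv lebesgue_measure_itv /= lte_fin.
rewrite (_ : x - r < x + r = true); last by lra.
by rewrite -EFinD; congr EFin; ring.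
Qed.

(** Every point is joined to one point of a good column: a horizontal segment,
    then a piece of that column. *)
Lemma poincare_ball w w1 w2 (z : plane R) (r p eps : R) :
  C1_plane w w1 w2 -> 0 < r -> 0 < eps ->
  (sqint (ball z r) w1 <= p%:E)%E -> (sqint (ball z r) w2 <= p%:E)%E ->
  exists c, (sqint (ball z r) (fun x => w x - c)%R <= (16 * r ^+ 2 * (p + eps))%:E)%E.
Proof.
move=> C1 r0 e0 h1 h2.
have mb (x : R) : measurable (ball x r) by exact: measurable_ball.
have mw2 := continuous_measurable_plane (C1_c2 C1).
have r20 : 0 < 2 * r by lra.
have p0 : 0 <= p by rewrite -lee_fin; apply: le_trans h1; exact: sqint_ge0.
have [x0 x0b hx0] := exists_good_line (mb z.1) (mb z.2) mw2 (measure_ball _ r0) r20 e0 h2.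
exists (w (x0, z.2)).
move: h1 x0b hx0; rewrite ball_planeE !ball_itv => h1 x0b hx0.
have mJ : measurable (`]z.2 - r, z.2 + r[ : set R) by exact: measurable_itv.
have lJ : leb `]z.2 - r, z.2 + r[ = (2 * r)%:E by rewrite -ball_itv measure_ball.
have z2 : z.2 - r < z.2 < z.2 + r by apply/andP; split; lra.
have sJ : `]z.2 - r, z.2 + r[%classic `<=` `]z.2 - r, z.2 + r[%classic by [].
rewrite /= in_itv /= in x0b.
apply: (le_trans (strip_poincare C1 mJ sJ lJ x0b z2 h1 hx0)).
rewrite lee_fin (_ : _ + _ = 16 * r ^+ 2 * p + 8 * r ^+ 2 * eps); last by field; lra.
have : 0 <= r ^+ 2 * eps by rewrite mulr_ge0// ?ltW// exprn_gt0.
by lra.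
Qed.

(** The annulus is the union of two full-width horizontal strips (together
    I x I') and two full-height vertical strips (together I' x I), where I' is I
    without its middle half.  A column over I' and a row over I' avoid the hole;
    choose a good one of each.  Both the horizontal and the vertical strips are
    compared with the value of w at their crossing point, hence with a common
    constant. *)
Lemma poincare_annulus w w1 w2 (z : plane R) (r p eps : R) :
  C1_plane w w1 w2 -> 0 < r -> 0 < eps ->
  (sqint (ball z (2 * r) `\` ball z r) w1 <= p%:E)%E ->
  (sqint (ball z (2 * r) `\` ball z r) w2 <= p%:E)%E ->
  exists c, (sqint (ball z (2 * r) `\` ball z r) (fun x => w x - c)%R
     <= (128 * r ^+ 2 * (p + eps))%:E)%E.
Proof.
move=> C1 r0 e0 h1 h2.
have mb (x s : R) : measurable (ball x s) by exact: measurable_ball.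
have mw1 := continuous_measurable_plane (C1_c1 C1).
have mw2 := continuous_measurable_plane (C1_c2 C1).
have r20 : 0 < 2 * r by lra.
have p0 : 0 <= p by rewrite -lee_fin; apply: le_trans h1; exact: sqint_ge0.
pose I (x : R) := ball x (2 * r); pose I' (x : R) := ball x (2 * r) `\` ball x r.
have mI' x : measurable (I' x) by exact: measurableD.
have mI x : measurable (I x) by exact: mb.
have mII' x y : measurable (I x `*` I' y) by exact: measurableX.
have mI'I x y : measurable (I' x `*` I y) by exact: measurableX.
have lI' x : leb (I' x) = (2 * r)%:E.
  have fb : (leb (ball x (2 * r)) < +oo)%E by rewrite measure_ball// ltry.
  rewrite /I' (@measureD _ _ _ leb _ _ (mb _ _) (mb _ _) fb).
  rewrite setIidr; last by apply: le_ball; lra.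
  transitivity ((2 * (2 * r))%:E - (2 * r)%:E)%E; last by rewrite -EFinD; congr EFin; ring.
  by congr (_ - _)%E; exact: measure_ball.
set A := ball z (2 * r) `\` ball z r.
have mA : measurable A by apply: measurableD; exact: measurable_ball_plane.
have AE : A = (I z.1 `*` I' z.2) `|` (I' z.1 `*` I z.2).
  rewrite /A !ball_planeE /I' /I; apply/seteqP; split => x.
    move=> [[x1 x2] nx]; have [x1r|nx1] := pselect (ball z.1 r x.1).
      by left; split => //; split => // x2r; apply: nx; split.
    by right; split => //; split.
  by move=> [[x1 [x2 nx]]|[[x1 nx] x2]]; (split; first by split) => -[].
have H1 : (sqint (I z.1 `*` I' z.2) w1 <= p%:E)%E.
  apply: le_trans h1; apply: subset_sqint => //; first exact: measurable_funTS.
  by rewrite -/A AE; exact: subsetUl.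
have H2 : (sqint (I' z.1 `*` I z.2) w2 <= p%:E)%E.
  apply: le_trans h2; apply: subset_sqint => //; first exact: measurable_funTS.
  by rewrite -/A AE; exact: subsetUr.
have mw1s : measurable_fun setT (w1 \o @swapp R).
  exact: continuous_measurable_plane (C1_c2 (C1_swap C1)).
have H1s : (sqint (I' z.2 `*` I z.1) (w1 \o @swapp R) <= p%:E)%E.
  by rewrite sqint_swap.
have H2s : (sqint (I z.2 `*` I' z.1) (w2 \o @swapp R) <= p%:E)%E.
  by rewrite sqint_swap.
have [x0 x0b hx0] := exists_good_line (mI' z.1) (mb z.2 (2 * r)) mw2 (lI' _) r20 e0 H2.
have [y0 y0b hy0] := exists_good_line (mI' z.2) (mb z.1 (2 * r)) mw1s (lI' _) r20 e0 H1s.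
exists (w (x0, y0)).
have bI (x y : R) : I' x y -> x - 2 * r < y < x + 2 * r.
  by move=> [+ _]; rewrite ball_itv /= in_itv.
have sI x : I' x `<=` `]x - 2 * r, x + 2 * r[%classic.
  by rewrite /I' ball_itv; exact: subDsetl.
have Q1 : (sqint (I z.1 `*` I' z.2) (fun x => w x - w (x0, y0))%R
    <= (64 * r ^+ 2 * (p + eps))%:E)%E.
  move: H1 hx0; rewrite /I !ball_itv => H1 hx0.
  apply: (le_trans (strip_poincare C1 (mI' _) (@sI _) (lI' _) (bI _ _ x0b) (bI _ _ y0b) H1 hx0)).
  rewrite lee_fin (_ : _ + _ = 64 * r ^+ 2 * p + 32 * r ^+ 2 * eps); last by field; lra.
  have : 0 <= r ^+ 2 * eps by rewrite mulr_ge0// ?ltW// exprn_gt0.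
  by lra.
have mww : measurable_fun setT (fun x => w x - w (x0, y0))%R.
  apply: continuous_measurable_plane => x.
  by apply: cvgB; [exact: (C1_c C1)|exact: cvg_cst].
have Q2 : (sqint (I' z.1 `*` I z.2) (fun x => w x - w (x0, y0))%R
    <= (64 * r ^+ 2 * (p + eps))%:E)%E.
  rewrite -sqint_swap//.
  move: H2s hy0; rewrite /I !ball_itv => H2s hy0.
  apply: (le_trans (strip_poincare (C1_swap C1) (mI' _) (@sI _) (lI' _) (bI _ _ y0b) (bI _ _ x0b) H2s hy0)).
  rewrite lee_fin (_ : _ + _ = 64 * r ^+ 2 * p + 32 * r ^+ 2 * eps); last by field; lra.
  have : 0 <= r ^+ 2 * eps by rewrite mulr_ge0// ?ltW// exprn_gt0.
  by lra.
rewrite AE; have := sqintU_le (mII' z.1 z.2) (mI'I z.1 z.2) (measurable_funTS mww).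
move=> /le_trans; apply.
apply: (le_trans (leeD Q1 Q2)); rewrite -EFinD lee_fin.
by rewrite le_eqVlt; apply/orP; left; apply/eqP; ring.
Qed.

End PoincareSquares.

(** * Coercivity and growth of the stress *)

Section MatrixAlgebra.
Variable R : realType.
Implicit Types A B : 'M[R]_2.

Lemma sum_ord2 (V : nmodType) (F : 'I_2 -> V) : \sum_i F i = F 0 + F 1.
Proof.
rewrite big_ord_recl big_ord_recl big_ord0 addr0; congr (_ + F _).
exact: val_inj.
Qed.

Lemma ord2 (i : 'I_2) : i = 0 \/ i = 1.
Proof. by case: i => [[|[|//]] ?]; [left|right]; exact: val_inj. Qed.

Lemma frobenius2E A B : frobenius A B =
  A 0 0 * B 0 0 + A 0 1 * B 0 1 + A 1 0 * B 1 0 + A 1 1 * B 1 1.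
Proof. by rewrite /frobenius !sum_ord2 !addrA. Qed.

Lemma det2E A : \det A = A 0 0 * A 1 1 - A 0 1 * A 1 0.
Proof.
have [e00 e01 _ _] := cofE A; move: e00 e01; rewrite !mxE => e00 e01.
by rewrite (expand_det_row A 0) sum_ord2 e00 e01 mulrN.
Qed.

(** The field in the weak equation, with k in place of rho'(det A). *)
Definition stress (k : R) A : 'M[R]_2 := A + k *: cof A.

Lemma stressE k A : [/\ stress k A 0 0 = A 0 0 + k * A 1 1,
  stress k A 0 1 = A 0 1 - k * A 1 0, stress k A 1 0 = A 1 0 - k * A 0 1 &
  stress k A 1 1 = A 1 1 + k * A 0 0].
Proof.
have [e00 e01 e10 e11] := cofE A.
have e i j : stress k A i j = A i j + k * cof A i j by rewrite !mxE.
by rewrite !e e00 e01 e10 e11 !mulrN.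
Qed.

(** Since cof A . A = 2 det A, the nonlinear part of the stress works against
    A with a favourable sign. *)
Lemma stress_coercive k A : 0 <= k * \det A ->
  frobenius A A <= frobenius (stress k A) A.
Proof.
move=> kA; have [e00 e01 e10 e11] := stressE k A.
rewrite !frobenius2E e00 e01 e10 e11 -subr_ge0.
rewrite (_ : _ - _ = 2 * (k * \det A)); first by rewrite mulr_ge0.
by rewrite det2E; ring.
Qed.

(** The cofactor matrix permutes the entries of A up to sign, hence has the same
    norm. *)
Lemma stress_bounded k gamma A : 0 <= k <= gamma ->
  frobenius (stress k A) (stress k A) <= (2 + 2 * gamma ^+ 2) * frobenius A A.
Proof.
move=> /andP[k0 kg]; have [e00 e01 e10 e11] := stressE k A.
have kk : k ^+ 2 <= gamma ^+ 2 by rewrite lerXn2r// nnegrE// (le_trans k0).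
have H (a b : R) : (a + k * b) * (a + k * b) <= 2 * a ^+ 2 + 2 * gamma ^+ 2 * b ^+ 2.
  apply: (@le_trans _ _ (2 * a ^+ 2 + 2 * k ^+ 2 * b ^+ 2)).
    rewrite -subr_ge0 (_ : _ - _ = (a - k * b) ^+ 2) ?sqr_ge0//; ring.
  by rewrite lerD2l ler_wpM2r ?sqr_ge0// ler_wpM2l.
have H' (a b : R) : (a - k * b) * (a - k * b) <= 2 * a ^+ 2 + 2 * gamma ^+ 2 * b ^+ 2.
  by have := H a (- b); rewrite mulrN sqrrN.
rewrite !frobenius2E e00 e01 e10 e11.
have := H (A 0 0) (A 1 1); have := H (A 1 1) (A 0 0).
have := H' (A 0 1) (A 1 0); have := H' (A 1 0) (A 0 1).
lra.
Qed.

Lemma frobenius_ge0 A : 0 <= frobenius A A.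
Proof. by rewrite frobenius2E !addr_ge0// -expr2 sqr_ge0. Qed.

Lemma sqr_entry_le A i j : A i j ^+ 2 <= frobenius A A.
Proof.
rewrite frobenius2E -!expr2.
have := sqr_ge0 (A 0 0); have := sqr_ge0 (A 0 1).
have := sqr_ge0 (A 1 0); have := sqr_ge0 (A 1 1).
by case: (ord2 i) => ->; case: (ord2 j) => ->; lra.
Qed.

(** The parameter d is sent to zero against the approximation error and set to
    1/2 where no smallness is required. *)
Lemma frobenius_young (d : R) A B : 0 < d ->
  frobenius A B <= d * frobenius A A + (4 * d)^-1 * frobenius B B.
Proof.
move=> d0; have H (a b : R) : a * b <= d * (a * a) + (4 * d)^-1 * (b * b).
  rewrite -subr_ge0 (_ : _ - _ = d * (a - (2 * d)^-1 * b) ^+ 2).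
    by rewrite mulr_ge0 ?sqr_ge0// ltW.
  by field; lra.
rewrite !frobenius2E.
have := H (A 0 0) (B 0 0); have := H (A 0 1) (B 0 1).
have := H (A 1 0) (B 1 0); have := H (A 1 1) (B 1 1).
by move: ((4 * d)^-1) => t; lra.
Qed.

End MatrixAlgebra.

(** * Square integrable functions on a set *)

Section L2.
Variable R : realType.
Local Notation mu := (leb2 R).
Implicit Types (f g h : plane R -> R).

Lemma integrable_add (Omega : set (plane R)) f g : measurable Omega ->
  mu.-integrable Omega (EFin \o f) -> mu.-integrable Omega (EFin \o g) ->
  mu.-integrable Omega (EFin \o (fun x => f x + g x)).
Proof. by move=> mO fi gi; apply: (@integrableD _ _ _ mu Omega mO (EFin \o f) (EFin \o g)). Qed.

Lemma integrable_scale (Omega : set (plane R)) (c : R) f : measurable Omega ->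
  mu.-integrable Omega (EFin \o f) ->
  mu.-integrable Omega (EFin \o (fun x => c * f x)).
Proof. by move=> mO fi; apply: (@integrableZl _ _ _ mu Omega mO c (EFin \o f)). Qed.

Lemma integrable_sub (Omega : set (plane R)) f g : measurable Omega ->
  mu.-integrable Omega (EFin \o f) -> mu.-integrable Omega (EFin \o g) ->
  mu.-integrable Omega (EFin \o (fun x => f x - g x)).
Proof. by move=> mO fi gi; apply: (@integrableB _ _ _ mu Omega mO (EFin \o f) (EFin \o g)). Qed.

Definition L2on (Omega : set (plane R)) f : Prop :=
  measurable_fun Omega f /\ (sqint Omega f < +oo)%E.

Lemma L2on_integrable Omega f : measurable Omega -> L2on Omega f ->
  mu.-integrable Omega (EFin \o (fun x => f x ^+ 2)).
Proof.
move=> mO [mf fi]; apply/integrableP; split.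
  by apply/measurable_EFinP; exact: measurable_funX.
apply: le_lt_trans fi; rewrite le_eqVlt; apply/orP; left; apply/eqP.
by apply: eq_integral => x _ /=; rewrite ger0_norm// sqr_ge0.
Qed.

Lemma L2on_dom Omega f g : measurable Omega -> measurable_fun Omega f ->
  mu.-integrable Omega (EFin \o g) ->
  (forall x, Omega x -> f x ^+ 2 <= g x) -> L2on Omega f.
Proof.
move=> mO mf gi fg; split => //.
apply: (@le_lt_trans _ _ (\int[mu]_(x in Omega) (g x)%:E)%E).
  apply: ge0_le_integral => //.
  - by move=> x _; rewrite lee_fin sqr_ge0.
  - exact: measurable_sqr.
  - by case/integrableP: gi.
have := @integrable_fin_num _ _ _ mu Omega mO _ gi.
rewrite ge0_fin_numE// integral_ge0// => x Ox.
by rewrite lee_fin; apply: le_trans (fg _ Ox); exact: sqr_ge0.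
Qed.

Lemma L2on_le Omega f g h : measurable Omega -> measurable_fun Omega h ->
  L2on Omega f -> L2on Omega g ->
  (forall x, Omega x -> h x ^+ 2 <= 2 * f x ^+ 2 + 2 * g x ^+ 2) -> L2on Omega h.
Proof.
move=> mO mh Lf Lg; apply: L2on_dom => //.
have i1 := integrable_scale 2 mO (L2on_integrable mO Lf).
have i2 := integrable_scale 2 mO (L2on_integrable mO Lg).
exact: integrable_add mO i1 i2.
Qed.

Lemma L2on_subset A Omega f : measurable A -> measurable Omega -> A `<=` Omega ->
  L2on Omega f -> L2on A f.
Proof.
move=> mA mO AO [mf fi]; split; first exact: measurable_funS mf.
by apply: le_lt_trans fi; exact: subset_sqint.
Qed.

Lemma integrable_indic A Omega f : measurable A -> measurable Omega -> A `<=` Omega ->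
  mu.-integrable A (EFin \o f) ->
  mu.-integrable Omega (EFin \o (fun x => \1_A x * f x)).
Proof.
move=> mA mO AO fi.
have -> : EFin \o (fun x => \1_A x * f x) = (EFin \o f) \_ A.
  by apply/funext => x; rewrite patchE /= indicE; case: (x \in A); rewrite ?mul1r ?mul0r.
apply: (integrableS measurableT mO) => //.
exact: (integrable_mkcond _ mA).1.
Qed.

Lemma Rintegral_indic A Omega f : A `<=` Omega ->
  \int[mu]_(x in Omega) (\1_A x * f x) = \int[mu]_(x in A) f x.
Proof.
move=> AO; rewrite -(setIidr AO) Rintegral_mkcondr; apply: eq_Rintegral => x _.
by rewrite patchE indicE setIidr//; case: (x \in A); rewrite ?mul1r ?mul0r.
Qed.

Lemma L2onM Omega f g : measurable Omega -> L2on Omega f -> L2on Omega g ->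
  mu.-integrable Omega (EFin \o (fun x => f x * g x)).
Proof.
move=> mO Lf Lg; have [mf _] := Lf; have [mg _] := Lg.
have i1 := L2on_integrable mO Lf; have i2 := L2on_integrable mO Lg.
apply: (@le_integrable _ _ _ mu Omega mO _ _ _ _ (integrable_add mO i1 i2)).
  by apply/measurable_EFinP; exact: measurable_funM.
move=> x _ /=; rewrite lee_fin [leRHS]ger0_norm ?addr_ge0 ?sqr_ge0//.
have h1 := sqr_ge0 (f x - g x); have h2 := sqr_ge0 (f x + g x).
have h3 := sqr_ge0 (f x); have h4 := sqr_ge0 (g x).
by rewrite ler_norml; apply/andP; split; nra.
Qed.

Lemma sqint_triangle A f g h (p q : R) : measurable A ->
  measurable_fun A f -> measurable_fun A g -> measurable_fun A h ->
  (forall x, A x -> `|h x| <= `|f x| + `|g x|) ->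
  (sqint A f <= p%:E)%E -> (sqint A g <= q%:E)%E ->
  (sqint A h <= (2 * p + 2 * q)%:E)%E.
Proof.
move=> mA mf mg mh hfg fp gq.
apply: (@le_trans _ _ (\int[mu]_(x in A) (2%:E * (f x ^+ 2)%:E + 2%:E * (g x ^+ 2)%:E))%E).
  apply: ge0_le_integral => //.
  - by move=> x _; rewrite lee_fin sqr_ge0.
  - exact: measurable_sqr.
  - by apply: emeasurable_funD; apply: measurable_funeM; exact: measurable_sqr.
  move=> x /hfg hx; rewrite -!EFinM -EFinD lee_fin.
  apply: (@le_trans _ _ ((`|f x| + `|g x|) ^+ 2)).
    by rewrite -(real_normK (num_real (h x))) lerXn2r// nnegrE// addr_ge0.
  rewrite -[f x ^+ 2]real_normK ?num_real// -[g x ^+ 2]real_normK ?num_real//.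
  move: `|f x| `|g x| => a b.
  by rewrite -subr_ge0 (_ : _ - _ = (a - b) ^+ 2) ?sqr_ge0//; ring.
have pos (k : plane R -> R) x : A x -> (0 <= (k x ^+ 2)%:E)%E.
  by move=> _; rewrite lee_fin sqr_ge0.
have pos2 (k : plane R -> R) x : A x -> (0 <= 2%:E * (k x ^+ 2)%:E)%E.
  by move=> Ax; apply: mule_ge0 => //; exact: pos Ax.
rewrite ge0_integralD//; [|exact: pos2| |exact: pos2|].
- rewrite ge0_integralZl//; [|exact: measurable_sqr|exact: pos].
  rewrite ge0_integralZl//; [|exact: measurable_sqr|exact: pos].
  rewrite [leRHS](_ : _ = 2%:E * p%:E + 2%:E * q%:E)%E; last by rewrite -!EFinM -EFinD.
  by apply: leeD; apply: lee_wpmul2l.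
- by apply: measurable_funeM; exact: measurable_sqr.
- by apply: measurable_funeM; exact: measurable_sqr.
Qed.

End L2.

(** * Energy decay by hole filling *)

Section Testing.
Variable R : realType.

(** The pointwise estimate behind the test function eta (w - c): here S is the
    stress, D the weak gradient of u, W the gradient of a smooth approximation w,
    v stands for w - c, p for the gradient of eta and chi for the indicator of
    the annulus that carries p. *)
Lemma testing_bound (S D W : 'M[R]_2) (v p : 'I_2 -> R) (eta d L chi : R) :
  0 <= eta <= 1 -> 0 < d -> frobenius D D <= frobenius S D ->
  (chi = 0 /\ forall j, p j = 0) \/ (chi = 1 /\ forall j, `|p j| <= L) ->
  eta * frobenius D D -
    frobenius S (\matrix_(i, j) (v i * p j + eta * W i j)) <=
  d * frobenius S S + (4 * d)^-1 * frobenius (W - D) (W - D) +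
    chi * (2^-1 * frobenius S S + L ^+ 2 * (v 0 ^+ 2 + v 1 ^+ 2)).
Proof.
move=> /andP[e0 e1] d0 DS chip.
pose vp : 'M[R]_2 := \matrix_(i, j) (v i * p j).
have -> : frobenius S (\matrix_(i, j) (v i * p j + eta * W i j)) =
    frobenius S vp + eta * frobenius S D + eta * frobenius S (W - D).
  by rewrite !frobenius2E !mxE; ring.
have h1 : - frobenius S (W - D) <= d * frobenius S S + (4 * d)^-1 * frobenius (W - D) (W - D).
  have := frobenius_young S (D - W) d0.
  have -> : frobenius (D - W) (D - W) = frobenius (W - D) (W - D).
    by rewrite !frobenius2E !mxE; ring.
  by have -> : frobenius S (D - W) = - frobenius S (W - D)
    by rewrite !frobenius2E !mxE; ring.
have h2 : - frobenius S vp <= chi * (2^-1 * frobenius S S + L ^+ 2 * (v 0 ^+ 2 + v 1 ^+ 2)).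
  case: chip => -[-> hp].
    by rewrite mul0r frobenius2E /vp !mxE !hp; lra.
  have half : 0 < 2^-1 :> R by rewrite invr_gt0.
  have := frobenius_young S (- vp) half.
  have -> : frobenius S (- vp) = - frobenius S vp by rewrite !frobenius2E !mxE; ring.
  have -> : (4 * 2^-1)^-1 = 2^-1 :> R by field.
  have -> : frobenius (- vp) (- vp) = (v 0 ^+ 2 + v 1 ^+ 2) * (p 0 ^+ 2 + p 1 ^+ 2).
    by rewrite !frobenius2E !mxE; ring.
  have pL j : p j ^+ 2 <= L ^+ 2.
    by rewrite -(real_normK (num_real _)) lerXn2r// ?nnegrE// (le_trans _ (hp j)).
  have vv : 0 <= v 0 ^+ 2 + v 1 ^+ 2 by rewrite addr_ge0// sqr_ge0.
  have := ler_wpM2l vv (lerD (pL 0) (pL 1)).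
  lra.
have h3 : eta * - frobenius S (W - D) <=
    d * frobenius S S + (4 * d)^-1 * frobenius (W - D) (W - D).
  apply: (le_trans (ler_wpM2l e0 h1)); rewrite ler_piMl//.
  by rewrite addr_ge0// mulr_ge0 ?frobenius_ge0// ?invr_ge0 ?mulr_ge0// ltW.
have h4 := ler_wpM2l e0 DS.
lra.
Qed.

End Testing.

Lemma crect_ball (R : realType) (z : plane R) (r s : R) : r < s ->
  crect (z.1 - r, z.2 - r) (z.1 + r, z.2 + r) `<=` ball z s.
Proof.
move=> rs x; rewrite /crect /= !in_itv/= => -[/andP[h1 h2] /andP[h3 h4]].
split; rewrite /ball/= ltr_distlC; apply/andP; split; lra.
Qed.

Section HoleFilling.
Variable R : realType.
Local Notation mu := (leb2 R).
Variables (Omega : set (plane R)) (sigma k : R -> R) (M gamma : R).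
Variable D : plane R -> 'M[R]_2.
Hypothesis oO : open Omega.
Hypothesis step : smooth_step sigma.
Hypothesis sigma_le : forall t, `|derive1 sigma t| <= M.
Hypothesis k_itv : forall s, 0 <= k s <= gamma.
Hypothesis k_sign : forall s, 0 <= k s * s.
Hypothesis k_cont : continuous k.
Hypothesis LD : forall i j, L2on Omega (entry D i j).

Let S x := stress (k (\det (D x))) (D x).

Hypothesis stationary : forall phi : plane R -> 'cV[R]_2,
  (forall i, test_function Omega (component phi i)) ->
  \int[mu]_(x in Omega) frobenius (S x) (gradient phi x) = 0.

Let mO : measurable Omega := open_measurable_plane oO.

Definition energy (A : set (plane R)) : R :=
  \int[mu]_(x in A) frobenius (D x) (D x).

Lemma L2_frobenius_integrable (F G : plane R -> 'M[R]_2) (A : set (plane R)) :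
  measurable A ->
  (forall i j, L2on A (entry F i j)) -> (forall i j, L2on A (entry G i j)) ->
  mu.-integrable A (EFin \o (fun x => frobenius (F x) (G x))).
Proof.
move=> mA LF LG.
have h i j := L2onM mA (LF i j) (LG i j).
have := integrable_add mA (integrable_add mA (integrable_add mA (h 0 0) (h 0 1)) (h 1 0)) (h 1 1).
by congr (_.-integrable _ _); apply/funext => x /=; rewrite frobenius2E.
Qed.

Lemma integrable_energy A : measurable A -> A `<=` Omega ->
  mu.-integrable A (EFin \o (fun x => frobenius (D x) (D x))).
Proof.
move=> mA AO; apply: L2_frobenius_integrable => // i j; exact: L2on_subset (LD i j).
Qed.

Lemma energy_ge0 A : 0 <= energy A.
Proof. by apply: Rintegral_ge0 => x _; exact: frobenius_ge0. Qed.

Let measurable_entry i j : measurable_fun Omega (entry D i j).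
Proof. by have [] := LD i j. Qed.

Lemma L2on_stress i j : L2on Omega (entry S i j).
Proof.
have mdet : measurable_fun Omega (fun x => \det (D x)).
  rewrite (_ : (fun x => \det (D x)) = fun x => entry D 0 0 x * entry D 1 1 x
     - entry D 0 1 x * entry D 1 0 x); last by apply/funext => x; rewrite det2E.
  by apply: measurable_funB; apply: measurable_funM; exact: measurable_entry.
have mk : measurable_fun Omega (fun x => k (\det (D x))).
  by apply: measurableT_comp mdet; exact: continuous_measurable_fun.
have mS : measurable_fun Omega (entry S i j).
  have e00 : entry S 0 0 = fun x => entry D 0 0 x + k (\det (D x)) * entry D 1 1 x.
    by apply/funext => x; rewrite /entry /S; have [] := stressE (k (\det (D x))) (D x).
  have e01 : entry S 0 1 = fun x => entry D 0 1 x - k (\det (D x)) * entry D 1 0 x.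
    by apply/funext => x; rewrite /entry /S; have [] := stressE (k (\det (D x))) (D x).
  have e10 : entry S 1 0 = fun x => entry D 1 0 x - k (\det (D x)) * entry D 0 1 x.
    by apply/funext => x; rewrite /entry /S; have [] := stressE (k (\det (D x))) (D x).
  have e11 : entry S 1 1 = fun x => entry D 1 1 x + k (\det (D x)) * entry D 0 0 x.
    by apply/funext => x; rewrite /entry /S; have [] := stressE (k (\det (D x))) (D x).
  by case: (ord2 i) => ->; case: (ord2 j) => ->; rewrite ?e00 ?e01 ?e10 ?e11;
    (apply: measurable_funB || apply: measurable_funD); try exact: measurable_entry;
    apply: measurable_funM => //; exact: measurable_entry.
apply: (L2on_dom mO mS (integrable_scale (2 + 2 * gamma ^+ 2) mO (integrable_energy mO (@subset_refl _ _)))).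
move=> x _; apply: le_trans (stress_bounded _ (k_itv _)).
exact: sqr_entry_le.
Qed.

Section OneSquare.
Variables (z : plane R) (r : R) (w : 'I_2 -> plane R -> R) (c : 'I_2 -> R).
Hypothesis r0 : 0 < r.
Hypothesis zO : ball z (4 * r) `<=` Omega.
Hypothesis sw : forall i, smooth2 (w i).

Let W (x : plane R) : 'M[R]_2 := \matrix_(i, j) partial j (w i) x.
Let A := ball z (2 * r) `\` ball z r.
Let a : plane R := (z.1 - 2 * r, z.2 - 2 * r).
Let b : plane R := (z.1 + 2 * r, z.2 + 2 * r).
Let eta := bump sigma r a b.

Hypothesis LW : forall i j, L2on Omega (fun x => W x i j - D x i j).
Hypothesis Lw : forall i, L2on A (fun x => w i x - c i).

Let phi (x : plane R) : 'cV[R]_2 := \col_i (eta x * (w i x - c i)).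

Let r20 : 2 * r < 4 * r.
Proof. by have := r0; lra. Qed.

Let abO : crect a b `<=` Omega.
Proof. exact: subset_trans (crect_ball r20) zO. Qed.

Let smooth_wc i : smooth2 (fun x => w i x - c i).
Proof. by apply: smooth2D (sw i) _; exact: smooth2_cst. Qed.

Let comp_phi i : component phi i = fun x => eta x * (w i x - c i).
Proof. by apply/funext => x; rewrite /component mxE. Qed.

Let test_phi i : test_function Omega (component phi i).
Proof. by rewrite comp_phi; apply: test_function_bumpM => //; exact: smooth_wc. Qed.

Let grad_phi x : gradient phi x =
  \matrix_(i, j) ((w i x - c i) * partial j eta x + eta x * W x i j).
Proof.
apply/matrixP => i j; rewrite !mxE comp_phi partialM.
- rewrite addrC; congr (_ + eta x * _).
  rewrite /partial deriveB//; first by rewrite derive_cst subr0.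
  exact: smooth2_derivable.
- by move=> y; exact/smooth2_derivable/smooth2_bump.
- by move=> y; exact/smooth2_derivable/smooth_wc.
Qed.

Let eta_chi x : (\1_A x = 0 :> R /\ forall j, partial j eta x = 0) \/
  (\1_A x = 1 :> R /\ forall j, `|partial j eta x| <= 2 * M / r).
Proof.
rewrite indicE; have [xA|xA] := boolP (x \in A).
  by right; split => // j; exact: partial_bump_le.
left; split => // j.
have [xb|nxb] := pselect (ball z (2 * r) x); last first.
  by apply: partial_bump_out => //; rewrite -ball_rect.
have xr : ball z r x.
  by apply: contrapT => nr; move/negP: xA; apply; rewrite inE.
apply: partial_bump_plateau => // i.
move: xr; rewrite ball_planeE !ball_itv => -[]; rewrite /= !in_itv /= => /andP[h1 h2] /andP[h3 h4].
have r0' := r0.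
by case: (ord2 i) => ->; rewrite /coord /a /b /=; apply/andP; split; lra.
Qed.

Let eta1 x : ball z r x -> eta x = 1.
Proof.
rewrite ball_planeE !ball_itv => -[]; rewrite /= !in_itv /= => /andP[h1 h2] /andP[h3 h4].
apply: bump_eq1 => // i.
have r0' := r0.
by case: (ord2 i) => ->; rewrite /coord /a /b /=; apply/andP; split; lra.
Qed.

Let mA : measurable A.
Proof. by apply: measurableD; exact: measurable_ball_plane. Qed.

Let AO : A `<=` Omega.
Proof. by move=> x [xb _]; apply: zO; apply: le_ball xb; have := r0; lra. Qed.

Let LgradW i j : L2on Omega (fun x => W x i j).
Proof.
apply: (L2on_le mO _ (LW i j) (LD i j)).
  apply: measurable_funTS; apply: continuous_measurable_plane.
  rewrite (_ : (fun x => W x i j) = partial j (w i)); last by apply/funext => x; rewrite mxE.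
  exact/smooth2_continuous/smooth2_partial.
move=> x _; rewrite /entry; set p := W x i j; set q := D x i j.
rewrite -subr_ge0 (_ : _ - _ = (p - 2 * q) ^+ 2) ?sqr_ge0//; ring.
Qed.

Let eta_itv x : 0 <= eta x <= 1.
Proof. exact: bump_itv. Qed.

Let meta : measurable_fun Omega eta.
Proof.
by apply: measurable_funTS; apply: continuous_measurable_plane; exact/smooth2_continuous/smooth2_bump.
Qed.

Let Lgrad_phi i j : L2on Omega (entry (gradient phi) i j).
Proof.
have i1 := integrable_scale (2 * (2 * M / r) ^+ 2) mO
  (integrable_indic mA mO AO (L2on_integrable mA (Lw i))).
have i2 := integrable_scale 2 mO (L2on_integrable mO (LgradW i j)).
have e : entry (gradient phi) i j = fun x => (w i x - c i) * partial j eta x + eta x * W x i j.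
  by apply/funext => x; rewrite /entry grad_phi mxE.
apply: (L2on_dom mO _ (integrable_add mO i1 i2)).
  rewrite e; apply: measurable_funD; apply: measurable_funM => //.
  - by apply: measurable_funTS; apply: continuous_measurable_plane; exact/smooth2_continuous/smooth_wc.
  - apply: measurable_funTS; apply: continuous_measurable_plane.
    exact/smooth2_continuous/smooth2_partial/smooth2_bump.
  - by have [] := LgradW i j.
move=> x _; rewrite e.
set v := w i x - c i; set p := partial j eta x; set q := W x i j; set h := eta x.
apply: (@le_trans _ _ (2 * (v * p) ^+ 2 + 2 * (h * q) ^+ 2)).
  by rewrite -subr_ge0 (_ : _ - _ = (v * p - h * q) ^+ 2) ?sqr_ge0//; ring.
have hq : (h * q) ^+ 2 <= q ^+ 2.
  have /andP[h0 h1] := eta_itv x.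
  by rewrite exprMn ler_piMl ?sqr_ge0// exprn_ile1.
have pv : (v * p) ^+ 2 <= \1_A x * ((2 * M / r) ^+ 2 * v ^+ 2).
  case: (eta_chi x) => -[-> hp]; first by rewrite /p hp mulr0 expr0n /= mul0r.
  rewrite mul1r exprMn mulrC ler_wpM2r ?sqr_ge0//.
  by rewrite -(real_normK (num_real p)) lerXn2r// ?nnegrE// (le_trans _ (hp j)).
lra.
Qed.

(** Caccioppoli's inequality with the smooth function w in place of the
    solution.  The price is the distance of W from D, which comes with the large
    factor 1/(4d), and a small multiple of the total energy; in the limit W -> D
    and then d -> 0 only the terms on the annulus remain. *)
Lemma caccioppoli_approx (d : R) : 0 < d ->
  energy (ball z r) <=
   d * (2 + 2 * gamma ^+ 2) * energy Omega
   + (4 * d)^-1 * \int[mu]_(x in Omega) frobenius (W x - D x) (W x - D x)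
   + (1 + gamma ^+ 2) * energy A
   + (2 * M / r) ^+ 2 *
       \int[mu]_(x in A) ((w 0 x - c 0) ^+ 2 + (w 1 x - c 1) ^+ 2).
Proof.
move=> d0.
set C := 2 + 2 * gamma ^+ 2; set L := 2 * M / r.
have mB : measurable (ball z r : set (plane R)) by exact: measurable_ball_plane.
have BO : ball z r `<=` Omega by move=> x xb; apply: zO; apply: le_ball xb; have := r0; lra.
have iD := integrable_energy mO (@subset_refl _ Omega).
have iDB := integrable_energy mB BO.
have iDA := integrable_energy mA AO.
have iSp := L2_frobenius_integrable mO L2on_stress Lgrad_phi.
have LWD i j : L2on Omega (entry (fun x => W x - D x) i j).
  rewrite (_ : entry _ i j = fun x => W x i j - D x i j)//.
  by apply/funext => x; rewrite /entry !mxE.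
have iW := L2_frobenius_integrable mO LWD LWD.
have iV := integrable_add mA (L2on_integrable mA (Lw 0)) (L2on_integrable mA (Lw 1)).
have ieD : mu.-integrable Omega (EFin \o (fun x => eta x * frobenius (D x) (D x))).
  apply: (@le_integrable _ _ _ mu Omega mO _ _ _ _ iD).
    by apply/measurable_EFinP; apply: measurable_funM => //; apply/measurable_EFinP; case/integrableP: iD.
  move=> x _ /=; rewrite lee_fin normrM ler_piMl//.
  by have /andP[h0 h1] := eta_itv x; rewrite ger0_norm.
have step1 : energy (ball z r) <= \int[mu]_(x in Omega) (eta x * frobenius (D x) (D x)).
  rewrite /energy -(Rintegral_indic _ BO); apply: le_Rintegral => //.
    exact: integrable_indic.
  move=> x _; rewrite indicE; have [xB|xB] := boolP (x \in (ball z r : set (plane R))).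
    by rewrite eta1//; rewrite inE in xB.
  rewrite mul0r mulr_ge0// ?frobenius_ge0//; by have /andP[] := eta_itv x.
(* The subtracted term integrates to zero by stationarity; now the integrand can
   be estimated pointwise. *)
have step2 : \int[mu]_(x in Omega) (eta x * frobenius (D x) (D x)) =
   \int[mu]_(x in Omega) (eta x * frobenius (D x) (D x) - frobenius (S x) (gradient phi x)).
  by rewrite RintegralB// stationary// subr0.
have iVA := integrable_indic mA mO AO (integrable_add mA
   (integrable_scale (2^-1 * C) mA iDA) (integrable_scale (L ^+ 2) mA iV)).
have i1 := integrable_scale (d * C) mO iD.
have i2 := integrable_scale (4 * d)^-1 mO iW.
have i12 := integrable_add mO i1 i2.
apply: (le_trans step1); rewrite step2.
apply: (@le_trans _ _ (\int[mu]_(x in Omega) (d * C * frobenius (D x) (D x)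
   + (4 * d)^-1 * frobenius (W x - D x) (W x - D x)
   + \1_A x * (2^-1 * C * frobenius (D x) (D x) +
       L ^+ 2 * ((w 0 x - c 0) ^+ 2 + (w 1 x - c 1) ^+ 2))))).
  apply: le_Rintegral => //; [exact: integrable_sub|exact: integrable_add mO i12 iVA|].
  move=> x _; rewrite grad_phi.
  have coer : frobenius (D x) (D x) <= frobenius (S x) (D x) by exact: stress_coercive.
  have bnd : frobenius (S x) (S x) <= C * frobenius (D x) (D x) by exact: stress_bounded.
  have := testing_bound (W x) (fun i => w i x - c i) (eta_itv x) d0 coer (eta_chi x).
  move=> /le_trans; apply.
  apply: lerD.
    by rewrite lerD2r -mulrA ler_pM2l.
  apply: ler_wpM2l; first by rewrite indicE.
  by rewrite lerD2r -mulrA ler_pM2l// invr_gt0.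
rewrite RintegralD// RintegralD// RintegralZl// RintegralZl//.
rewrite Rintegral_indic// RintegralD//; last 2 first.
- exact: integrable_scale.
- exact: integrable_scale.
rewrite RintegralZl// RintegralZl// -/(energy _) -/(energy _) !addrA.
rewrite lerD2r lerD2l le_eqVlt; apply/orP; left; apply/eqP; congr (_ * _).
by rewrite /C; field.
Qed.

End OneSquare.

Lemma integralE (A : set (plane R)) (f : plane R -> R) : measurable A ->
  mu.-integrable A (EFin \o f) ->
  (\int[mu]_(x in A) (f x)%:E)%E = (\int[mu]_(x in A) f x)%:E.
Proof.
by move=> mA fi; rewrite /Rintegral fineK//; exact: (@integrable_fin_num _ _ _ mu A mA _ fi).
Qed.

Lemma Rintegral_sqr_le (A : set (plane R)) (f : plane R -> R) (p : R) :
  measurable A -> measurable_fun A f -> (sqint A f <= p%:E)%E ->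
  L2on A f /\ \int[mu]_(x in A) (f x ^+ 2) <= p.
Proof.
move=> mA mf fp; have Lf : L2on A f by split => //; apply: le_lt_trans fp _; rewrite ltry.
by split => //; rewrite -lee_fin -integralE//; exact: L2on_integrable.
Qed.

Variable U : 'I_2 -> plane R -> R.
Hypothesis mU : forall i, measurable_fun Omega (U i).
(* U is the solution and D its weak gradient; all that the estimates use is
   that smooth functions approximate both in L^2. *)
Hypothesis approx : forall e : R, 0 < e -> exists w : 'I_2 -> plane R -> R,
  [/\ forall i, smooth2 (w i),
      forall i, (sqint Omega (fun x => w i x - U i x)%R <= e%:E)%E &
      forall i j, (sqint Omega (fun x => partial j (w i) x - D x i j)%R <= e%:E)%E].

Let measurable_partial (A : set (plane R)) (w : 'I_2 -> plane R -> R) i j : smooth2 (w i) ->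
  measurable_fun A (partial j (w i) : plane R -> R).
Proof.
move=> sw; apply: measurable_funTS; apply: continuous_measurable_plane.
exact/smooth2_continuous/smooth2_partial.
Qed.

Let sqint_partial_le (A : set (plane R)) (w : 'I_2 -> plane R -> R) i j (e : R) :
  measurable A -> A `<=` Omega -> smooth2 (w i) ->
  (sqint Omega (fun x => partial j (w i) x - D x i j)%R <= e%:E)%E ->
  (sqint A (partial j (w i)) <= (2 * e + 2 * energy A)%:E)%E.
Proof.
move=> mA AO sw we.
have md : measurable_fun Omega (fun x => partial j (w i) x - D x i j).
  by apply: measurable_funB; [exact: measurable_partial|exact: measurable_entry].
have weA : (sqint A (fun x => partial j (w i) x - D x i j)%R <= e%:E)%E.
  by apply: le_trans we; exact: subset_sqint.
have mD : measurable_fun A (entry D i j) by exact: measurable_funS (measurable_entry i j).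
have DA : (sqint A (entry D i j) <= (energy A)%:E)%E.
  rewrite -integralE//; last exact: integrable_energy.
  apply: ge0_le_integral => //.
  - by move=> x _; rewrite lee_fin sqr_ge0.
  - exact: measurable_sqr.
  - by case/integrableP: (integrable_energy mA AO).
  - by move=> x _; rewrite lee_fin sqr_entry_le.
apply: (sqint_triangle mA (measurable_funS mO AO md) mD _ _ weA DA) => [|x _].
  exact: measurable_partial.
by rewrite -{1}(subrK (D x i j) (partial j (w i) x)) ler_normD.
Qed.

(** Choose the constants c by the Poincare inequality on the annulus and let the
    approximation parameters tend to zero. *)
Lemma hole_filling (z : plane R) (r : R) : 0 < r -> ball z (4 * r) `<=` Omega ->
  energy (ball z r) <= (1 + gamma ^+ 2 + 16 * 128 * M ^+ 2) *
    energy (ball z (2 * r) `\` ball z r).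
Proof.
move=> r0 zO; set A := ball z (2 * r) `\` ball z r.
set K := 1 + gamma ^+ 2 + 16 * 128 * M ^+ 2.
have mA : measurable A by apply: measurableD; exact: measurable_ball_plane.
have AO : A `<=` Omega by move=> x [xb _]; apply: zO; apply: le_ball xb; lra.
apply/ler_addgt0Pr => eps eps0.
set C := 2 + 2 * gamma ^+ 2.
have C0 : 0 <= C by rewrite addr_ge0// mulr_ge0// sqr_ge0.
have EO := energy_ge0 Omega.
have CE1 : 0 < C * energy Omega + 1 by have := mulr_ge0 C0 EO; lra.
(* Half of eps pays for the multiple d C of the total energy; with d fixed, e is
   chosen so that all errors of the approximation fit into the other half. *)
pose d := eps / 2 / (C * energy Omega + 1).
have d0 : 0 < d by rewrite !divr_gt0.
have M2 := sqr_ge0 M.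
have q0 : 0 < d^-1 + 24 * 128 * M ^+ 2.
  by have : 0 < d^-1; [rewrite invr_gt0|lra].
pose e := eps / 2 / (d^-1 + 24 * 128 * M ^+ 2).
have e0 : 0 < e by rewrite !divr_gt0.
have [w [sw wU wD]] := approx e0.
have p1 i j : (sqint A (partial j (w i)) <= (2 * e + 2 * energy A)%:E)%E.
  exact: sqint_partial_le.
have Pc i : exists c, (sqint A (fun x => w i x - c)%R <=
    (128 * r ^+ 2 * (2 * e + 2 * energy A + e))%:E)%E.
  exact: poincare_annulus (smooth2_C1 (sw i)) r0 e0 (p1 i 0) (p1 i 1).
have [c hc] := choice Pc.
have mw i : measurable_fun A (fun x => w i x - c i).
  apply: measurable_funTS; apply: continuous_measurable_plane.
  apply: smooth2_continuous; exact: smooth2D (sw i) (smooth2_cst _).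
have Lw i := Rintegral_sqr_le mA (mw i) (hc i).
have md i j : measurable_fun Omega (fun x => partial j (w i) x - D x i j).
  by apply: measurable_funB; [exact: measurable_partial|exact: measurable_entry].
have LW i j := Rintegral_sqr_le mO (md i j) (wD i j).
pose W (x : plane R) : 'M[R]_2 := \matrix_(i, j) partial j (w i) x.
have LW' i j : L2on Omega (fun x => W x i j - D x i j).
  have [h _] := LW i j; rewrite (_ : (fun x => _) = fun x => partial j (w i) x - D x i j)//.
  by apply/funext => x; rewrite mxE.
have := @caccioppoli_approx z r w c r0 zO sw LW' (fun i => (Lw i).1) d d0.
move=> /le_trans; apply.
have T : \int[mu]_(x in Omega) frobenius (W x - D x) (W x - D x) <= 4 * e.
  rewrite (_ : (fun x => _) = fun x => (partial 0 (w 0) x - D x 0 0) ^+ 2 +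
     (partial 1 (w 0) x - D x 0 1) ^+ 2 + (partial 0 (w 1) x - D x 1 0) ^+ 2 +
     (partial 1 (w 1) x - D x 1 1) ^+ 2); last first.
    by apply/funext => x; rewrite frobenius2E !mxE !expr2.
  have i1 i j := L2on_integrable mO (LW i j).1.
  have i2 := integrable_add mO (i1 0 0) (i1 0 1).
  have i3 := integrable_add mO i2 (i1 1 0).
  rewrite RintegralD// RintegralD// RintegralD//.
  have := (LW 0 0).2; have := (LW 0 1).2; have := (LW 1 0).2; have := (LW 1 1).2.
  lra.
have V : \int[mu]_(x in A) ((w 0 x - c 0) ^+ 2 + (w 1 x - c 1) ^+ 2) <=
    2 * (128 * r ^+ 2 * (2 * e + 2 * energy A + e)).
  rewrite RintegralD//; [|exact: L2on_integrable (Lw _).1..].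
  by have := (Lw 0).2; have := (Lw 1).2; lra.
have h1 : d * C * energy Omega <= eps / 2.
  have -> : eps / 2 = d * (C * energy Omega + 1) by rewrite /d divfK// gt_eqF.
  by rewrite -mulrA ler_pM2l// lerDl.
have h2 : e * (d^-1 + 24 * 128 * M ^+ 2) = eps / 2 by rewrite /e divfK// gt_eqF.
have h3 : (4 * d)^-1 * \int[mu]_(x in Omega) frobenius (W x - D x) (W x - D x) <= e * d^-1.
  apply: (@le_trans _ _ ((4 * d)^-1 * (4 * e))).
    by rewrite ler_pM2l// invr_gt0 mulr_gt0.
  by rewrite le_eqVlt; apply/orP; left; apply/eqP; field; rewrite gt_eqF.
(* The factor r^2 of the Poincare inequality cancels the r^-2 of the cutoff. *)
have h4 : (2 * M / r) ^+ 2 *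
   \int[mu]_(x in A) ((w 0 x - c 0) ^+ 2 + (w 1 x - c 1) ^+ 2) <=
    16 * 128 * M ^+ 2 * energy A + 24 * 128 * M ^+ 2 * e.
  apply: (@le_trans _ _ ((2 * M / r) ^+ 2 * (2 * (128 * r ^+ 2 * (2 * e + 2 * energy A + e))))).
    by rewrite ler_wpM2l// sqr_ge0.
  by rewrite le_eqVlt; apply/orP; left; apply/eqP; field; rewrite gt_eqF.
have h2' : e * d^-1 + 24 * 128 * M ^+ 2 * e = eps / 2 by rewrite -h2; ring.
rewrite -/A -/W -/C; move: h1 h2' h3 h4; rewrite /K.
move: (\int[mu]_(x in Omega) _) => I1; move: (\int[mu]_(x in A) _) => I2.
move: ((4 * d)^-1 * I1) ((2 * M / r) ^+ 2 * I2) (e * d^-1) (d * C * _) => J1 J2 J3 J4.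
move: (M ^+ 2) (gamma ^+ 2) => M'' g2 h1 h2' h3 h4.
have -> : (1 + g2 + 16 * 128 * M'') * energy A =
  (1 + g2) * energy A + 16 * 128 * M'' * energy A by ring.
move: ((1 + g2) * energy A) (16 * 128 * M'' * energy A) (24 * 128 * M'' * e) h2' h4 => t1 t2 t3.
lra.
Qed.

Let K := 1 + gamma ^+ 2 + 16 * 128 * M ^+ 2.

Let K_gt0 : 0 < K.
Proof. by rewrite /K; have := sqr_ge0 gamma; have := sqr_ge0 M; lra. Qed.

Definition decay_rate : R := K / (K + 1).

Lemma decay_rate_gt0 : 0 < decay_rate.
Proof. by rewrite divr_gt0//; have := K_gt0; lra. Qed.

(** The lower bound keeps the Hoelder exponent below 1. *)
Lemma decay_rate_gt : 4^-1 < decay_rate.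
Proof.
have := sqr_ge0 gamma; have := sqr_ge0 M; have K0 := K_gt0 => h1 h2.
by rewrite /decay_rate ltr_pdivlMr /K; lra.
Qed.

Lemma decay_rate_lt1 : decay_rate < 1.
Proof. by rewrite ltr_pdivrMr ?mul1r; have := K_gt0; lra. Qed.

(** Hole filling: from E(r) <= K (E(2r) - E(r)) one gets
    E(r) <= K / (K + 1) E(2r). *)
Lemma energy_decay_step (z : plane R) (r : R) : 0 < r -> ball z (4 * r) `<=` Omega ->
  energy (ball z r) <= decay_rate * energy (ball z (2 * r)).
Proof.
move=> r0 zO; have h := hole_filling r0 zO.
set A := ball z (2 * r) `\` ball z r in h *.
have mA : measurable A by apply: measurableD; exact: measurable_ball_plane.
have mB : measurable (ball z r : set (plane R)) by exact: measurable_ball_plane.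
have e : ball z (2 * r) = ball z r `|` A.
  by rewrite setDUK//; apply: le_ball; lra.
have BO : ball z r `|` A `<=` Omega.
  by rewrite -e; apply: subset_trans zO; apply: le_ball; lra.
have mBA : measurable (ball z r `|` A) by exact: measurableU.
have -> : energy (ball z (2 * r)) = energy (ball z r) + energy A.
  rewrite e /energy Rintegral_setU//.
    exact: integrable_energy.
  by apply/disj_set2P; rewrite /A setDE setICA setICr setI0.
have K0 := K_gt0; rewrite -/K in h.
by rewrite /decay_rate -mulrA mulrCA ler_pdivlMl; nra.
Qed.

Lemma energy_subset (A B : set (plane R)) : measurable A -> measurable B ->
  A `<=` B -> B `<=` Omega -> energy A <= energy B.
Proof.
move=> mA mB AB BO; rewrite -lee_fin -!integralE//.
- apply: ge0_subset_integral => //.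
    by case/integrableP: (integrable_energy mB BO).
  by move=> x _; rewrite lee_fin frobenius_ge0.
- exact: integrable_energy.
- by apply: integrable_energy => //; exact: subset_trans BO.
Qed.

Lemma energy_decay (z : plane R) k0 l : ball z (4 * dyadic R k0) `<=` Omega ->
  energy (ball z (dyadic R (k0 + l))) <= decay_rate ^+ l * energy Omega.
Proof.
move=> zO; elim: l => [|l IH].
  rewrite addn0 expr0 mul1r; apply: energy_subset => //.
    exact: measurable_ball_plane.
  by apply: subset_trans zO; apply: le_ball; have := dyadic_gt0 R k0; lra.
have d0 := dyadic_gt0 R (k0 + l.+1).
have e : 2 * dyadic R (k0 + l.+1) = dyadic R (k0 + l) by rewrite addnS -dyadicS.
apply: (le_trans (energy_decay_step d0 _)).
  apply: subset_trans zO; apply: le_ball.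
  have := dyadic_le R (leq_addr l k0); lra.
rewrite e exprS -mulrA ler_wpM2l// ltW//; exact: decay_rate_gt0.
Qed.

(** The Poincare inequality passes to the limit along smooth approximations,
    at the cost of a factor 4 from two triangle inequalities. *)
Lemma poincare_U i (z : plane R) (r eps : R) : 0 < r -> 0 < eps ->
  ball z r `<=` Omega -> exists c,
  (sqint (ball z r) (fun x => U i x - c)%R <=
    (64 * r ^+ 2 * (energy (ball z r) + eps))%:E)%E.
Proof.
move=> r0 eps0 zO; set B := ball z r.
have mB : measurable (B : set (plane R)) by exact: measurable_ball_plane.
have r2 : 0 < r ^+ 2 by rewrite exprn_gt0.
pose e := 64 * r ^+ 2 * eps / (2 + 96 * r ^+ 2).
have q0 : 0 < 2 + 96 * r ^+ 2 by lra.
have e0 : 0 < e by rewrite !divr_gt0// !mulr_gt0.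
have [w [sw wU wD]] := approx e0.
have p1 j : (sqint B (partial j (w i)) <= (2 * e + 2 * energy B)%:E)%E.
  exact: sqint_partial_le.
have [c hc] := poincare_ball (smooth2_C1 (sw i)) r0 e0 (p1 0) (p1 1).
exists c.
have cw : continuous (w i) := smooth2_continuous (sw i).
have mwU : measurable_fun Omega (fun x => w i x - U i x).
  apply: measurable_funB => //.
  by apply: measurable_funTS; exact: continuous_measurable_plane.
have mwc : measurable_fun B (fun x => w i x - c).
  apply: measurable_funTS; apply: continuous_measurable_plane.
  apply: smooth2_continuous; exact: smooth2D (sw i) (smooth2_cst _).
have wUB : (sqint B (fun x => w i x - U i x)%R <= e%:E)%E.
  by apply: le_trans (wU i); exact: subset_sqint.
have mUc : measurable_fun B (fun x => U i x - c).
  by apply: measurable_funB => //; exact: measurable_funS (mU i).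
have tri x : B x -> `|U i x - c| <= `|w i x - U i x| + `|w i x - c|.
  by move=> _; rewrite [`|w i x - U i x|]distrC; exact: ler_distD.
have := sqint_triangle mB (measurable_funS mO zO mwU) mwc mUc tri wUB hc.
move=> /le_trans; apply; rewrite lee_fin.
have he : e * (2 + 96 * r ^+ 2) = 64 * r ^+ 2 * eps by rewrite /e divfK// gt_eqF.
rewrite (_ : 64 * r ^+ 2 * (_ + eps) = 64 * r ^+ 2 * energy B + e * (2 + 96 * r ^+ 2)); last first.
  by rewrite he; ring.
by rewrite le_eqVlt; apply/orP; left; apply/eqP; ring.
Qed.

(** Poincare's inequality converts decay of the energy into decay of the mean
    square oscillation: the factor r^2 is the measure of the square up to a
    constant. *)
Lemma campanato_bound i (z : plane R) k0 l : ball z (4 * dyadic R k0) `<=` Omega ->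
  exists c, (sqint (ball z (dyadic R (k0 + l))) (fun x => U i x - c)%R <=
    (64 * (energy Omega + 1) * dyadic R (k0 + l) ^+ 2 * decay_rate ^+ l)%:E)%E.
Proof.
move=> zO; have d0 := dyadic_gt0 R (k0 + l).
have t0 : 0 < decay_rate ^+ l by rewrite exprn_gt0// decay_rate_gt0.
have BO : ball z (dyadic R (k0 + l)) `<=` Omega.
  apply: subset_trans zO; apply: le_ball.
  by have := dyadic_le R (leq_addr l k0); lra.
have [c hc] := poincare_U i d0 t0 BO.
exists c; apply: (le_trans hc); rewrite lee_fin.
have := energy_decay l zO; move: (energy (ball z (dyadic R (k0 + l)))) => E hE.
move: (dyadic R (k0 + l)) d0 => r r0.
rewrite (_ : 64 * (energy Omega + 1) * r ^+ 2 * _ =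
  64 * r ^+ 2 * (decay_rate ^+ l * energy Omega + decay_rate ^+ l)); last by ring.
by rewrite ler_pM2l ?lerD2r// mulr_gt0 ?exprn_gt0.
Qed.

End HoleFilling.

(** * Approximating constants and their limits *)

(** With e n the right hand side of the claim, e n - e (n + 1) = N t^n; hence
    u n - e n increases, u n + e n decreases, and the supremum of the former is
    the limit. *)
Lemma geometric_limit (R : realType) (u : nat -> R) (N t : R) :
  0 < t < 1 -> (forall n, `|u n.+1 - u n| <= N * t ^+ n) ->
  exists v, forall n, `|v - u n| <= N / (1 - t) * t ^+ n.
Proof.
move=> /andP[t0 t1] hu; have t1' : 0 < 1 - t by lra.
pose e n := N / (1 - t) * t ^+ n.
have eS n : e n - e n.+1 = N * t ^+ n.
  by rewrite /e exprS; field; rewrite gt_eqF.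
have N0 : 0 <= N by have := hu 0; rewrite expr0 mulr1; apply: le_trans.
have e0 n : 0 <= e n.
  by rewrite /e mulr_ge0 ?divr_ge0 ?exprn_ge0// ltW.
have inc n m : (n <= m)%N -> u n - e n <= u m - e m.
  elim: m => [|m IH]; first by rewrite leqn0 => /eqP ->.
  rewrite leq_eqVlt => /predU1P[->//|/IH /le_trans]; apply.
  by have := hu m; have := eS m; rewrite ler_norml => h /andP[h1 _]; lra.
have dec n m : (n <= m)%N -> u m + e m <= u n + e n.
  elim: m => [|m IH]; first by rewrite leqn0 => /eqP ->.
  rewrite leq_eqVlt => /predU1P[->//|/IH]; apply: le_trans.
  by have := hu m; have := eS m; rewrite ler_norml => h /andP[_ h1]; lra.
have ab n m : u n - e n <= u m + e m.
  have := inc n _ (leq_maxl n m); have := dec m _ (leq_maxr n m).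
  by have := e0 (maxn n m); lra.
pose E := [set u n - e n | n in [set: nat]].
exists (sup E) => n; rewrite ler_distl; apply/andP; split.
  by apply: ub_le_sup; [exists (u 0 + e 0) => _ [m _ <-]|exists n].
by apply: ge_sup; [exists (u 0 - e 0); exists 0|move=> _ [m _ <-]].
Qed.

Section Campanato.
Variable R : realType.
Local Notation mu := (leb2 R).
Local Notation d_ := (dyadic R).
Variables (Omega : set (plane R)) (U : plane R -> R) (theta B : R).
Hypothesis oO : open Omega.
Hypothesis mU : measurable_fun Omega U.
Hypothesis theta_itv : 4^-1 < theta < 1.
Hypothesis decay : forall (z : plane R) k l, ball z (4 * d_ k) `<=` Omega ->
  exists c, (sqint (ball z (d_ (k + l))) (fun x => U x - c)%R <=
     (B * d_ (k + l) ^+ 2 * theta ^+ l)%:E)%E.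

Let mO : measurable Omega := open_measurable_plane oO.

Lemma measure_ball_plane (z : plane R) (r : R) : 0 < r ->
  mu (ball z r) = (4 * r ^+ 2)%:E.
Proof.
move=> r0; rewrite ball_planeE product_measure1E; [|exact: measurable_ball..].
transitivity ((2 * r)%:E * (2 * r)%:E)%E; last by rewrite -EFinM; congr EFin; ring.
by congr (_ * _)%E; exact: measure_ball.
Qed.

(** Both constants approximate U on the smaller square, whose measure is
    4 s^2, so the triangle inequality controls their distance. *)
Lemma constants_close (z z' : plane R) (r s c c' p q : R) : 0 < s ->
  ball z' s `<=` ball z r -> ball z r `<=` Omega ->
  (sqint (ball z r) (fun x => U x - c)%R <= p%:E)%E ->
  (sqint (ball z' s) (fun x => U x - c')%R <= q%:E)%E ->
  2 * s ^+ 2 * (c' - c) ^+ 2 <= p + q.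
Proof.
move=> s0 zz zO hc hc'.
have mb (x : plane R) t : measurable (ball x t : set (plane R)) by exact: measurable_ball_plane.
have zO' := subset_trans zz zO.
have mUc (A : set (plane R)) (a : R) : measurable A -> A `<=` Omega ->
    measurable_fun A (fun x => U x - a).
  by move=> mA AO; apply: measurable_funB => //; exact: measurable_funS mO AO mU.
have h1 : (sqint (ball z' s) (fun x => U x - c)%R <= p%:E)%E.
  by apply: le_trans hc; apply: subset_sqint => //; apply: mUc.
have tri x : ball z' s x -> `|cst (c' - c) x| <= `|U x - c| + `|U x - c'|.
  by move=> _; rewrite /cst distrC [`|U x - c|]distrC; exact: ler_distD.
have := sqint_triangle (mb _ _) (mUc _ _ (mb _ _) zO') (mUc _ _ (mb _ _) zO')
  (measurable_cst _) tri h1 hc'.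
rewrite /sqint /cst.
have -> : (\int[mu]_(x in ball z' s) ((c' - c) ^+ 2)%:E)%E =
    (((c' - c) ^+ 2)%:E * (4 * s ^+ 2)%:E)%E.
  by rewrite -(measure_ball_plane z' s0); apply: integral_cst; exact: mb.
rewrite -EFinM lee_fin => h.
rewrite -(@ler_pM2l _ 2)// (le_trans _ (le_trans h _))//.
  by rewrite le_eqVlt; apply/orP; left; apply/eqP; ring.
by rewrite mulrDr.
Qed.

Let tau := Num.sqrt theta.

Let theta_gt0 : 0 < theta.
Proof. by have /andP[h _] := theta_itv; apply: lt_trans h; rewrite invr_gt0. Qed.

Let tau2 : tau ^+ 2 = theta.
Proof. by rewrite sqr_sqrtr// ltW. Qed.

Let tau_gt0 : 0 < tau.
Proof. by rewrite sqrtr_gt0. Qed.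

Let tau_lt1 : tau < 1.
Proof.
rewrite -(@ltr_pXn2r _ 2) ?nnegrE// ?(ltW tau_gt0)// tau2 expr1n.
by have /andP[] := theta_itv.
Qed.

Let sub_ball (z : plane R) k l : ball z (4 * d_ k) `<=` Omega ->
  ball z (d_ (k + l)) `<=` Omega.
Proof.
move=> zO; apply: subset_trans zO; apply: le_ball.
by have := dyadic_le R (leq_addr l k); have := dyadic_gt0 R k; lra.
Qed.

Definition modulus : R :=
  2 * (B + 4 * (Num.sqrt (3 * B) / (1 - tau)) ^+ 2).

(** The constants for the squares about x form a Cauchy sequence, and its limit v
    serves as the value at x of a continuous representative.  One v works for
    all admissible k: starting from the largest admissible square, whose index
    is the smallest k, the squares for any other k are a tail of the same
    sequence. *)
Lemma exists_value (x : plane R) : exists v, forall k l,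
  ball x (4 * d_ k) `<=` Omega ->
  (sqint (ball x (d_ (k + l))) (fun y => U y - v)%R <=
     (modulus * d_ (k + l) ^+ 2 * theta ^+ l)%:E)%E.
Proof.
have [[k0 hk0]|nk] := pselect (exists k, ball x (4 * d_ k) `<=` Omega); last first.
  by exists 0 => k l xO; exfalso; apply: nk; exists k.
have ex : exists k, `[< ball x (4 * d_ k) `<=` Omega >] by exists k0; exact/asboolP.
(* The smallest k for which the square fits into Omega. *)
case: (ex_minnP ex) => k1 /asboolP xO kmin {k0 hk0 ex}; move: k1 xO kmin => k0 xO kmin.
have [c hc] := choice (fun l => decay l xO).
have B0 : 0 <= B.
  have := hc 0%N; rewrite addn0 expr0 mulr1 => h.
  have := le_trans (sqint_ge0 _ _) h.
  by rewrite lee_fin pmulr_lge0// exprn_gt0// dyadic_gt0.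
have step n : `|c n.+1 - c n| <= Num.sqrt (3 * B) * tau ^+ n.
  have d0 := dyadic_gt0 R (k0 + n.+1).
  have sub : ball x (d_ (k0 + n.+1)) `<=` ball x (d_ (k0 + n)).
    by apply: le_ball; rewrite addnS dyadic_le.
  have := constants_close d0 sub (@sub_ball _ _ _ xO) (hc n) (hc n.+1).
  rewrite (_ : d_ (k0 + n) = 2 * d_ (k0 + n.+1)); last by rewrite addnS -dyadicS.
  rewrite [theta ^+ n.+1]exprS => h.
  have th := exprn_gt0 n theta_gt0.
  have {h} : (c n.+1 - c n) ^+ 2 <= 3 * B * theta ^+ n.
    rewrite -(@ler_pM2l _ (2 * d_ (k0 + n.+1) ^+ 2)) ?mulr_gt0 ?exprn_gt0//.
    apply: (le_trans h).
    have -> : B * (2 * d_ (k0 + n.+1)) ^+ 2 * theta ^+ n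
      + B * d_ (k0 + n.+1) ^+ 2 * (theta * theta ^+ n) =
      (B * d_ (k0 + n.+1) ^+ 2 * theta ^+ n) * (4 + theta) by ring.
    have -> : 2 * d_ (k0 + n.+1) ^+ 2 * (3 * B * theta ^+ n) =
      (B * d_ (k0 + n.+1) ^+ 2 * theta ^+ n) * 6 by ring.
    apply: ler_wpM2l; first by rewrite !mulr_ge0 ?exprn_ge0// ltW.
    by have /andP[_] := theta_itv; lra.
  move=> h; rewrite -sqrtr_sqr; apply: (le_trans (ler_wsqrtr h)).
  rewrite sqrtrM ?mulr_ge0// -tau2 -exprM mulnC exprM sqrtr_sqr.
  by rewrite ger0_norm// exprn_ge0// ltW.
have [v hv] := @geometric_limit R c (Num.sqrt (3 * B)) tau (introT andP (conj tau_gt0 tau_lt1)) step.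
exists v => k l xk.
have kk0 : (k0 <= k)%N by apply: kmin; exact/asboolP.
set n := (k + l - k0)%N.
have kl : (k + l = k0 + n)%N by rewrite subnKC// (leq_trans kk0)// leq_addr.
have ln : (l <= n)%N by rewrite /n leq_subRL ?leq_add2r// (leq_trans kk0)// leq_addr.
have mb : measurable (ball x (d_ (k0 + n)) : set (plane R)) by exact: measurable_ball_plane.
have mUc a : measurable_fun (ball x (d_ (k0 + n))) (fun y => U y - a).
  by apply: measurable_funB => //; exact: measurable_funS mO (@sub_ball _ _ _ xO) mU.
have hcst : (sqint (ball x (d_ (k0 + n))) (cst (c n - v)%R) <=
   ((Num.sqrt (3 * B) / (1 - tau) * tau ^+ n) ^+ 2 * (4 * d_ (k0 + n) ^+ 2))%:E)%E.
  rewrite /sqint /cst.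
  have -> : (\int[mu]_(x in ball x (d_ (k0 + n))) ((c n - v) ^+ 2)%:E)%E =
    (((c n - v) ^+ 2)%:E * (4 * d_ (k0 + n) ^+ 2)%:E)%E.
    by rewrite -(measure_ball_plane x (dyadic_gt0 R (k0 + n))); apply: integral_cst; exact: mb.
  rewrite -EFinM lee_fin; apply: ler_wpM2r; first by apply: mulr_ge0 => //; exact: sqr_ge0.
  rewrite -(real_normK (num_real (c n - v))) distrC lerXn2r ?nnegrE//.
  exact: le_trans (hv n).
have tri y : ball x (d_ (k0 + n)) y -> `|U y - v| <= `|U y - c n| + `|cst (c n - v) y|.
  by move=> _; exact: ler_distD.
rewrite kl.
have := sqint_triangle mb (mUc _) (measurable_cst _) (mUc _) tri (hc n) hcst.
move=> /le_trans; apply; rewrite lee_fin.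
have dn := exprn_gt0 2 (dyadic_gt0 R (k0 + n)).
have tn : (tau ^+ n) ^+ 2 = theta ^+ n by rewrite -exprM mulnC exprM tau2.
rewrite [(_ / _ * tau ^+ n) ^+ 2]exprMn tn /modulus.
set q := (_ / _) ^+ 2; have q0 : 0 <= q by exact: sqr_ge0.
have -> : 2 * (B * d_ (k0 + n) ^+ 2 * theta ^+ n) + 2 * (q * theta ^+ n * (4 * d_ (k0 + n) ^+ 2)) =
  2 * (B + 4 * q) * d_ (k0 + n) ^+ 2 * theta ^+ n by ring.
apply: ler_wpM2l; first by apply: mulr_ge0; [lra|exact: ltW].
by apply: ler_wiXn2l => //; [exact: ltW|have /andP[_ /ltW] := theta_itv].
Qed.

End Campanato.

(** * The continuous representative *)

Section Representative.
Variable R : realType.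
Local Notation mu := (leb2 R).
Local Notation d_ := (dyadic R).
Variables (Omega : set (plane R)) (U v : plane R -> R) (theta B : R).
Hypothesis oO : open Omega.
Hypothesis mU : measurable_fun Omega U.
Hypothesis theta_itv : 4^-1 < theta < 1.
Hypothesis hv : forall (x : plane R) k l, ball x (4 * d_ k) `<=` Omega ->
  (sqint (ball x (d_ (k + l))) (fun y => U y - v x)%R <=
     (B * d_ (k + l) ^+ 2 * theta ^+ l)%:E)%E.

Let mO : measurable Omega := open_measurable_plane oO.

Let theta_gt0 : 0 < theta.
Proof. by have /andP[h _] := theta_itv; apply: lt_trans h; rewrite invr_gt0. Qed.

Let sub_ball (z : plane R) k l : ball z (4 * d_ k) `<=` Omega ->
  ball z (d_ (k + l)) `<=` Omega.
Proof.
move=> zO; apply: subset_trans zO; apply: le_ball.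
by have := dyadic_le R (leq_addr l k); have := dyadic_gt0 R k; lra.
Qed.

Lemma bound_ge0 (x : plane R) k : ball x (4 * d_ k) `<=` Omega -> 0 <= B.
Proof.
move=> xO; have := hv 0 xO; rewrite addn0 expr0 mulr1 => h.
have := le_trans (sqint_ge0 _ _) h.
by rewrite lee_fin pmulr_lge0// exprn_gt0// dyadic_gt0.
Qed.

(** The square of half side r about y is contained in the one of half side 2r
    about x, so the values at x and y are both compared with U there. *)
Lemma value_close (x y : plane R) k l :
  ball x (4 * d_ k) `<=` Omega -> ball y (4 * d_ k) `<=` Omega ->
  ball x (d_ (k + l.+1)) y -> (v y - v x) ^+ 2 <= 3 * B * theta ^+ l.
Proof.
move=> xO yO xy; have B0 := bound_ge0 xO.
have d0 := dyadic_gt0 R (k + l.+1).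
have dd : d_ (k + l) = 2 * d_ (k + l.+1) by rewrite addnS -dyadicS.
have sub : ball y (d_ (k + l.+1)) `<=` ball x (d_ (k + l)).
  move=> t yt; rewrite dd mulrDl mul1r; exact: ball_triangle xy yt.
have th := exprn_gt0 l theta_gt0.
have := constants_close oO mU d0 sub (@sub_ball _ _ _ xO) (hv l xO) (hv l.+1 yO).
rewrite dd [theta ^+ l.+1]exprS => h.
rewrite -(@ler_pM2l _ (2 * d_ (k + l.+1) ^+ 2)) ?mulr_gt0 ?exprn_gt0//.
apply: (le_trans h); move: (d_ (k + l.+1)) d0 => r r0.
have -> : B * (2 * r) ^+ 2 * theta ^+ l + B * r ^+ 2 * (theta * theta ^+ l) =
      (B * r ^+ 2 * theta ^+ l) * (4 + theta) by ring.
have -> : 2 * r ^+ 2 * (3 * B * theta ^+ l) = (B * r ^+ 2 * theta ^+ l) * 6 by ring.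
apply: ler_wpM2l; first by rewrite !mulr_ge0 ?exprn_ge0// ltW.
by have /andP[_] := theta_itv; lra.
Qed.

Let theta_small (e : R) : 0 < e -> exists l, theta ^+ l < e.
Proof.
move=> e0; have /andP[_ t1] := theta_itv.
have h1 : `|theta| < 1 by rewrite ger0_norm// ltW.
have /cvgr0_norm_lt /(_ e e0)[l _ hl] := cvg_expr h1.
exists l; have := hl l (leqnn _).
by rewrite ger0_norm// exprn_ge0// ltW.
Qed.

Lemma value_continuous : {in Omega, continuous v}.
Proof.
move=> x; rewrite inE => Ox.
have /nbhs_ballP[e /= e0 eO] := open_nbhs_nbhs (conj oO Ox).
have e8 : 0 < e / 8 by rewrite divr_gt0.
have [k hk] := dyadic_small e8.
have xO : ball x (4 * d_ k) `<=` Omega.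
  by apply: subset_trans eO; apply: le_ball; have := dyadic_gt0 R k; lra.
have B0 := bound_ge0 xO.
apply/cvgrPdist_lt => eps eps0.
have q0 : 0 < eps ^+ 2 / (3 * B + 1).
  by rewrite divr_gt0 ?exprn_gt0//; lra.
have [l hl] := theta_small q0.
have : \forall y \near x, ball x (d_ (k + l.+1)) y.
  by apply/nbhs_ballP; exists (d_ (k + l.+1)) => //=; exact: dyadic_gt0.
apply: filterS => y xy.
have yO : ball y (4 * d_ k) `<=` Omega.
  apply: subset_trans eO => t yt.
  apply: (@le_ball _ _ _ (d_ (k + l.+1) + 4 * d_ k)); last exact: ball_triangle xy yt.
  by have := dyadic_le R (leq_addr l.+1 k); lra.
have h := value_close xO yO xy.
rewrite distrC -(@ltr_pXn2r _ 2) ?nnegrE// ?(ltW eps0)// real_normK ?num_real//.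
apply: (le_lt_trans h).
have : theta ^+ l * (3 * B + 1) < eps ^+ 2 by rewrite -ltr_pdivlMr//; lra.
have := exprn_gt0 l theta_gt0; lra.
Qed.

Let mv : measurable_fun Omega v.
Proof. exact: open_continuous_measurable_plane value_continuous. Qed.

Let mUv (A : set (plane R)) : measurable A -> A `<=` Omega ->
  measurable_fun A (fun x => U x - v x).
Proof.
move=> mA AO; apply: measurable_funB; [exact: measurable_funS mO AO mU|exact: measurable_funS mO AO mv].
Qed.

(** Closed squares, because a closed square is the union of its four closed
    quarters whereas open squares would leave out the dividing lines. *)
Definition csquare (z : plane R) (r : R) : set (plane R) :=
  crect (z.1 - r, z.2 - r) (z.1 + r, z.2 + r).

Lemma measurable_csquare z r : measurable (csquare z r).
Proof. by apply: measurableX; exact: measurable_itv. Qed.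

Lemma csquareP (z x : plane R) r :
  csquare z r x <-> `|z.1 - x.1| <= r /\ `|z.2 - x.2| <= r.
Proof. by rewrite /csquare /crect /= !in_itv /= !ler_distlC. Qed.

Lemma sqint_quarters (z : plane R) (r p : R) (f : plane R -> R) : 0 < r ->
  measurable_fun (csquare z (2 * r)) f ->
  (forall z', csquare z' r `<=` csquare z (2 * r) ->
    (sqint (csquare z' r) f <= p%:E)%E) ->
  (sqint (csquare z (2 * r)) f <= (4 * p)%:E)%E.
Proof.
move=> r0 mf hp.
pose Q (s t : R) := csquare (z.1 + s, z.2 + t) r.
have mQ s t : measurable (Q s t) by exact: measurable_csquare.
have Qs s t : s = r \/ s = - r -> t = r \/ t = - r -> Q s t `<=` csquare z (2 * r).
  move=> hs ht x /csquareP[/=]; rewrite !ler_distlC => /andP[h1 h2] /andP[h3 h4].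
  apply/csquareP; rewrite !ler_distlC; split; apply/andP;
    by case: hs h1 h2 => ->; case: ht h3 h4 => ->; split; lra.
have cover : csquare z (2 * r) = (Q r r `|` Q r (- r)) `|` (Q (- r) r `|` Q (- r) (- r)).
  apply/seteqP; split => [x|x [[|]|[|]]]; try by apply: Qs; tauto.
  move=> /csquareP; rewrite !ler_distlC => -[/andP[h1 h2] /andP[h3 h4]].
  have [z1|z1] := leP z.1 x.1; have [z2|z2] := leP z.2 x.2.
  - left; left; apply/csquareP; rewrite /= !ler_distlC; split; apply/andP; split; lra.
  - left; right; apply/csquareP; rewrite /= !ler_distlC; split; apply/andP; split; lra.
  - right; left; apply/csquareP; rewrite /= !ler_distlC; split; apply/andP; split; lra.
  - right; right; apply/csquareP; rewrite /= !ler_distlC; split; apply/andP; split; lra.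
have mfS (A : set (plane R)) : A `<=` csquare z (2 * r) -> measurable_fun A f.
  by move=> AS; exact: measurable_funS (measurable_csquare z (2 * r)) AS mf.
have b s t : s = r \/ s = - r -> t = r \/ t = - r -> (sqint (Q s t) f <= p%:E)%E.
  by move=> hs ht; apply: hp; exact: Qs.
rewrite {1}cover.
apply: (le_trans (sqintU_le (measurableU _ _ (mQ _ _) (mQ _ _)) (measurableU _ _ (mQ _ _) (mQ _ _)) _)).
  by rewrite -cover.
rewrite (_ : (4 * p)%:E = ((p%:E + p%:E) + (p%:E + p%:E))%E); last first.
  by rewrite -!EFinD; congr EFin; ring.
apply: leeD.
  apply: (le_trans (sqintU_le (mQ _ _) (mQ _ _) _)).
    by apply: mfS; rewrite cover; exact: subsetUl.
  by apply: leeD; apply: b; tauto.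
apply: (le_trans (sqintU_le (mQ _ _) (mQ _ _) _)).
  by apply: mfS; rewrite cover; exact: subsetUr.
by apply: leeD; apply: b; tauto.
Qed.

Let sup_triangle (x y t : plane R) (r s : R) :
  csquare x r y -> ball y s t -> ball x (r + s) t.
Proof.
move=> /csquareP[h1 h2] [g1 g2]; split; rewrite /ball /=.
  by apply: le_lt_trans (ler_distD y.1 _ _) _; apply: ler_ltD.
by apply: le_lt_trans (ler_distD y.2 _ _) _; apply: ler_ltD.
Qed.

(* The values v x for x in the square are all close to v z, which is close to U
   in the mean; the measure of the square contributes the factor 4 and squared
   triangle inequalities the rest: 2 theta + 2 * 3 * 4 <= 26. *)
Let sqint_base (z : plane R) k l :
  ball z (4 * d_ k) `<=` Omega ->
  (forall x, ball z (d_ (k + l.+1)) x -> ball x (4 * d_ k) `<=` Omega) ->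
  (sqint (ball z (d_ (k + l.+1))) (fun x => U x - v x)%R <=
    (26 * B * d_ (k + l.+1) ^+ 2 * theta ^+ l)%:E)%E.
Proof.
move=> zO zO'; have B0 := bound_ge0 zO.
have t0 := exprn_gt0 l theta_gt0.
set S := ball z (d_ (k + l.+1)); have mS : measurable (S : set (plane R)).
  exact: measurable_ball_plane.
have SO : S `<=` Omega by exact: sub_ball.
have mUz : measurable_fun S (fun x => U x - v z).
  by apply: measurable_funB => //; exact: measurable_funS mO SO mU.
have mvz : measurable_fun S (fun x => v x - v z).
  by apply: measurable_funB => //; exact: measurable_funS mO SO mv.
have tri x : S x -> `|U x - v x| <= `|U x - v z| + `|v x - v z|.
  by move=> _; rewrite [`|v x - v z|]distrC; exact: ler_distD.
have hc : (sqint S (fun x => v x - v z)%R <=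
    (3 * B * theta ^+ l * (4 * d_ (k + l.+1) ^+ 2))%:E)%E.
  rewrite EFinM -(measure_ball_plane z (dyadic_gt0 R (k + l.+1))).
  rewrite -[leRHS](@integral_cst _ _ _ mu S mS); apply: ge0_le_integral => //.
  - by move=> x _; rewrite lee_fin sqr_ge0.
  - exact: measurable_sqr.
  - by move=> x Sx; rewrite lee_fin; exact: value_close zO (zO' _ Sx) Sx.
have := sqint_triangle mS mUz mvz (mUv mS SO) tri (hv l.+1 zO) hc.
move=> /le_trans; apply; rewrite lee_fin [theta ^+ l.+1]exprS.
move: (d_ _) => r; have r2 := sqr_ge0 r.
have -> : 2 * (B * r ^+ 2 * (theta * theta ^+ l)) + 2 * (3 * B * theta ^+ l * (4 * r ^+ 2)) =
  (B * r ^+ 2 * theta ^+ l) * (2 * theta + 24) by ring.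
have -> : 26 * B * r ^+ 2 * theta ^+ l = (B * r ^+ 2 * theta ^+ l) * 26 by ring.
apply: ler_wpM2l; last by have /andP[_] := theta_itv; lra.
by apply: mulr_ge0; [exact: mulr_ge0|exact: ltW].
Qed.

(* The mean over a square is the average of the means over its four quarters,
   for which the bound is better by a factor theta.  104 = 4 * 26 because the
   base case bounds the integral over a closed square by that over an open
   square of twice the side. *)
Let sqint_iter (z : plane R) k j : ball z (16 * d_ k) `<=` Omega ->
  forall l z', csquare z' (d_ (k + l.+2)) `<=` csquare z (d_ k) ->
  (sqint (csquare z' (d_ (k + l.+2))) (fun x => U x - v x)%R <=
    (104 * B * d_ (k + l.+2) ^+ 2 * theta ^+ (l + j))%:E)%E.
Proof.
move=> zO; have dk := dyadic_gt0 R k.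
have regO : csquare z (d_ k) `<=` Omega.
  apply: subset_trans zO; apply: crect_ball; lra.
elim: j => [|j IH] l z' z'z.
  have dl := dyadic_gt0 R (k + l.+2).
  have dd : d_ (k + l.+1) = 2 * d_ (k + l.+2) by rewrite [(k + l.+2)%N]addnS -dyadicS.
  have zz' : csquare z (d_ k) z'.
    by apply: z'z; apply/csquareP; rewrite !subrr normr0 ltW.
  have z'O : ball z' (4 * d_ k) `<=` Omega.
    apply: subset_trans zO => t z't.
    by apply: (@le_ball _ _ _ (d_ k + 4 * d_ k)); [lra|exact: sup_triangle zz' z't].
  have z'O' x : ball z' (d_ (k + l.+1)) x -> ball x (4 * d_ k) `<=` Omega.
    move=> z'x t xt; apply: zO.
    apply: (@le_ball _ _ _ (d_ k + (d_ (k + l.+1) + 4 * d_ k))).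
      by have := dyadic_le R (leq_addr l.+1 k); lra.
    apply: sup_triangle zz' _; exact: ball_triangle z'x xt.
  have SB : csquare z' (d_ (k + l.+2)) `<=` ball z' (d_ (k + l.+1)).
    by apply: crect_ball; lra.
  have BO : ball z' (d_ (k + l.+1)) `<=` Omega by exact: sub_ball.
  have mB : measurable (ball z' (d_ (k + l.+1)) : set (plane R)) by exact: measurable_ball_plane.
  apply: (@le_trans _ _ (sqint (ball z' (d_ (k + l.+1))) (fun x => U x - v x)%R)).
    by apply: subset_sqint => //; [exact: measurable_csquare|exact: mUv].
  apply: (le_trans (sqint_base z'O z'O')); rewrite addn0 lee_fin dd.
  by rewrite le_eqVlt; apply/orP; left; apply/eqP; ring.
have dd : d_ (k + l.+2) = 2 * d_ (k + l.+3) by rewrite [(k + l.+3)%N]addnS -dyadicS.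
have mS := measurable_csquare z' (d_ (k + l.+2)).
rewrite dd.
have -> : 104 * B * (2 * d_ (k + l.+3)) ^+ 2 * theta ^+ (l + j.+1) =
   4 * (104 * B * d_ (k + l.+3) ^+ 2 * theta ^+ (l.+1 + j)).
  by rewrite addSnnS; ring.
apply: sqint_quarters; first exact: dyadic_gt0.
  by rewrite -dd; apply: mUv => //; exact: subset_trans z'z regO.
move=> z'' z''z'; apply: IH.
by apply: subset_trans z'z; rewrite dd.
Qed.

(** The mean square distance between U and v over a square of fixed size is
    an average over ever smaller squares, where it is ever smaller. *)
Lemma value_ae : {ae mu, forall x, Omega x -> v x = U x}.
Proof.
(* The square of half side 16 * 2^-k leaves room for the squares of half side
   4 * 2^-k about all points near z, and the conclusion is drawn on a square two
   dyadic steps smaller than 2^-k. *)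
apply: (ae_open (s := 2) (m := 16) oO) => // z k zO.
have S0 : sqint (csquare z (d_ (k + 2))) (fun x => U x - v x)%R = 0%E.
  apply/eqP; rewrite eq_le sqint_ge0 andbT.
  apply/lee_addgt0Pr => e e0; rewrite add0e.
  have sub : csquare z (d_ (k + 0.+2)) `<=` csquare z (d_ k).
    move=> x /csquareP[h1 h2]; have dd := dyadic_le R (leq_addr 2 k).
    by apply/csquareP; split; [apply: le_trans h1 _|apply: le_trans h2 _].
  have B0 : 0 <= B.
    apply: (@bound_ge0 z k); apply: subset_trans zO; apply: le_ball.
    by have := dyadic_gt0 R k; lra.
  have q0 : 0 < 104 * B * d_ (k + 2) ^+ 2 + 1.
    have : 0 <= 104 * B * d_ (k + 2) ^+ 2 by apply: mulr_ge0; [exact: mulr_ge0|exact: sqr_ge0].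
    lra.
  have [j hj] := theta_small (divr_gt0 e0 q0).
  apply: (le_trans (sqint_iter j zO sub)); rewrite lee_fin add0n.
  have : theta ^+ j * (104 * B * d_ (k + 2) ^+ 2 + 1) <= e.
    by rewrite -ler_pdivlMr// ltW.
  by rewrite mulrDr mulr1 mulrC; have := exprn_gt0 j theta_gt0; lra.
have SO : csquare z (d_ (k + 2)) `<=` Omega.
  apply: subset_trans zO; apply: crect_ball.
  by have := dyadic_le R (leq_addr 2 k); have := dyadic_gt0 R k; lra.
have mS := measurable_csquare z (d_ (k + 2)).
have msq : measurable_fun (csquare z (d_ (k + 2))) (fun x => ((U x - v x) ^+ 2)%:E).
  by apply: measurable_sqr; exact: mUv.
have := (@ae_eq_integral_abs _ _ _ mu _ mS _ msq).1.
rewrite (_ : (\int[mu]_(x in csquare z (d_ (k + 2))) `|((U x - v x) ^+ 2)%:E|)%E = 0%E); last first.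
  rewrite -S0; apply: eq_integral => x _.
  by rewrite /= ger0_norm// sqr_ge0.
move=> /(_ erefl); apply: filterS => x h xz.
have xS : csquare z (d_ (k + 2)) x.
  by move: xz => [h1 h2]; apply/csquareP; split; apply: ltW.
have [/eqP] := h xS; rewrite sqrf_eq0 subr_eq0 => /eqP ->//.
Qed.

Lemma compact_uniform_radius (K : set (plane R)) : compact K -> K `<=` Omega ->
  exists k, forall x, K x -> ball x (4 * d_ k) `<=` Omega.
Proof.
move=> /compact_near_coveringP cK KO.
have [|k _ hk] := cK nat \oo (fun k x => ball x (4 * d_ k) `<=` Omega) _.
  move=> x Kx; have Ox := KO _ Kx.
  have /nbhs_ballP[e /= e0 eO] := open_nbhs_nbhs (conj oO Ox).
  have e8 : 0 < e / 8 by rewrite divr_gt0.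
  have [k0 hk0] := dyadic_small e8.
  exists (ball x (e / 2), [set k | (k0 <= k)%N]) => /=.
    by split; [apply: nbhsx_ballx; rewrite divr_gt0|exists k0].
  move=> [y k] /= [xy k0k] t yt; apply: eO.
  have := dyadic_le R k0k => h.
  apply: (@le_ball _ _ _ (e / 2 + 4 * d_ k)); [lra|exact: ball_triangle xy yt].
by exists k => x Kx; exact: (hk k (leqnn k) x Kx).
Qed.

Lemma compact_bounded_value (K : set (plane R)) : compact K -> K `<=` Omega ->
  exists2 V, 0 <= V & forall x, K x -> `|v x| <= V.
Proof.
move=> cK KO.
have cv : {within K, continuous v}.
  by apply: continuous_in_subspaceT => x xK; apply: value_continuous; apply/mem_set/KO; exact: set_mem xK.
have [M [_ hM]] := compact_bounded (continuous_compact cv cK).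
exists (`|M| + 1); first by rewrite addr_ge0.
move=> x Kx; apply: (hM (`|M| + 1)); last by exists x.
by rewrite (le_lt_trans (ler_norm _))// ltrDl.
Qed.

End Representative.

(** * Hoelder continuity from dyadic estimates *)

Section Exponent.
Variable R : realType.

(** The number alpha with (1/2)^alpha = sqrt theta. *)
Definition exponent (theta : R) : R := ln (Num.sqrt theta) / ln 2^-1.

Lemma exponent_itv (theta : R) : 4^-1 < theta < 1 -> 0 < exponent theta < 1.
Proof.
move=> /andP[h1 h2]; have t0 : 0 < theta by apply: lt_trans h1; rewrite invr_gt0.
have s0 : 0 < Num.sqrt theta by rewrite sqrtr_gt0.
have l2 : ln 2^-1 < 0 :> R by rewrite ln_lt0// invr_gt0 ltr0n invf_lt1// ltr1n.
have ls : ln (Num.sqrt theta) < 0.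
  rewrite ln_lt0// s0/= -(@ltr_pXn2r _ 2) ?nnegrE ?ltW//.
  by rewrite sqr_sqrtr ?ltW// expr1n.
have lt : ln 2^-1 < ln (Num.sqrt theta).
  rewrite ltr_ln ?posrE ?invr_gt0// -(@ltr_pXn2r _ 2) ?nnegrE ?invr_ge0// ?ltW//.
  by rewrite sqr_sqrtr ?ltW// exprVn -natrX.
rewrite /exponent; apply/andP; split.
  by rewrite nmulr_rgt0// invr_lt0.
by rewrite ltr_ndivrMr// mul1r.
Qed.

Lemma dyadic_powR (theta : R) l : 0 < theta ->
  dyadic R l `^ exponent theta = Num.sqrt theta ^+ l.
Proof.
move=> t0; have s0 : 0 < Num.sqrt theta by rewrite sqrtr_gt0.
have h2 : 0 < 2^-1 :> R by rewrite invr_gt0.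
have l2 : ln 2^-1 < 0 :> R by rewrite ln_lt0// h2 invf_lt1// ltr1n.
rewrite /dyadic -powR_mulrn ?ltW// -powRrM mulrC powRrM powR_mulrn ?powR_ge0//.
by rewrite /powR gt_eqF// /exponent divfK ?lt_eqF// lnK.
Qed.

Lemma abs_le_enorm (x y : plane R) :
  `|x.1 - y.1| <= enorm (x - y) /\ `|x.2 - y.2| <= enorm (x - y).
Proof.
have h (a b : R) : `|a| <= Num.sqrt (a ^+ 2 + b ^+ 2).
  by rewrite -sqrtr_sqr ler_wsqrtr// lerDl sqr_ge0.
have h' (a b : R) : `|b| <= Num.sqrt (a ^+ 2 + b ^+ 2) by rewrite addrC.
by split; [exact: h|exact: h'].
Qed.

End Exponent.

Section Hoelder.
Variable R : realType.
Local Notation d_ := (dyadic R).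

(** Nearby points are at distance about 2^-n for some n = k + l + 2, and
    theta^(l/2) is the power alpha of 2^-l, which is comparable to the distance.
    For points further apart than 2^-(k+1) the bound V on v is enough. *)
Lemma dyadic_hoelder (K : set (plane R)) (v : plane R -> R) (theta B V : R) k :
  4^-1 < theta < 1 -> 0 <= V -> 0 <= B -> (forall x, K x -> `|v x| <= V) ->
  (forall x y l, K x -> K y -> ball x (d_ (k + l.+1)) y ->
    (v y - v x) ^+ 2 <= B * theta ^+ l) ->
  exists2 C, 0 <= C & forall x y, K x -> K y ->
    `|v x - v y| <= C * enorm (x - y) `^ exponent theta.
Proof.
move=> th V0 B0 vV vclose; have /andP[a0 a1] := exponent_itv th.
have t0 : 0 < theta by have /andP[h _] := th; apply: lt_trans h; rewrite invr_gt0.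
set alpha := exponent theta in a0 a1 *.
(* The base scale 2^-(k+2) is where the first index l = 0 meets the minimal n
   below, so that 2^-l = 2^-n / 2^-(k+2). *)
have D0 := dyadic_gt0 R (k + 2).
have Di : 0 <= (d_ (k + 2))^-1 by rewrite invr_ge0 ltW.
have C0 : 0 <= (2 * V + Num.sqrt B) * (d_ (k + 2))^-1 `^ alpha.
  by rewrite mulr_ge0 ?powR_ge0// addr_ge0 ?sqrtr_ge0// mulr_ge0.
exists ((2 * V + Num.sqrt B) * (d_ (k + 2))^-1 `^ alpha) => //.
move=> x y Kx Ky; have [e1 e2] := abs_le_enorm x y.
have [e0|e0] := leP (enorm (x - y)) 0.
  have -> : x = y.
    apply/eqP; rewrite -subr_eq0 -pair_eqE; apply/andP; split;
      by rewrite -normr_le0; apply: le_trans e0.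
  by rewrite subrr normr0; apply: mulr_ge0 => //; exact: powR_ge0.
rewrite -mulrA -powRM//; last exact: ltW.
have mon (p q : R) : 0 <= p -> p <= q -> p `^ alpha <= q `^ alpha.
  by move=> p0 pq; apply: (ge0_ler_powR (ltW a0)); rewrite ?nnegrE//; exact: le_trans pq.
have [far|near_] := leP (d_ k.+1) (enorm (x - y)).
  have one : 1 <= ((d_ (k + 2))^-1 * enorm (x - y)) `^ alpha.
    have one_pow : 1 `^ alpha = 1 :> R by rewrite powR1.
    rewrite -one_pow; apply: mon => //.
    rewrite mulrC ler_pdivlMr// mul1r; apply: le_trans far.
    by rewrite dyadic_le// addn2.
  apply: (le_trans (ler_normB _ _)).
  apply: (@le_trans _ _ (2 * V + Num.sqrt B)).
    by have := vV _ Kx; have := vV _ Ky; have := sqrtr_ge0 B; lra.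
  by rewrite ler_peMr// addr_ge0 ?sqrtr_ge0// mulr_ge0.
have ex : exists n, d_ n <= enorm (x - y).
  by have [n hn] := dyadic_small e0; exists n; exact: ltW.
case: (ex_minnP ex) => n hn nmin.
have kn : (k + 2 <= n)%N.
  rewrite leqNgt; apply/negP => nk; have : d_ k.+1 <= enorm (x - y).
    by apply: le_trans hn; apply: dyadic_le; rewrite addn2 ltnS in nk.
  by rewrite leNgt near_.
pose l := (n - (k + 2))%N.
have nE : n = (k + l.+2)%N by rewrite -[LHS](subnKC kn) -addnA.
have xy : ball x (d_ (k + l.+1)) y.
  have lt : enorm (x - y) < d_ (k + l.+1).
    rewrite ltNge; apply/negP => /nmin; rewrite nE !addnS ltnn//.
  by split; rewrite /ball /=; [exact: le_lt_trans e1 lt|exact: le_lt_trans e2 lt].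
have h := vclose _ _ _ Kx Ky xy.
have hl : `|v x - v y| <= Num.sqrt B * d_ l `^ alpha.
  rewrite dyadic_powR// distrC -sqrtr_sqr; apply: (le_trans (ler_wsqrtr h)).
  rewrite sqrtrM// -[X in _ * Num.sqrt X](_ : (Num.sqrt theta ^+ l) ^+ 2 = theta ^+ l); last first.
    by rewrite -exprM mulnC exprM sqr_sqrtr// ltW.
  by rewrite sqrtr_sqr ger0_norm// exprn_ge0// sqrtr_ge0.
apply: (le_trans hl).
apply: (@le_trans _ _ (Num.sqrt B * ((d_ (k + 2))^-1 * enorm (x - y)) `^ alpha)).
  apply: ler_wpM2l; first exact: sqrtr_ge0.
  apply: mon; first exact/ltW/dyadic_gt0.
  rewrite mulrC ler_pdivlMr//; apply: le_trans hn.
  by rewrite nE /dyadic -exprD addnCA addn2.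
by rewrite ler_wpM2r ?powR_ge0// lerDr mulr_ge0.
Qed.

End Hoelder.

(** Campanato's theorem: U is close in the mean to constants on small squares,
    so their limits define a function v, and comparing the squares about two
    points shows that v is Hoelder continuous. *)
Lemma campanato_hoelder (R : realType) (Omega : set (plane R)) (U : plane R -> R)
    (theta B : R) :
  open Omega -> measurable_fun Omega U -> 4^-1 < theta < 1 -> 0 <= B ->
  (forall (z : plane R) k l, ball z (4 * dyadic R k) `<=` Omega ->
    exists c, (sqint (ball z (dyadic R (k + l))) (fun x => U x - c)%R <=
      (B * dyadic R (k + l) ^+ 2 * theta ^+ l)%:E)%E) ->
  exists2 v : plane R -> R, {ae leb2 R, forall x, Omega x -> v x = U x} &
    forall K, compact K -> K `<=` Omega -> exists2 C, 0 <= C &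
      forall x y, K x -> K y ->
        `|v x - v y| <= C * enorm (x - y) `^ exponent theta.
Proof.
move=> oO mU th B0 dec.
have [v hv] := choice (exists_value oO mU th dec).
exists v; first exact: value_ae oO mU th hv.
move=> K cK KO.
have [k kO] := compact_uniform_radius oO cK KO.
have [V V0 hV] := compact_bounded_value oO mU th hv cK KO.
have M0 : 0 <= 3 * modulus theta B.
  by rewrite mulr_ge0// mulr_ge0// addr_ge0// mulr_ge0// sqr_ge0.
apply: (dyadic_hoelder th V0 M0 hV (k := k)) => x y l Kx Ky xy.
exact: (value_close oO mU th hv (kO _ Kx) (kO _ Ky) xy).
Qed.

(** * Weak gradients and convergence in L^2 *)

Section Bridge.
Variable R : realType.
Local Notation mu := (leb2 R).
Implicit Types (Omega : set (plane R)) (f : plane R -> R).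

Lemma sqint_restrict Omega f : measurable Omega ->
  (\int[mu]_x (`|(EFin \o (f \_ Omega)) x| `^ 2) = sqint Omega f)%E.
Proof.
move=> mO; rewrite /sqint [RHS]integral_mkcond; apply: eq_integral => x _.
rewrite /= powR_mulrn// real_normK ?num_real// !patchE.
by case: (x \in Omega) => //; rewrite expr0n.
Qed.

Lemma sqint_Lnorm Omega f : measurable Omega ->
  sqint Omega f = (Lnorm mu 2%:E (EFin \o (f \_ Omega)) `^ 2)%E.
Proof. by move=> mO; rewrite powR_Lnorm// sqint_restrict. Qed.

Lemma square_integrable_L2on Omega f : measurable Omega ->
  square_integrable Omega f -> L2on Omega f.
Proof.
move=> mO fL; split.
  have : measurable_fun setT (f \_ Omega).
    by have := sub_Lfun_mfun fL; rewrite inE.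
  by move=> /(measurable_restrictT _ mO).2.
have := Lfun2_integrable_sqr fL => /integrableP[_].
rewrite /sqint [X in _ -> (X < _)%E]integral_mkcond.
apply: le_lt_trans; rewrite le_eqVlt; apply/orP; left; apply/eqP.
apply: eq_integral => x _ /=; rewrite ger0_norm ?sqr_ge0// !patchE.
by case: (x \in Omega) => //; rewrite expr0n.
Qed.

Lemma Lnorm_cvg0_sqint Omega (f : nat -> plane R -> R) (e : R) :
  measurable Omega -> 0 < e ->
  Lnorm mu 2%:E (EFin \o (f n \_ Omega)) @[n --> \oo] --> 0%E ->
  \forall n \near \oo, (sqint Omega (f n) <= e%:E)%E.
Proof.
move=> mO e0 f0.
have s0 : (0 < (Num.sqrt e)%:E)%E by rewrite lte_fin sqrtr_gt0.
have : \forall n \near \oo,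
    (Lnorm mu 2%:E (EFin \o (f n \_ Omega)) < (Num.sqrt e)%:E)%E.
  exact: f0 _ (open_ereal_lt' s0).
apply: filterS => n /ltW hn; rewrite sqint_Lnorm//.
have -> : e%:E = ((Num.sqrt e)%:E `^ 2)%E.
  by rewrite poweR_EFin powR_mulrn// ?sqrtr_ge0// sqr_sqrtr// ltW.
by apply: gt0_ler_poweR => //; rewrite in_itv/= leey andbT ?Lnorm_ge0.
Qed.

Lemma bounded_measure Omega : measurable Omega -> bounded_set Omega ->
  exists r : R, 0 < r /\ Omega `<=` ball (0 : plane R) r.
Proof.
move=> mO [M [_ hM]]; exists (`|M| + 2); split; first by rewrite ltr_wpDl.
move=> x Ox; have h : `|x| <= `|M| + 1.
  by apply: hM => //; rewrite (le_lt_trans (ler_norm _))// ltrDl.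
rewrite -ball_normE /= sub0r normrN; apply: le_lt_trans h _; lra.
Qed.

Lemma continuous_L2on Omega f : measurable Omega -> bounded_set Omega ->
  continuous f -> L2on Omega f.
Proof.
move=> mO bO cf; have [r [r0 Or]] := bounded_measure mO bO.
have mf : measurable_fun setT f by exact: continuous_measurable_plane.
split; first exact: measurable_funTS.
have cK : compact (crect (- r, - r) (r, r) : set (plane R)) by exact: compact_crect.
have [M [_ hM]] := compact_bounded (continuous_compact (continuous_subspaceT cf) cK).
have bM x : Omega x -> `|f x| <= `|M| + 1.
  move=> /Or; rewrite ball_rect => xr; apply: hM; first by rewrite (le_lt_trans (ler_norm _))// ltrDl.
  by exists x => //; apply: rect_crect; move: xr; rewrite /= !sub0r !add0r.
apply: (@le_lt_trans _ _ (\int[mu]_(x in Omega) (cst ((`|M| + 1) ^+ 2)%:E x))%E).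
  apply: ge0_le_integral => //.
  - by move=> x _; rewrite lee_fin sqr_ge0.
  - by apply: measurable_sqr; exact: measurable_funTS.
  - move=> x /bM h; rewrite lee_fin -(real_normK (num_real (f x))) lerXn2r// nnegrE.
    exact: le_trans h.
rewrite integral_cst// lte_mul_pinfty// ?lee_fin ?sqr_ge0//.
apply: (@le_lt_trans _ _ (mu (ball (0 : plane R) r))).
  by apply: le_measure; rewrite ?inE//; exact: measurable_ball_plane.
by rewrite measure_ball_plane// ltry.
Qed.

(** The difference of two weak gradients integrates to zero against every test
    function. *)
Lemma weak_gradient_unique Omega (u : plane R -> 'cV[R]_2) (Du Du' : plane R -> 'M[R]_2)
    (sigma : R -> R) i j :
  open Omega -> bounded_set Omega -> smooth_step sigma ->
  W12_with_gradient Omega u Du -> W12_with_gradient Omega u Du' ->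
  {ae mu, forall x, Omega x -> Du x i j = Du' x i j}.
Proof.
move=> oO bO ss [_ hD wD] [_ hD' wD'].
have mO := open_measurable_plane oO.
have L := square_integrable_L2on mO (hD i j).
have L' := square_integrable_L2on mO (hD' i j).
have L1 : L2on Omega (cst 1) by apply: continuous_L2on => //; exact: cst_continuous.
have LM (f : plane R -> R) psi : L2on Omega f -> test_function Omega psi ->
    mu.-integrable Omega (EFin \o (fun x => f x * psi x)).
  move=> Lf [sp _ _]; apply: L2onM => //; apply: continuous_L2on => //.
  exact: smooth2_continuous.
have fi : mu.-integrable Omega (EFin \o (fun x => Du x i j - Du' x i j)).
  have := integrable_sub mO (L2onM mO L L1) (L2onM mO L' L1).
  by congr (_.-integrable _ _); apply/funext => x /=; rewrite !mulr1.
have : {ae mu, forall x, Omega x -> Du x i j - Du' x i j = 0}.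
  apply: (fundamental_lemma oO ss fi) => psi tpsi.
  under eq_Rintegral do rewrite mulrBl.
  rewrite RintegralB//; [|exact: LM L tpsi|exact: LM L' tpsi].
  apply/eqP; rewrite subr_eq0 -eqr_opp; apply/eqP.
  by rewrite -(wD psi i j tpsi) -(wD' psi i j tpsi).
apply: (@filterS _ _ (ae_filter_ringOfSetsType mu)) => x h Ox.
by apply/eqP; rewrite -subr_eq0; apply/eqP; exact: h.
Qed.

End Bridge.

(** * Local Hoelder continuity *)

Theorem theorem2p3 (R : realType) (Omega : set (plane R))
    (Omega_open : open Omega) (Omega_bounded : bounded_set Omega)
    (Omega_lipschitz : lipschitz_domain Omega)
    (gamma s0 kappa : R) (rho1 rho : R -> R)
    (rho_spec : energy_density gamma s0 kappa rho1 rho)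
    (u0 u : plane R -> 'cV[R]_2) (u_admissible : admissible Omega u0 u)
    (Du : plane R -> 'M[R]_2) (u_gradient : W12_with_gradient Omega u Du)
    (u_stationary : weak_euler_lagrange Omega rho Du) :
  exists2 alpha : R, 0 < alpha < 1 & locally_hoelder Omega alpha u.
Proof.
have mO := open_measurable_plane Omega_open.
have [sigma ss] := exists_smooth_step rho_spec.
have [M hM] := step_derive_bounded ss.
have [hu hDu _] := u_gradient.
have mU i : measurable_fun Omega (component u i).
  by have [] := square_integrable_L2on mO (hu i).
have LD i j := square_integrable_L2on mO (hDu i j).
have k_itv s : 0 <= derive1 rho s <= gamma.
  by rewrite (rho'_ge0 rho_spec) (rho'_le rho_spec).
have k_sign s : 0 <= derive1 rho s * s.
  have [s_le|s_gt] := leP s 0; first by rewrite (rho'_le0 rho_spec)// mul0r.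
  by rewrite mulr_ge0 ?(rho'_ge0 rho_spec)// ltW.
have k_cont : continuous (derive1 rho).
  exact/smooth1_continuous/smooth1_derive/(rho_smooth rho_spec).
(* The smooth functions from the definition of the trace approximate Du' in
   L^2; replacing Du' by Du changes the integrals by nothing. *)
have [_ [_ [Du' [w [u_gradient' sw wu wDu _]]]]] := u_admissible.
have approx (e : R) : 0 < e -> exists w : 'I_2 -> plane R -> R,
    [/\ forall i, smooth2 (w i),
      forall i, (sqint Omega (fun x => w i x - component u i x)%R <= e%:E)%E &
      forall i j, (sqint Omega (fun x => partial j (w i) x - Du x i j)%R <= e%:E)%E].
  move=> e0.
  have cu i := Lnorm_cvg0_sqint mO e0 (wu i).
  have cD i j := Lnorm_cvg0_sqint mO e0 (wDu i j).
  have {}cu : \forall n \near \oo, forall i,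
      (sqint Omega (component (w n) i \- component u i)%R <= e%:E)%E.
    exact: filter_forall.
  have {}cD : \forall n \near \oo, forall i j,
      (sqint Omega (entry (gradient (w n)) i j \- entry Du' i j)%R <= e%:E)%E.
    by apply: filter_forall => i; exact: filter_forall.
  have [n [hun hDn]] := filter_ex (filterI cu cD).
  exists (fun i => component (w n) i); split => //.
  move=> i j; apply: le_trans (hDn i j).
  have sp : smooth2 (partial j (component (w n) i)) by exact/smooth2_partial.
  have mp : measurable_fun Omega (partial j (component (w n) i)).
    by apply: measurable_funTS; apply: continuous_measurable_plane; exact: smooth2_continuous.
  have [_ hDu' _] := u_gradient'.
  have eg : entry (gradient (w n)) i j = partial j (component (w n) i).
    by apply/funext => x; rewrite /entry mxE.
  rewrite le_eqVlt; apply/orP; left; apply/eqP; apply: ae_eq_integral => //.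
  - apply: measurable_sqr; apply: measurable_funB => //; by have [] := LD i j.
  - apply: measurable_sqr; rewrite eg; apply: measurable_funB => //.
    by have [] := square_integrable_L2on mO (hDu' i j).
  have := weak_gradient_unique i j Omega_open Omega_bounded ss u_gradient u_gradient'.
  apply: (@filterS _ _ (ae_filter_ringOfSetsType (leb2 R))) => x h Ox.
  by rewrite eg /entry h.
have bound := @campanato_bound R Omega sigma (derive1 rho) M gamma Du Omega_open ss hM
  k_itv k_sign k_cont LD u_stationary (component u) mU approx.
set theta := decay_rate M gamma in bound.
have th : 4^-1 < theta < 1 by rewrite decay_rate_gt decay_rate_lt1.
have B0 : 0 <= 64 * (energy Du Omega + 1).
  by rewrite mulr_ge0// addr_ge0// energy_ge0.
have rep i := campanato_hoelder Omega_open (mU i) th B0 (bound i).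
pose good (i : 'I_2) (vi : plane R -> R) :=
  {ae leb2 R, forall x, Omega x -> vi x = component u i x} /\
  forall K, compact K -> K `<=` Omega -> exists2 C, 0 <= C &
    forall x y, K x -> K y ->
      `|vi x - vi y| <= C * enorm (x - y) `^ exponent theta.
have good_ex i : exists vi, good i vi by have [vi h1 h2] := rep i; exists vi.
have [v vP] := choice good_ex.
exists (exponent theta); first exact: exponent_itv.
exists (fun x => \col_i v i x); split.
  have ae_filter := ae_filter_ringOfSetsType (leb2 R).
  have := @filterI _ _ ae_filter _ _ (vP 0).1 (vP 1).1.
  apply: (@filterS _ _ ae_filter) => x [h0 h1] Ox.
  apply/matrixP => i j; rewrite ord1 mxE.
  by case: (ord2 i) => ->; [rewrite h0|rewrite h1].
move=> K cK KO.
have [C0 C00 hC0] := (vP 0).2 K cK KO; have [C1 C10 hC1] := (vP 1).2 K cK KO.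
exists (C0 + C1) => x y Kx Ky.
have frob (a b : R) : Num.sqrt (a ^+ 2 + b ^+ 2) <= `|a| + `|b|.
  rewrite -[leRHS]ger0_norm ?addr_ge0// -sqrtr_sqr ler_wsqrtr//.
  by rewrite sqrrD !real_normK ?num_real// lerD2r lerDl mulrn_wge0// mulr_ge0.
have -> : frobenius_norm ((\col_i v i x) - (\col_i v i y)) =
    Num.sqrt ((v 0 x - v 0 y) ^+ 2 + (v 1 x - v 1 y) ^+ 2).
  by rewrite /frobenius_norm /frobenius sum_ord2 !big_ord1 !mxE !expr2.
apply: (le_trans (frob _ _)); rewrite mulrDl.
by apply: lerD; [exact: hC0|exact: hC1].
Qed.
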